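(* Let $E=(d_0,d_1)$ with $-\infty\le d_0<d_1\le\infty$, equipped with Lebesgue measure, and $L^1=L^1(E)$. Let $g\colon E\to\mathbb{R}$ be continuous and strictly positive, let $\varphi\ge0$ be Borel measurable and integrable on compact subsets of $E$, define $G,Q$ as in the context, and assume $G(d_1)=+\infty$ and $Q(d_1)=+\infty$. Let $P\colon L^1\to L^1$ be a stochastic operator, let $A$, $\mathcal{D}(A)$, $\{P(t)\}_{t\ge0}$, $R_0$ and $K=P(\varphi R_0)$ be as in the context. Then: (i) If $K$ has an invariant density $v_*$ with $v_*>0$ a.e., then $\{P(t)\}_{t\ge0}$ is a stochastic semigroup. If moreover $\{P(t)\}_{t\ge0}$ is partially integral and $R_0v_*\in L^1$, then $\{P(t)\}_{t\ge0}$ is asymptotically stable with invariant density $u_*=R_0v_*/\|R_0v_*\|$. (ii) Conversely, if $\{P(t)\}_{t\ge0}$ has an invariant density $u_*\in\mathcal{D}(A)$, then the density $P(\varphi u_* )/\|\varphi u_*\|$ is invariant for $K$.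
   Context: $G(x)=\int_{x_0}^x\frac{dz}{g(z)}$, $Q(x)=\int_{x_1}^x\frac{\varphi(z)}{g(z)}dz$, where $x_0=d_0$ (resp. $x_1=d_0$) if the corresponding integral is finite for all $x\in E$, otherwise a fixed point of $E$; $G(d_1),Q(d_1)$ are the limits as $x\uparrow d_1$. $AC$ is the space of absolutely continuous functions on $E$. $Au=-\frac{d}{dx}(gu)-\varphi u$ with $\mathcal{D}(A)=\{u\in L^1: gu\in AC,\ \frac{d}{dx}(gu)\in L^1,\ \lim_{x\downarrow d_0}g(x)u(x)=0,\ \varphi u\in L^1\}$; under $G(d_1)=+\infty$ it generates a positive strongly continuous contraction semigroup on $L^1$ with resolvent $R(\lambda,A)$. $\{P(t)\}_{t\ge0}$ is the minimal positive strongly continuous contraction semigroup on $L^1$ whose generator $C$ extends the operator $u\mapsto Au+P(\varphi u)$, $u\in\mathcal{D}(A)$; its generator is characterized by $R(\lambda,C)u=\lim_{N\to\infty}R(\lambda,A)\sum_{n=0}^N(P(\varphi R(\lambda,A)))^nu$ for $u\in L^1$, $\lambda>0$. $R_0v(x)=\int_{d_0}^{d_1}\mathbf{1}_{(d_0,x)}(y)\frac{e^{Q(y)-Q(x)}}{g(x)}v(y)\,dy$ (defined for $v$ with $R_0v\in L^1$); $\varphi R_0$ extends uniquely by the same formula to a positive contraction on $L^1$, and $K u=P(\varphi R_0u)$, $u\in L^1$. A density is a nonnegative element of $L^1$ of norm $1$; a stochastic operator maps densities to densities; a stochastic semigroup is a strongly continuous semigroup of stochastic operators. A density $u$ is invariant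 for an operator $T$ if $Tu=u$, and for a semigroup if $P(t)u=u$ for all $t\ge 0$. $\{P(t)\}$ is asymptotically stable if there is an invariant density $u_*$ with $\|P(t)u-u_*\|\to0$ for every density $u$. $\{P(t)\}$ is partially integral if for some $t_0>0$ there is a measurable $p\colon E\times E\to[0,\infty)$ with $\iint p(x,y)\,dy\,dx>0$ and $P(t_0)u(x)\ge\int_E p(x,y)u(y)\,dy$ for every density $u$. *)

(* Defs.v *)
From HB Require Import structures.
From mathcomp Require Import all_boot all_order all_algebra.
From mathcomp Require Import all_classical all_reals all_analysis.
From Stdlib Require Import ClassicalEpsilon.
Set Implicit Arguments. Unset Strict Implicit. Unset Printing Implicit Defensive.
Import Order.TTheory GRing.Theory Num.Theory.
Import numFieldNormedType.Exports.
Local Open Scope classical_set_scope.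
Local Open Scope ring_scope.

(* Elements of L^1(E) are represented by functions R -> R (only their values
   on E matter, up to Lebesgue-a.e. equality on E); operators on L^1 are
   maps (R -> R) -> (R -> R) required to respect a.e. equality. *)

Definition Eset (R : realType) (d0 d1 : \bar R) : set R :=
  [set x | (d0 < x%:E)%E /\ (x%:E < d1)%E].

Definition lebm (R : realType) := (@lebesgue_measure R).
Arguments lebm : clear implicits.

Definition aeE (R : realType) (d0 d1 : \bar R) (u v : R -> R) : Prop :=
  {ae lebm R, forall x, Eset d0 d1 x -> u x = v x}.

Definition L1 (R : realType) (d0 d1 : \bar R) (u : R -> R) : Prop :=
  (lebm R).-integrable (Eset d0 d1) (EFin \o u).

Definition norm1 (R : realType) (d0 d1 : \bar R) (u : R -> R) : R :=
  fine (\int[lebm R]_(x in Eset d0 d1) (`|u x|)%:E)%E.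

Definition nonneg_ae (R : realType) (d0 d1 : \bar R) (u : R -> R) : Prop :=
  {ae lebm R, forall x, Eset d0 d1 x -> 0 <= u x}.

Definition pos_ae (R : realType) (d0 d1 : \bar R) (u : R -> R) : Prop :=
  {ae lebm R, forall x, Eset d0 d1 x -> 0 < u x}.

Definition density (R : realType) (d0 d1 : \bar R) (u : R -> R) : Prop :=
  L1 d0 d1 u /\ nonneg_ae d0 d1 u /\ norm1 d0 d1 u = 1.

Definition L1op (R : realType) (d0 d1 : \bar R) (T : (R -> R) -> (R -> R)) : Prop :=
  [/\ (forall u, L1 d0 d1 u -> L1 d0 d1 (T u)),
      (forall u v, L1 d0 d1 u -> L1 d0 d1 v -> aeE d0 d1 u v ->
         aeE d0 d1 (T u) (T v)) &
      (forall (a b : R) u v, L1 d0 d1 u -> L1 d0 d1 v ->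
         aeE d0 d1 (T (fun x => a * u x + b * v x))
                   (fun x => a * T u x + b * T v x))].

Definition positive_op (R : realType) (d0 d1 : \bar R) (T : (R -> R) -> (R -> R)) :=
  forall u, L1 d0 d1 u -> nonneg_ae d0 d1 u -> nonneg_ae d0 d1 (T u).

Definition contraction_op (R : realType) (d0 d1 : \bar R) (T : (R -> R) -> (R -> R)) :=
  forall u, L1 d0 d1 u -> norm1 d0 d1 (T u) <= norm1 d0 d1 u.

Definition stochastic_op (R : realType) (d0 d1 : \bar R) (T : (R -> R) -> (R -> R)) :=
  L1op d0 d1 T /\ (forall u, density d0 d1 u -> density d0 d1 (T u)).

Definition semigroup_law (R : realType) (d0 d1 : \bar R) (Pt : R -> (R -> R) -> (R -> R)) :=
  (forall u, L1 d0 d1 u -> aeE d0 d1 (Pt 0 u) u) /\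
  (forall s t u, 0 <= s -> 0 <= t -> L1 d0 d1 u ->
     aeE d0 d1 (Pt (s + t) u) (Pt s (Pt t u))).

Definition strongly_continuous (R : realType) (d0 d1 : \bar R) (Pt : R -> (R -> R) -> (R -> R)) :=
  forall u, L1 d0 d1 u ->
    (fun t => norm1 d0 d1 (fun x => Pt t u x - u x)) @ 0^'+ --> 0.

Definition pos_sc_contraction_semigroup (R : realType) (d0 d1 : \bar R)
    (Pt : R -> (R -> R) -> (R -> R)) :=
  [/\ semigroup_law d0 d1 Pt,
      (forall t, 0 <= t ->
         [/\ L1op d0 d1 (Pt t), positive_op d0 d1 (Pt t) & contraction_op d0 d1 (Pt t)]) &
      strongly_continuous d0 d1 Pt].

Definition stochastic_semigroup (R : realType) (d0 d1 : \bar R) (Pt : R -> (R -> R) -> (R -> R)) :=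
  [/\ semigroup_law d0 d1 Pt,
      (forall t, 0 <= t -> stochastic_op d0 d1 (Pt t)) &
      strongly_continuous d0 d1 Pt].

Definition generator (R : realType) (d0 d1 : \bar R) (Pt : R -> (R -> R) -> (R -> R))
    (u w : R -> R) : Prop :=
  [/\ L1 d0 d1 u, L1 d0 d1 w &
      (fun t => norm1 d0 d1 (fun x => (Pt t u x - u x) / t - w x)) @ 0^'+ --> 0].

Definition at_d0 (R : realType) (d0 : \bar R) : set_system R :=
  match d0 with
  | EFin r => r^'+
  | -oo%E => ninfty_nbhs R
  | +oo%E => pinfty_nbhs R
  end.

Definition at_d1 (R : realType) (d1 : \bar R) : set_system R :=
  match d1 with
  | EFin r => r^'-
  | +oo%E => pinfty_nbhs R
  | -oo%E => ninfty_nbhs R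
  end.

(* u \in D(A) and w = d/dx (g u): g u has an absolutely continuous version h
   on E with derivative w \in L^1, i.e. h x - h y = \int_y^x w, and
   lim_{x -> d0+} g u = 0; moreover phi u \in L^1. *)
Definition DA_deriv (R : realType) (d0 d1 : \bar R) (g phi : R -> R) (u w : R -> R) : Prop :=
  [/\ L1 d0 d1 u, L1 d0 d1 w, L1 d0 d1 (fun x => phi x * u x) &
      exists h : R -> R,
        [/\ aeE d0 d1 h (fun x => g x * u x),
            (forall x y, Eset d0 d1 x -> Eset d0 d1 y -> y <= x ->
               h x - h y = Rintegral (lebm R) `[y, x] w) &
            h @ at_d0 d0 --> 0]].

Definition inDA (R : realType) (d0 d1 : \bar R) (g phi : R -> R) (u : R -> R) : Prop :=
  exists w, DA_deriv d0 d1 g phi u w.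

Definition Arel (R : realType) (d0 d1 : \bar R) (g phi : R -> R) (u z : R -> R) : Prop :=
  exists w, DA_deriv d0 d1 g phi u w /\
            aeE d0 d1 z (fun x => - w x - phi x * u x).

Definition is_resolventA (R : realType) (d0 d1 : \bar R) (g phi : R -> R)
    (lam : R) (u v : R -> R) : Prop :=
  exists z, Arel d0 d1 g phi v z /\ aeE d0 d1 (fun x => lam * v x - z x) u.

Definition RA (R : realType) (d0 d1 : \bar R) (g phi : R -> R) (lam : R)
    (u : R -> R) : R -> R :=
  epsilon (inhabits (fun _ : R => 0)) (is_resolventA d0 d1 g phi lam u).

Definition stepPA (R : realType) (d0 d1 : \bar R) (g phi : R -> R)
    (P : (R -> R) -> (R -> R)) (lam : R) (v : R -> R) : R -> R :=
  P (fun x => phi x * RA d0 d1 g phi lam v x).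

Definition partial_res (R : realType) (d0 d1 : \bar R) (g phi : R -> R)
    (P : (R -> R) -> (R -> R)) (lam : R) (N : nat) (u : R -> R) : R -> R :=
  RA d0 d1 g phi lam
     (fun x => \sum_(n < N.+1) iter n (stepPA d0 d1 g phi P lam) u x).

(* {P(t)} is the minimal positive strongly continuous contraction semigroup
   whose generator C extends A + P phi, characterized by
   R(lam,C) u = lim_N R(lam,A) \sum_{n<=N} (P(phi R(lam,A)))^n u. *)
Definition minimal_semigroup (R : realType) (d0 d1 : \bar R) (g phi : R -> R)
    (P : (R -> R) -> (R -> R)) (Pt : R -> (R -> R) -> (R -> R)) : Prop :=
  pos_sc_contraction_semigroup d0 d1 Pt /\
  forall lam, 0 < lam -> forall u, L1 d0 d1 u ->
    exists w z, [/\ generator d0 d1 Pt w z,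
                    aeE d0 d1 (fun x => lam * w x - z x) u &
                    (fun N => norm1 d0 d1 (fun x => partial_res d0 d1 g phi P lam N u x - w x))
                      @ \oo --> 0].

Definition Qdiff (R : realType) (g phi : R -> R) (y x : R) : R :=
  Rintegral (lebm R) `[y, x] (fun z => phi z / g z).

Definition R0 (R : realType) (d0 d1 : \bar R) (g phi : R -> R) (v : R -> R) : R -> R :=
  fun x => (g x)^-1 *
    Rintegral (lebm R) [set y | (d0 < y%:E)%E /\ y < x]
      (fun y => expR (- Qdiff g phi y x) * v y).

Definition Kop (R : realType) (d0 d1 : \bar R) (g phi : R -> R)
    (P : (R -> R) -> (R -> R)) (u : R -> R) : R -> R :=
  P (fun x => phi x * R0 d0 d1 g phi u x).

(* G(d1) = +oo  (for any base point c of E; finite shifts do not matter) *)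
Definition G_infinite (R : realType) (d0 d1 : \bar R) (g : R -> R) : Prop :=
  forall c, Eset d0 d1 c ->
    (fun x => \int[lebm R]_(z in `[c, x]) ((g z)^-1)%:E)%E @ at_d1 d1 --> +oo%E.

Definition Q_infinite (R : realType) (d0 d1 : \bar R) (g phi : R -> R) : Prop :=
  forall c, Eset d0 d1 c ->
    (fun x => \int[lebm R]_(z in `[c, x]) (phi z / g z)%:E)%E @ at_d1 d1 --> +oo%E.

Definition invariant_op (R : realType) (d0 d1 : \bar R) (T : (R -> R) -> (R -> R))
    (u : R -> R) : Prop :=
  density d0 d1 u /\ aeE d0 d1 (T u) u.

Definition invariant_sg (R : realType) (d0 d1 : \bar R) (Pt : R -> (R -> R) -> (R -> R))
    (u : R -> R) : Prop :=
  density d0 d1 u /\ forall t, 0 <= t -> aeE d0 d1 (Pt t u) u.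

Definition asympt_stable_with (R : realType) (d0 d1 : \bar R)
    (Pt : R -> (R -> R) -> (R -> R)) (ustar : R -> R) : Prop :=
  invariant_sg d0 d1 Pt ustar /\
  forall u, density d0 d1 u ->
    (fun t => norm1 d0 d1 (fun x => Pt t u x - ustar x)) @ pinfty_nbhs R --> 0.

Definition partially_integral (R : realType) (d0 d1 : \bar R)
    (Pt : R -> (R -> R) -> (R -> R)) : Prop :=
  exists t0 : R, 0 < t0 /\
  exists p : R -> R -> R,
    [/\ measurable_fun (Eset d0 d1 `*` Eset d0 d1) (fun xy : R * R => p xy.1 xy.2),
        (forall x y, Eset d0 d1 x -> Eset d0 d1 y -> 0 <= p x y),
        (0 < \int[lebm R]_(x in Eset d0 d1) \int[lebm R]_(y in Eset d0 d1) (p x y)%:E)%E &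
        forall u, density d0 d1 u ->
          {ae lebm R, forall x, Eset d0 d1 x ->
             (\int[lebm R]_(y in Eset d0 d1) (p x y * u y)%:E <= (Pt t0 u x)%:E)%E}].

(* Main.v *)
(* Let B = P (phi R(1,A)).  The resolvent of the generator C preserves the
   integral as soon as the integrals of the B^n u tend to 0.  Since B <= K, the
   iterates B^n vs of an invariant density of K decrease; the limit w satisfies
   B w = w, and the mass balance of R(1,A) forces w = 0.  As vs > 0, truncation
   by multiples of vs extends this to all u.  Moreover R0 vs is in the kernel of
   C when it is integrable, and a nonnegative fixed function dominates its
   resolvent R(1,A), which is positive near d1; so two fixed functions cannot have
   disjoint supports and the invariant density us is unique.

   For convergence, the kernel provides a set Y of positive measure such that
   two nonnegative functions with mass on Y have overlapping images at time t0.
   If P(t) f did not tend to 0 for some f of integral 0 with |f| <= M us,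
   the positive and negative parts of P(t) f would become almost disjoint for all
   later times, and so would p and us - p for a truncation p of the positive part.
   By continuity in time one of the two would never carry much mass on Y.  A
   maximal function with no mass on Y along its orbit is, however, fixed, hence a
   multiple of us > 0, and therefore 0. *)

Require Import Defs.
From mathcomp Require Import all_boot all_order all_algebra.
From mathcomp Require Import all_classical all_reals all_analysis.
From mathcomp Require Import measurable_realfun.
From mathcomp Require Import ring lra.
From Stdlib Require ClassicalEpsilon.
Import Order.TTheory GRing.Theory Num.Theory.
Import numFieldNormedType.Exports.
Local Open Scope classical_set_scope.
Local Open Scope ring_scope.
Set Implicit Arguments. Unset Strict Implicit. Unset Printing Implicit Defensive.

(** * Integrals over E *)

(** Everything about [A] comes from one explicit formula. With [h = g u], the equation
    [(lam - A) u = v] reads [h' = v - ((lam + phi) / g) h], solved by an integral with exponential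
    kernel that vanishes at [d0]. Its integrated form and its uniqueness are obtained by bisection
    from second-order error bounds. The divergence of [G] (for [lam > 0]) or of [Q] (for [lam = 0])
    makes the flux vanish at [d1], so that no mass is lost there. The semigroup is given only
    through its resolvents: the extension of [A + P phi] and the conservation of mass are read off
    telescoping partial sums, and they reach every [u] because [u = w - z] with [z] the generator at
    [w]. In the stability part, functions between 0 and [us] stand in for sets: the semigroup maps
    this order interval to itself, and maxima and monotone limits stay inside it. A truncation
    [min (n * a) us] behaves like a set when doubling [n] hardly changes it, which is why the
    cut-offs run through powers of 2. *)

#[local] Instance lebm_ae_filter (R : realType) : Filter (nbhs (almost_everywhere (lebm R))).
Proof. exact: (ae_filter_ringOfSetsType (lebm R)). Qed.

Section AlmostEverywhere.
Context {R : realType} {d0 d1 : \bar R}.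
Implicit Types (Q : R -> Prop) (u v w : R -> R).

Local Notation AE Q := {ae lebm R, forall x, Eset d0 d1 x -> Q x}.

Lemma AE_all Q : (forall x, Eset d0 d1 x -> Q x) -> AE Q.
Proof. by move=> h; apply: aeW. Qed.

(** Membership in [E] is handed to the continuation, so facts valid only on [E] can be used under
    the almost-everywhere quantifier. *)
Lemma AE1 Q1 Q : AE Q1 -> (forall x, Eset d0 d1 x -> Q1 x -> Q x) -> AE Q.
Proof. by move=> h1 h; apply: filterS h1 => x q1 Ex; exact: h (q1 Ex). Qed.

Lemma AE2 Q1 Q2 Q : AE Q1 -> AE Q2 ->
  (forall x, Eset d0 d1 x -> Q1 x -> Q2 x -> Q x) -> AE Q.
Proof.
by move=> h1 h2 h; apply: filterS2 h1 h2 => x q1 q2 Ex; exact: h (q1 Ex) (q2 Ex).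
Qed.

Lemma AE3 Q1 Q2 Q3 Q : AE Q1 -> AE Q2 -> AE Q3 ->
  (forall x, Eset d0 d1 x -> Q1 x -> Q2 x -> Q3 x -> Q x) -> AE Q.
Proof.
move=> h1 h2 h3 h; apply: filterS3 h1 h2 h3 => x q1 q2 q3 Ex.
exact: h (q1 Ex) (q2 Ex) (q3 Ex).
Qed.

Lemma AE_foralln (Q : nat -> R -> Prop) :
  (forall n, AE (Q n)) -> AE (fun x => forall n, Q n x).
Proof.
move=> h; have /ae_foralln : forall n, {ae lebm R, forall x, Eset d0 d1 x -> Q n x} by [].
by apply: filterS => x hx Ex n; exact: hx.
Qed.

Lemma aeE_refl u : aeE d0 d1 u u. Proof. exact: AE_all. Qed.
Lemma aeE_sym u v : aeE d0 d1 u v -> aeE d0 d1 v u.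
Proof. by move=> h; refine (AE1 h _) => x _ ->. Qed.
Lemma aeE_trans v u w : aeE d0 d1 u v -> aeE d0 d1 v w -> aeE d0 d1 u w.
Proof. by move=> h k; refine (AE2 h k _) => x _ -> ->. Qed.

Lemma open_Eset : open (Eset d0 d1).
Proof.
have -> : Eset d0 d1 = [set x | (d0 < x%:E)%E] `&` [set x | (x%:E < d1)%E].
  by apply/seteqP; split.
apply: openI.
- case: d0 => [r||].
  + rewrite (_ : mkset _ = [set x | r < x]); first exact: open_gt.
    by apply/seteqP; split => x /=; rewrite lte_fin.
  + rewrite (_ : mkset _ = set0); first exact: open0.
    by apply/seteqP; split => x //=; rewrite ltNge leey.
  + rewrite (_ : mkset _ = setT); first exact: openT.
    by apply/seteqP; split => x //= _; rewrite ltNyr.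
- case: d1 => [r||].
  + rewrite (_ : mkset _ = [set x | x < r]); first exact: open_lt.
    by apply/seteqP; split => x /=; rewrite lte_fin.
  + rewrite (_ : mkset _ = setT); first exact: openT.
    by apply/seteqP; split => x //= _; rewrite ltry.
  + rewrite (_ : mkset _ = set0); first exact: open0.
    by apply/seteqP; split => x //=; rewrite ltNge leNye.
Qed.

Lemma mEset : measurable (Eset d0 d1).
Proof. exact: open_measurable open_Eset. Qed.

Lemma Eset_convex a b x : Eset d0 d1 a -> Eset d0 d1 b -> a <= x <= b ->
  Eset d0 d1 x.
Proof.
move=> [a0 a1] [b0 b1] /andP[ax xb]; split.
  by apply: lt_le_trans a0 _; rewrite lee_fin.
by apply: le_lt_trans b1; rewrite lee_fin.
Qed.

Lemma sub_Eset a b : Eset d0 d1 a -> Eset d0 d1 b -> `[a, b] `<=` Eset d0 d1.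
Proof. by move=> Ea Eb x /=; rewrite in_itv /=; exact: Eset_convex. Qed.

End AlmostEverywhere.
Notation AE d0 d1 Q := {ae lebm _, forall x, Eset d0 d1 x -> Q x}.

Section Integral.
Context {R : realType} {d0 d1 : \bar R}.
Implicit Types u v w : R -> R.
Let E := Eset d0 d1.
Let mE : measurable E := mEset.

(* Locked, so that unification never unfolds integrals. *)
Fact J_key : unit. Proof. exact: tt. Qed.
Definition J : (R -> R) -> R :=
  locked_with J_key (fun u => Rintegral (lebm R) (Eset d0 d1) u).

Lemma JE u : J u = Rintegral (lebm R) (Eset d0 d1) u.
Proof. by rewrite /J unlock. Qed.

Lemma norm1E u : norm1 d0 d1 u = J (fun x => `|u x|).
Proof. by rewrite JE. Qed.

Lemma L1_meas u : L1 d0 d1 u -> measurable_fun E u.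
Proof. by case/integrableP => /measurable_EFinP. Qed.

Lemma L1_eqE u v : (forall x, E x -> u x = v x) -> L1 d0 d1 u -> L1 d0 d1 v.
Proof.
move=> uv; apply: eq_integrable => // x; rewrite inE /= => Ex.
by rewrite uv.
Qed.

Lemma L1_0 : L1 d0 d1 (fun=> 0).
Proof. exact: integrable0. Qed.

Lemma L1Z c u : L1 d0 d1 u -> L1 d0 d1 (fun x => c * u x).
Proof. by move=> Lu; have := @integrableZl _ _ _ (lebm R) E mE c _ Lu. Qed.

Lemma L1D u v : L1 d0 d1 u -> L1 d0 d1 v -> L1 d0 d1 (fun x => u x + v x).
Proof. by move=> Lu Lv; have := @integrableD _ _ _ (lebm R) E mE _ _ Lu Lv. Qed.

Lemma L1N u : L1 d0 d1 u -> L1 d0 d1 (fun x => - u x).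
Proof. by move=> /(L1Z (-1)); apply: L1_eqE => x _; rewrite mulN1r. Qed.

Lemma L1B u v : L1 d0 d1 u -> L1 d0 d1 v -> L1 d0 d1 (fun x => u x - v x).
Proof. by move=> Lu /L1N; exact: L1D. Qed.

Lemma L1_comb a b u v : L1 d0 d1 u -> L1 d0 d1 v ->
  L1 d0 d1 (fun x => a * u x + b * v x).
Proof. by move=> Lu Lv; apply: L1D; exact: L1Z. Qed.

Lemma L1_abs u : L1 d0 d1 u -> L1 d0 d1 (fun x => `|u x|).
Proof. exact: integrable_norm. Qed.

Lemma L1_le u v : measurable_fun E u -> L1 d0 d1 v ->
  (forall x, E x -> `|u x| <= v x) -> L1 d0 d1 u.
Proof.
move=> mu Lv uv; apply: le_integrable Lv => //; first exact/measurable_EFinP.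
by move=> x Ex /=; rewrite lee_fin (le_trans (uv x Ex))// ler_norm.
Qed.

Lemma L1_aele u v : measurable_fun E u -> L1 d0 d1 v ->
  AE d0 d1 (fun x => `|u x| <= v x) -> L1 d0 d1 u.
Proof.
move=> mu Lv uv; have Lw := L1_abs Lv.
apply/integrableP; split; first exact/measurable_EFinP.
have /integrableP[_] := Lw; apply: le_lt_trans.
apply: ae_ge0_le_integral => //.
  by apply: measurableT_comp => //; exact/measurable_EFinP.
apply: measurableT_comp => //; apply/measurable_EFinP; exact (L1_meas Lw).
refine (AE1 uv _) => x _ h /=; rewrite lee_fin (le_trans h)// normr_id; exact: ler_norm.
Qed.

Lemma L1_max u v : L1 d0 d1 u -> L1 d0 d1 v -> L1 d0 d1 (fun x => Num.max (u x) (v x)).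
Proof.
move=> Lu Lv; apply: (L1_le _ (L1D (L1_abs Lu) (L1_abs Lv))).
  by apply: measurable_maxr; exact: L1_meas.
by move=> x _; rewrite /Num.max; case: ifP => _; rewrite ?lerDl ?lerDr.
Qed.

Lemma L1_min u v : L1 d0 d1 u -> L1 d0 d1 v -> L1 d0 d1 (fun x => Num.min (u x) (v x)).
Proof.
move=> Lu Lv; apply: (L1_le _ (L1D (L1_abs Lu) (L1_abs Lv))).
  by apply: measurable_minr; exact: L1_meas.
by move=> x _; rewrite /Num.min; case: ifP => _; rewrite ?lerDl ?lerDr.
Qed.

Lemma JD u v : L1 d0 d1 u -> L1 d0 d1 v -> J (fun x => u x + v x) = J u + J v.
Proof. by rewrite !JE; exact: RintegralD. Qed.

Lemma JB u v : L1 d0 d1 u -> L1 d0 d1 v -> J (fun x => u x - v x) = J u - J v.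
Proof. by rewrite !JE; exact: RintegralB. Qed.

Lemma JZ c u : L1 d0 d1 u -> J (fun x => c * u x) = c * J u.
Proof. by rewrite !JE; exact: RintegralZl. Qed.

Lemma Jcomb a b u v : L1 d0 d1 u -> L1 d0 d1 v ->
  J (fun x => a * u x + b * v x) = a * J u + b * J v.
Proof. by move=> Lu Lv; rewrite JD ?JZ //; exact: L1Z. Qed.

Lemma J0 : J (fun=> 0) = 0.
Proof. by rewrite JE /Rintegral integral0. Qed.

Lemma J_ae u v : L1 d0 d1 u -> L1 d0 d1 v -> aeE d0 d1 u v -> J u = J v.
Proof.
move=> Lu Lv uv; rewrite !JE /Rintegral; congr fine; apply: ae_eq_integral.
- exact: mE.
- by apply/measurable_EFinP; exact: L1_meas.
- by apply/measurable_EFinP; exact: L1_meas.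
- by refine (AE1 uv _) => x _ /= ->.
Qed.

Lemma J_le u v : L1 d0 d1 u -> L1 d0 d1 v -> AE d0 d1 (fun x => u x <= v x) -> J u <= J v.
Proof.
move=> Lu Lv uv.
(* [max u v] is a version of [v] that dominates [u] at every point of [E], as [le_Rintegral]
   requires. *)
rewrite (@J_ae v (fun x => Num.max (u x) (v x))) //.
- rewrite !JE; apply: le_Rintegral => //; first exact: L1_max.
  by move=> x _; rewrite le_max lexx.
- exact: L1_max.
- by refine (AE1 uv _) => x _ h; rewrite max_r.
Qed.

Lemma J_ge0 u : L1 d0 d1 u -> nonneg_ae d0 d1 u -> 0 <= J u.
Proof. by move=> Lu u0; rewrite -J0; apply: J_le => //; exact: L1_0. Qed.

Lemma J_eq0 u : L1 d0 d1 u -> nonneg_ae d0 d1 u -> J u <= 0 -> aeE d0 d1 u (fun=> 0).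
Proof.
move=> Lu u0 Ju.
have Ju0 : J (fun x => `|u x|) = 0.
  apply/eqP; rewrite eq_le; apply/andP; split; last first.
    by apply: J_ge0 (L1_abs Lu) _; exact: AE_all.
  rewrite (le_trans _ Ju)// ; apply: J_le => //; first exact: L1_abs.
  by refine (AE1 u0 _) => x _ h; rewrite ger0_norm.
have mu : measurable_fun E (EFin \o u) by apply/measurable_EFinP; exact: L1_meas.
have /(ae_eq_integral_abs (lebm R) mE mu) : (\int[lebm R]_(x in E) `|(EFin \o u) x| = 0)%E.
  have /integrableP[_ ufin] := Lu.
  rewrite -[LHS]fineK; last by rewrite ge0_fin_numE ?integral_ge0.
  by congr EFin; rewrite -[RHS]Ju0 JE.
by move=> h; refine (AE1 h _) => x _ /= [].
Qed.

Lemma J_abs u : L1 d0 d1 u -> `|J u| <= J (fun x => `|u x|).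
Proof. by rewrite !JE; exact: le_normr_Rintegral. Qed.

(** Integrability of the [f_ n] and of [f] comes out of the bound by [g], so measurability is the
    only regularity to be supplied. *)
Lemma J_dct (f_ : nat -> R -> R) (f g : R -> R) :
  (forall n, measurable_fun E (f_ n)) -> measurable_fun E f -> L1 d0 d1 g ->
  AE d0 d1 (fun x => f_ ^~ x @ \oo --> f x) ->
  (forall n, AE d0 d1 (fun x => `|f_ n x| <= g x)) ->
  L1 d0 d1 f /\ (fun n => J (f_ n)) @ \oo --> J f.
Proof.
move=> mf_ mf Lg cf fg.
have Lf_ n : L1 d0 d1 (f_ n) by exact: L1_aele (fg n).
have [] := @dominated_convergence _ _ _ (lebm R) E mE (fun n => EFin \o f_ n) (EFin \o f) (EFin \o g).
- by move=> n; apply/measurable_EFinP; exact: mf_.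
- exact/measurable_EFinP.
- refine (AE1 cf _) => x _ h /=; apply: cvg_EFin; first by apply: nearW.
  exact: h.
- exact: Lg.
- have := AE_foralln fg; apply: filterS => x hx n Ex /=.
  by rewrite lee_fin; exact: hx.
move=> If _ c; split => //.
rewrite JE (_ : (fun n => J (f_ n)) = fun n => Rintegral (lebm R) E (f_ n)); last first.
  by apply/funext => n; rewrite JE.
by apply: (@fine_cvg _ _ _ _ (fun n => \int[lebm R]_(x in E) (EFin \o f_ n) x)%E);
  rewrite fineK ?integrable_fin_num.
Qed.

End Integral.
Arguments J {R} d0 d1 u.

Lemma RintegralE d (T : measurableType d) (R : realType) (mu : {measure set T -> \bar R})
  (D : set T) (f : T -> R) : Rintegral mu D f = fine (\int[mu]_(x in D) (f x)%:E)%E.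
Proof. by []. Qed.
Opaque Rintegral expR.

(** * Integrals over compact intervals and a bisection principle *)

Section IntervalIntegral.
Context {R : realType}.
Implicit Types (f q v : R -> R) (D : set R).

Notation itg D f := ((lebm R).-integrable D (EFin \o f)).

Fact I_key : unit. Proof. exact: tt. Qed.
Definition I : (R -> R) -> R -> R -> R :=
  locked_with I_key (fun f a b => Rintegral (lebm R) `[a, b] f).

Lemma IE f a b : I f a b = Rintegral (lebm R) `[a, b] f.
Proof. by rewrite /I unlock. Qed.

Lemma itg_meas D f : itg D f -> measurable_fun D f.
Proof. by case/integrableP => /measurable_EFinP. Qed.

Lemma itg_sub D D' f : measurable D -> measurable D' -> D' `<=` D -> itg D f -> itg D' f.
Proof. by move=> mD mD' DD'; exact: integrableS. Qed.

Lemma itgZ D c f : measurable D -> itg D f -> itg D (fun x => c * f x).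
Proof. by move=> mD h; have := @integrableZl _ _ _ (lebm R) D mD c _ h. Qed.

Lemma itgD D f f' : measurable D -> itg D f -> itg D f' -> itg D (fun x => f x + f' x).
Proof. by move=> mD h h'; have := @integrableD _ _ _ (lebm R) D mD _ _ h h'. Qed.

Lemma itgB D f f' : measurable D -> itg D f -> itg D f' -> itg D (fun x => f x - f' x).
Proof.
move=> mD h h'; have /itgD := itgZ (-1) mD h' => /(_ _ mD h).
by apply: eq_integrable => // x _ /=; rewrite mulN1r addrC.
Qed.

Lemma itg_le D f g : measurable D -> measurable_fun D f -> itg D g ->
  (forall x, D x -> `|f x| <= g x) -> itg D f.
Proof.
move=> mD mf ig fg; apply: le_integrable ig => //; first exact/measurable_EFinP.
by move=> x Dx /=; rewrite lee_fin (le_trans (fg x Dx))// ler_norm.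
Qed.

Lemma itg_abs D f : itg D f -> itg D (fun x => `|f x|).
Proof. exact: integrable_norm. Qed.

Lemma itg_bmul D (h f : R -> R) (C : R) : measurable D -> measurable_fun D h -> itg D f ->
  (forall x, D x -> `|h x| <= C) -> itg D (fun x => h x * f x).
Proof.
move=> mD mh itf hC; apply: (@itg_le _ _ (fun x => C * `|f x|)) => //.
- by apply: measurable_funM => //; exact: itg_meas.
- by apply: itgZ => //; exact: itg_abs.
- by move=> x Dx; rewrite normrM ler_wpM2r// hC.
Qed.

Lemma I_ge0 f a b : (forall x, a <= x <= b -> 0 <= f x) -> 0 <= I f a b.
Proof. by move=> h; rewrite IE; apply: Rintegral_ge0 => x /=; rewrite in_itv /=; exact: h. Qed.

Lemma I_le f f' a b : itg `[a, b] f -> itg `[a, b] f' ->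
  (forall x, a <= x <= b -> f x <= f' x) -> I f a b <= I f' a b.
Proof.
move=> i i' h; rewrite !IE; apply: le_Rintegral => //.
Qed.

Lemma IB f f' a b : itg `[a, b] f -> itg `[a, b] f' ->
  I (fun x => f x - f' x) a b = I f a b - I f' a b.
Proof. by move=> i i'; rewrite !IE RintegralB. Qed.

Lemma IZ c f a b : itg `[a, b] f -> I (fun x => c * f x) a b = c * I f a b.
Proof. by move=> i; rewrite !IE RintegralZl. Qed.

Lemma eq_I f f' a b : (forall x, a <= x <= b -> f x = f' x) -> I f a b = I f' a b.
Proof.
by move=> h; rewrite !IE; apply: eq_Rintegral => x; rewrite inE /= in_itv /=; exact: h.
Qed.

Lemma I_norm f a b : itg `[a, b] f -> `|I f a b| <= I (fun x => `|f x|) a b.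
Proof. by move=> i; rewrite !IE; apply: le_normr_Rintegral. Qed.

(** Both closed intervals contain [b]; the double count is harmless because a point is null, which
    is what the passage through a half-open interval records. *)
Lemma I_split f a b c : a <= b -> b <= c -> itg `[a, c] f ->
  I f a c = I f a b + I f b c.
Proof.
move=> ab bc i; rewrite !IE.
have := @Rintegral_itvB R f (BLeft a) (BRight c) b i.
rewrite !bnd_simp => /(_ ab bc) h.
have ibc : itg `]b, c] f.
  apply: itg_sub i => //; move=> x /=; rewrite !in_itv /= => /andP[bx ->].
  by rewrite (le_trans ab (ltW bx)).
by rewrite -(Rintegral_itv_obnd_cbnd ibc) -h addrC subrK.
Qed.

Lemma I_cont f a b : a <= b -> itg `[a, b] f -> {within `[a, b], continuous (I f a)}.
Proof.
move=> ab; rewrite (_ : I f a = fun x => Rintegral (lebm R) `[a, x] f); last first.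
  by apply/funext => x; rewrite IE.
exact: parameterized_integral_continuous.
Qed.

(* Bisecting at the midpoints of F divides the bound by 2 at each step. *)
Lemma subadditive_le0 (F : R -> R) (D : R -> R -> R) C a b :
  a <= b -> {within `[a, b], continuous F} ->
  (forall x y, a <= x -> x <= y -> y <= b -> F x <= F y) ->
  (forall x y z, a <= x -> x <= y -> y <= z -> z <= b -> D x z <= D x y + D y z) ->
  (forall x y, a <= x -> x <= y -> y <= b -> D x y <= C * (F y - F x) ^+ 2) ->
  D a b <= 0.
Proof.
move=> ab cF ndF subD bD.
have main n x y : a <= x -> x <= y -> y <= b -> D x y <= C * (F y - F x) ^+ 2 / 2 ^+ n.
  elim: n x y => [|n IH] x y ax xy yb; first by rewrite expr0 divr1 bD.
  have [z] : exists2 z, z \in `[x, y] & F z = (F x + F y) / 2.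
    apply: IVT => //.
      apply: continuous_subspaceW cF => t /=; rewrite !in_itv /= => /andP[xt ty].
      by rewrite (le_trans ax xt) (le_trans ty yb).
    have Fxy := ndF _ _ ax xy yb.
    by rewrite min_l// max_r//; lra.
  rewrite in_itv /= => /andP[xz zy] Fz.
  rewrite (le_trans (subD x z y _ _ _ _))//.
  rewrite (le_trans (lerD (IH x z ax xz (le_trans zy yb)) (IH z y (le_trans ax xz) zy yb)))//.
  rewrite Fz [2 ^+ n.+1]exprS invfM.
  have -> : F y - (F x + F y) / 2 = (F y - F x) / 2 by lra.
  have -> : (F x + F y) / 2 - F x = (F y - F x) / 2 by lra.
  by rewrite le_eqVlt; apply/orP; left; apply/eqP; field.
rewrite leNgt; apply/negP => D0.
have K0 : 0 <= C * (F b - F a) ^+ 2.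
  by rewrite (le_trans (ltW D0))// bD.
set K := C * _ in K0 main *.
have [n nK] : exists n : nat, K / D a b < n%:R.
  exists (Num.truncn (K / D a b)).+1.
  by rewrite truncnS_gt.
have := main n a b (lexx _) ab (lexx _).
rewrite -/K leNgt => /negP; apply.
rewrite ltr_pdivrMr ?exprn_gt0// mulrC -ltr_pdivrMr//.
rewrite (lt_le_trans nK)// -natrX ler_nat.
exact/ltnW/ltn_expl.
Qed.

End IntervalIntegral.
Notation itg D f := ((lebm _).-integrable D (EFin \o f)).

(** * Exhaustion of E by compact intervals, and the filters at its ends *)

Section Exhaustion.
Context {R : realType} {d0 d1 : \bar R}.

Lemma exhaust_left (e : \bar R) (c : R) : (e < c%:E)%E ->
  exists a : nat -> R, [/\ forall n, (e < (a n)%:E)%E, forall n, a n <= c,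
    forall n m, (n <= m)%N -> a m <= a n &
    forall x, (e < x%:E)%E -> exists N, forall n, (N <= n)%N -> a n <= x].
Proof.
case: e => [r||] //; rewrite ?lte_fin => rc.
- exists (fun n => r + (c - r) / n.+1%:R); split.
  + by move=> n; rewrite lte_fin ltrDl divr_gt0// subr_gt0.
  + move=> n; rewrite -lerBrDl ler_pdivrMr// ler_peMr ?subr_ge0 ?(ltW rc)//.
    by rewrite ler1n.
  + move=> n m nm; rewrite lerD2l ler_wpM2l ?subr_ge0 ?(ltW rc)//.
    by rewrite lef_pV2 ?posrE// ler_nat.
  + move=> x; rewrite lte_fin => rx; exists (Num.truncn ((c - r) / (x - r))).+1 => n Nn.
    rewrite -lerBrDl ler_pdivrMr// mulrC -ler_pdivrMr ?subr_gt0//.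
    rewrite (le_trans (ltW (truncnS_gt _)))// ler_nat.
    exact: leq_trans Nn (leqnSn _).
- exists (fun n => c - n%:R); split.
  + by move=> n; rewrite ltNyr.
  + by move=> n; rewrite gerBl.
  + by move=> n m nm; rewrite lerD2l lerN2 ler_nat.
  + move=> x _; exists (Num.truncn (c - x)).+1 => n Nn.
    rewrite lerBlDl -lerBlDr (le_trans (ltW (truncnS_gt _)))// ler_nat //.
Qed.

Lemma exhaust_right (e : \bar R) (c : R) : (c%:E < e)%E ->
  exists b : nat -> R, [/\ forall n, ((b n)%:E < e)%E, forall n, c <= b n,
    forall n m, (n <= m)%N -> b n <= b m &
    forall x, (x%:E < e)%E -> exists N, forall n, (N <= n)%N -> x <= b n].
Proof.
rewrite -lteN2 => /= /exhaust_left[a [a0 ac am ax]].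
exists (fun n => - a n); split => //.
- by move=> n; rewrite -lteN2 /= opprK.
- by move=> n; rewrite lerNr.
- by move=> n m nm; rewrite lerN2 am.
- move=> x; rewrite -lteN2 /= => /ax[N hN]; exists N => n Nn.
  by rewrite lerNr hN.
Qed.

Lemma exists_between : (d0 < d1)%E -> exists c : R, Eset d0 d1 c.
Proof.
rewrite /Eset; case: d0 d1 => [r||] [s||] //=; rewrite ?lte_fin => h.
- by exists ((r + s) / 2); rewrite !lte_fin; lra.
- by exists (r + 1); rewrite lte_fin ltry; split => //; lra.
- by exists (s - 1); rewrite lte_fin ltNyr; split => //; lra.
- by exists 0; rewrite ltry ltNyr.
Qed.

Lemma exhaustion : (d0 < d1)%E -> exists a b : nat -> R,
  [/\ forall n, Eset d0 d1 (a n), forall n, Eset d0 d1 (b n), forall n, a n <= b n,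
      (forall n m, (n <= m)%N -> a m <= a n) /\ (forall n m, (n <= m)%N -> b n <= b m) &
      forall x, Eset d0 d1 x -> exists N, forall n, (N <= n)%N -> a n <= x <= b n].
Proof.
move=> /exists_between[c [c0 c1]].
have [a [a0 ac am ax]] := exhaust_left c0.
have [b [b0 bc bm bx]] := exhaust_right c1.
exists a, b; split => //.
- by move=> n; split => //; apply: le_lt_trans c1; rewrite lee_fin.
- by move=> n; split => //; apply: lt_le_trans c0 _; rewrite lee_fin.
- by move=> n; exact: le_trans (bc n).
- move=> x [x0 x1]; have [N hN] := ax _ x0; have [N' hN'] := bx _ x1.
  exists (maxn N N') => n; rewrite geq_max => /andP[h h'].
  by rewrite hN// hN'.
Qed.

(** The three-case filter at [d0] becomes a condition on initial pieces of [E], so that finite and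
    infinite ends are treated alike from here on. *)
Lemma at_d0P (U : set R) : (d0 < d1)%E ->
  at_d0 d0 U <-> exists2 c, Eset d0 d1 c & forall x, Eset d0 d1 x -> x <= c -> U x.
Proof.
move=> d01; have [e [e0 e1]] := exists_between d01.
have step c : (d0 < c%:E)%E -> (forall x, (d0 < x%:E)%E -> x <= c -> U x) ->
    exists2 c, Eset d0 d1 c & forall x, Eset d0 d1 x -> x <= c -> U x.
  move=> c0 h; exists (Num.min c e).
    split; first by rewrite /Num.min; case: ifP.
    by apply: le_lt_trans e1; rewrite lee_fin ge_min lexx orbT.
  by move=> x [x0 _]; rewrite le_min => /andP[xc _]; exact: h.
have back c : Eset d0 d1 c -> (forall x, Eset d0 d1 x -> x <= c -> U x) ->
    forall x, (d0 < x%:E)%E -> x <= c -> U x.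
  move=> [c0 c1] h x x0 xc; apply: h => //; split => //.
  by apply: le_lt_trans c1; rewrite lee_fin.
split.
- case: d0 d01 e0 step {back} => [r||] //= d01 e0 step.
  + rewrite /at_right => /nbhs_ballP[/= d d0' h].
    apply: (step (r + d / 2)); first by rewrite lte_fin ltrDl divr_gt0.
    move=> x; rewrite lte_fin => rx xd; apply: h => //.
    rewrite /ball /= ltr_distlC; apply/andP; split; lra.
  + move=> [M [_ hM]]; apply: (step (M - 1)); first by rewrite ltNyr.
    by move=> x _ xM; apply: hM; lra.
- move=> [c Ec] /(back c Ec); case: Ec => c0 _ {back step}.
  case: d0 c0 {d01 e0} => [r||] //= c0 h.
  + near=> x; apply: h.
      by rewrite lte_fin; near: x; exact: nbhs_right_gt.
    by near: x; apply: nbhs_right_ltW; rewrite -lte_fin.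
  + exists c; split; first exact: num_real.
    by move=> x xc; apply: h; [rewrite ltNyr|exact: ltW].
Unshelve. all: by end_near. Qed.

Lemma at_d1E (U : set R) : (d0 < d1)%E -> at_d1 d1 U ->
  exists2 c, Eset d0 d1 c & forall x, Eset d0 d1 x -> c <= x -> U x.
Proof.
move=> d01; have [e [e0 e1]] := exists_between d01.
have step c : (c%:E < d1)%E -> (forall x, (x%:E < d1)%E -> c <= x -> U x) ->
    exists2 c, Eset d0 d1 c & forall x, Eset d0 d1 x -> c <= x -> U x.
  move=> c0 h; exists (Num.max c e).
    split; last by rewrite /Num.max; case: ifP.
    by apply: lt_le_trans e0 _; rewrite lee_fin le_max lexx orbT.
  by move=> x [_ x1]; rewrite ge_max => /andP[xc _]; exact: h.
case: d1 d01 e1 step => [r||] //= d01 e1 step.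
- rewrite /at_left => /nbhs_ballP[/= d d0' h].
  apply: (step (r - d / 2)); first by rewrite lte_fin; lra.
  move=> x; rewrite lte_fin => rx xd; apply: h => //.
  rewrite /ball /= ltr_distlC; apply/andP; split; lra.
- move=> [M [_ hM]]; apply: (step (M + 1)); first by rewrite ltry.
  by move=> x _ xM; apply: hM; lra.
Qed.

Lemma measurable_fun_loc (f : R -> R) : (d0 < d1)%E ->
  (forall a b, Eset d0 d1 a -> Eset d0 d1 b -> measurable_fun `[a, b] f) ->
  measurable_fun (Eset d0 d1) f.
Proof.
move=> d01 mf; have [a [b [Ea Eb _ _ ab]]] := exhaustion d01.
have -> : Eset d0 d1 = \bigcup_n `[a n, b n]%classic.
  apply/seteqP; split => [x /ab[N hN]|x [n _ /=]].
    by exists N => //=; rewrite in_itv /= hN.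
  by rewrite in_itv /=; exact: Eset_convex.
by apply/measurable_fun_bigcup => [n|n]; [exact: measurable_itv|exact: mf].
Qed.

End Exhaustion.

(** * Variation of constants *)

(* lra fails on contexts with inequalities between extended reals. *)
Ltac rlra := repeat match goal with h : is_true (@Order.lt ereal_display _ _ _) |- _ => clear h end; lra.

Section LinearODE.
Context {R : realType} {d0 d1 : \bar R}.
Context (d01 : (d0 < d1)%E) (q : R -> R).
Context (itgq : forall a b, Eset d0 d1 a -> Eset d0 d1 b -> itg `[a, b] q).
Context (q0 : forall x, Eset d0 d1 x -> 0 <= q x).
Implicit Types u v : R -> R.
Local Notation E := (Eset d0 d1).

Definition below (x : R) : set R := [set y | (d0 < y%:E)%E /\ y < x].

Fact duhamel_key : unit. Proof. exact: tt. Qed.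
(** The solution of [h' = v - q h] that vanishes at [d0]. Locked for the same reason as [J]. *)
Definition duhamel : (R -> R) -> R -> R := locked_with duhamel_key
  (fun v x => Rintegral (lebm R) (below x) (fun y => expR (- I q y x) * v y)).

Local Notation H := duhamel.

Lemma HE v x : H v x = Rintegral (lebm R) (below x) (fun y => expR (- I q y x) * v y).
Proof. by rewrite /duhamel unlock. Qed.

(** An initial piece of [E] is again of the form [Eset], so the measurability results for [E] apply
    to it. *)
Lemma belowE x : below x = Eset d0 x%:E.
Proof. by apply/seteqP; split => y [h1 h2]; split => //; rewrite ?lte_fin// -lte_fin. Qed.

Lemma mbelow x : measurable (below x).
Proof. by rewrite belowE; exact: mEset. Qed.

Lemma below_sub x : E x -> below x `<=` E.
Proof.
move=> [_ x1] y [y0 yx]; split => //.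
by apply: lt_trans x1; rewrite lte_fin.
Qed.

Lemma Iq_ge0 a b : E a -> E b -> 0 <= I q a b.
Proof. by move=> Ea Eb; apply: I_ge0 => x xab; apply: q0; exact: Eset_convex xab. Qed.

Lemma Iq_split a b c : E a -> E c -> a <= b -> b <= c -> I q a c = I q a b + I q b c.
Proof. by move=> Ea Ec ab bc; apply: I_split => //; exact: itgq. Qed.

(** On [[a, x]] additivity gives [I q y x = I q a x - I q a y], so the kernel is the exponential of
    a continuous function of [y]. *)
Lemma mker_itv a b x : E a -> E x -> a <= b -> b <= x ->
  measurable_fun `[a, b] (fun y => expR (- I q y x)).
Proof.
move=> Ea Ex ab bx; have Eb : E b by apply: Eset_convex Ea Ex _; rewrite ab bx.
apply: measurableT_comp => //.
apply: (eq_measurable_fun (fun y => I q a y - I q a x)).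
  move=> y; rewrite inE /= in_itv /= => /andP[ay yb].
  rewrite (Iq_split Ea Ex ay (le_trans yb bx)); rlra.
apply: measurable_funB => //.
apply: subspace_continuous_measurable_fun; first exact: measurable_itv.
by apply: I_cont => //; exact: itgq.
Qed.

Lemma mker x : E x -> measurable_fun (below x) (fun y => expR (- I q y x)).
Proof.
move=> Ex; rewrite belowE; apply: measurable_fun_loc; first by case: Ex.
move=> a b [a0]; rewrite lte_fin => ax [b0]; rewrite lte_fin => bx.
have Ea : E a by apply: below_sub Ex _ _; split.
have [ab|ba] := leP a b; first by apply: mker_itv => //; exact: ltW.
rewrite (_ : [set` _] = set0); first exact: measurable_fun_set0.
by apply/seteqP; split => y //=; rewrite in_itv /= => /andP[h1 h2]; rlra.
Qed.

Lemma ker_le1 y x : E y -> E x -> `|expR (- I q y x)| <= 1.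
Proof. by move=> Ey Ex; rewrite ger0_norm ?expR_ge0// expR_le1 oppr_le0 Iq_ge0. Qed.

Lemma itg_ker v x : L1 d0 d1 v -> E x -> itg (below x) (fun y => expR (- I q y x) * v y).
Proof.
move=> Lv Ex; apply: (itg_bmul (C := 1)).
- exact: mbelow.
- exact: mker.
- by apply: itg_sub Lv; [exact: mEset|exact: mbelow|exact: below_sub].
- by move=> y yx; apply: ker_le1 => //; exact: below_sub yx.
Qed.

Lemma L1_itg v a b : L1 d0 d1 v -> E a -> E b -> itg `[a, b] v.
Proof.
move=> Lv Ea Eb; apply: itg_sub Lv; [exact: mEset|exact: measurable_itv|].
exact: sub_Eset.
Qed.

Lemma itg_ker_itv v a x : L1 d0 d1 v -> E a -> E x -> a <= x ->
  itg `[a, x] (fun y => expR (- I q y x) * v y).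
Proof.
move=> Lv Ea Ex ax; apply: (itg_bmul (C := 1)).
- exact: measurable_itv.
- exact: mker_itv.
- exact: L1_itg.
- by move=> y yx; apply: ker_le1 => //; exact: sub_Eset yx.
Qed.

(** The kernel is multiplicative: what has accumulated on [below a] is carried from [a] to [b] with
    the factor [expR (- I q a b)]. *)
Lemma H_split v a b : L1 d0 d1 v -> E a -> E b -> a <= b ->
  H v b = expR (- I q a b) * H v a + I (fun y => expR (- I q y b) * v y) a b.
Proof.
move=> Lv Ea Eb ab; rewrite !HE.
have -> : below b = below a `|` `[a, b[%classic.
  apply/seteqP; split => y /=.
    move=> [y0 yb]; have [ya|ay] := ltP y a; first by left.
    by right; rewrite in_itv /= ay yb.
  case=> [[y0 ya]|]; first by split => //; exact: lt_le_trans ab.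
  rewrite in_itv /= => /andP[ay yb]; split => //.
  by case: Ea => a0 _; apply: lt_le_trans a0 _; rewrite lee_fin.
have i1 : itg (below a) (fun y => expR (- I q y b) * v y).
  apply: itg_sub (itg_ker Lv Eb); [exact: mbelow|exact: mbelow|].
  by move=> y [y0 ya]; split => //; exact: lt_le_trans ab.
have i2 : itg `[a, b[ (fun y => expR (- I q y b) * v y).
  apply: itg_sub (itg_ker_itv Lv Ea Eb ab); [exact: measurable_itv|exact: measurable_itv|].
  by move=> y /=; rewrite !in_itv /= => /andP[-> /ltW ->].
rewrite Rintegral_setU.
- congr (_ + _); last by rewrite IE; exact: Rintegral_itv_bndo_bndc.
  rewrite -RintegralZl; [|exact: mbelow|exact: itg_ker].
  apply: eq_Rintegral => y; rewrite inE => -[y0 ya].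
  have Ey : E y by apply: below_sub Ea _ _; split.
  by rewrite (Iq_split Ey Eb (ltW ya) ab) opprD expRD mulrCA mulrA.
- exact: mbelow.
- exact: measurable_itv.
- rewrite (_ : _ `|` _ = below b); first exact: itg_ker.
  apply/seteqP; split => y /=.
    case=> [[y0 ya]|]; first by split => //; exact: lt_le_trans ab.
    rewrite in_itv /= => /andP[ay yb]; split => //.
    by case: Ea => a0 _; apply: lt_le_trans a0 _; rewrite lee_fin.
  move=> [y0 yb]; have [ya|ay] := ltP y a; first by left.
  by right; rewrite in_itv /= ay yb.
- apply/disj_setPS => y /= [[_ ya]]; rewrite in_itv /= => /andP[ay _].
  by rewrite ltNge ay in ya.
Qed.

Lemma H_comb c c' u v x : L1 d0 d1 u -> L1 d0 d1 v -> E x ->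
  H (fun y => c * u y + c' * v y) x = c * H u x + c' * H v x.
Proof.
move=> Lu Lv Ex; rewrite !HE -!RintegralZl; try exact: mbelow; try exact: itg_ker.
rewrite -RintegralD; try exact: mbelow; last first.
- by apply: itgZ; [exact: mbelow|exact: itg_ker].
- by apply: itgZ; [exact: mbelow|exact: itg_ker].
by apply: eq_Rintegral => y _; ring.
Qed.

Lemma H_ae u v x : L1 d0 d1 u -> L1 d0 d1 v -> aeE d0 d1 u v -> E x -> H u x = H v x.
Proof.
move=> Lu Lv uv Ex; rewrite !HE !RintegralE; congr fine; apply: ae_eq_integral.
- exact: mbelow.
- by apply/measurable_EFinP; exact: itg_meas (itg_ker Lu Ex).
- by apply/measurable_EFinP; exact: itg_meas (itg_ker Lv Ex).
- apply: filterS uv => y uv yx /=; rewrite uv//; exact: below_sub yx.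
Qed.

Lemma H_le u v x : L1 d0 d1 u -> L1 d0 d1 v -> AE d0 d1 (fun x => u x <= v x) ->
  E x -> H u x <= H v x.
Proof.
move=> Lu Lv uv Ex.
rewrite (@H_ae v (fun x => Num.max (u x) (v x))) //.
- rewrite !HE; apply: le_Rintegral; [exact: mbelow|exact: itg_ker|apply: itg_ker => //; exact: L1_max|].
  by move=> y _; rewrite ler_wpM2l ?expR_ge0// le_max lexx.
- exact: L1_max.
- by refine (AE1 uv _) => y _ h; rewrite max_r.
Qed.

Lemma H_0 x : H (fun=> 0) x = 0.
Proof.
rewrite HE (_ : (fun _ => _) = fun=> 0) ?RintegralE ?integral0//.
by apply/funext => y; rewrite mulr0.
Qed.

Lemma H_ge0 v x : L1 d0 d1 v -> nonneg_ae d0 d1 v -> E x -> 0 <= H v x.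
Proof. by move=> Lv v0 Ex; rewrite -(H_0 x); apply: H_le => //; exact: L1_0. Qed.

Lemma H_abs v x : L1 d0 d1 v -> E x -> `|H v x| <= H (fun y => `|v y|) x.
Proof.
move=> Lv Ex; rewrite !HE; apply: le_trans (@le_normr_Rintegral _ _ _ (lebm R) _ _ (mbelow x) (itg_ker Lv Ex)) _.
rewrite le_eqVlt; apply/orP; left; apply/eqP; apply: eq_Rintegral => y _.
by rewrite normrM (@ger0_norm _ (expR _)) ?expR_ge0.
Qed.

(** The tail is the one at the end [d0]: it becomes small there and approaches the full integral at
    [d1], and it bounds [H v] for nonnegative [v]. *)
Definition tail (v : R -> R) x : R := Rintegral (lebm R) (below x) v.

Lemma itg_below v x : L1 d0 d1 v -> E x -> itg (below x) v.
Proof.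
by move=> Lv Ex; apply: itg_sub Lv; [exact: mEset|exact: mbelow|exact: below_sub].
Qed.

Lemma subset_J v (A : set R) : measurable A -> A `<=` E -> L1 d0 d1 v ->
  (forall x, E x -> 0 <= v x) -> Rintegral (lebm R) A v <= J d0 d1 v.
Proof.
move=> mA AE Lv v0; rewrite JE !RintegralE; apply: fine_le.
- by apply: integrable_fin_num => //; apply: itg_sub Lv => //; exact: mEset.
- by apply: integrable_fin_num => //; exact: mEset.
- apply: ge0_subset_integral => //; first exact: mEset.
  by apply/measurable_EFinP; exact: L1_meas.
Qed.

Lemma H_le_tail v x : L1 d0 d1 v -> (forall x, E x -> 0 <= v x) -> E x ->
  H v x <= tail v x.
Proof.
move=> Lv v0 Ex; rewrite HE; apply: le_Rintegral; [exact: mbelow|exact: itg_ker|exact: itg_below|].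
move=> y yx; have Ey := below_sub Ex yx.
by rewrite ler_piMl ?v0// (le_trans (ler_norm _))// ker_le1.
Qed.

Lemma H_le_J v x : L1 d0 d1 v -> (forall x, E x -> 0 <= v x) -> E x ->
  H v x <= J d0 d1 v.
Proof.
move=> Lv v0 Ex; apply: le_trans (H_le_tail Lv v0 Ex) _.
by apply: subset_J => //; [exact: mbelow|exact: below_sub].
Qed.

(* Variation of constants: on [a, x] the kernel factors as a function of x times a function of y. *)
Lemma H_cont v a b : L1 d0 d1 v -> E a -> E b -> a <= b -> {within `[a, b], continuous (H v)}.
Proof.
move=> Lv Ea Eb ab.
have Ey y : y \in `[a, b] -> E y by rewrite in_itv /=; exact: Eset_convex.
have key : {in `[a, b]%classic, (fun x => expR (- I q a x) *
    (H v a + I (fun y => expR (I q a y) * v y) a x)) =1 H v}.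
  move=> x; rewrite inE /= => xab; have Ex := Ey _ xab.
  have [ax xb] : a <= x /\ x <= b by move: xab; rewrite in_itv /= => /andP[].
  rewrite (H_split Lv Ea Ex ax) mulrDr; congr (_ + _).
  rewrite -IZ; last first.
    apply: (itg_bmul (C := expR (I q a b))) => //.
    - apply: measurableT_comp => //.
      apply: subspace_continuous_measurable_fun; first exact: measurable_itv.
      by apply: I_cont => //; exact: itgq.
    - exact: L1_itg.
    - move=> y /=; rewrite in_itv /= => /andP[ay yx].
      rewrite ger0_norm ?expR_ge0// ler_expR.
      rewrite (Iq_split Ea Eb ay (le_trans yx xb)) lerDl Iq_ge0//.
      by apply: Ey; rewrite in_itv /= ay (le_trans yx xb).
  apply: eq_I => y /andP[ay yx].
  rewrite mulrA -expRD; congr (expR _ * _).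
  by rewrite (Iq_split Ea Ex ay yx); rlra.
have iq : itg `[a, b] (fun y => expR (I q a y) * v y).
  apply: (itg_bmul (C := expR (I q a b))) => //.
  - apply: measurableT_comp => //.
    apply: subspace_continuous_measurable_fun; first exact: measurable_itv.
    by apply: I_cont => //; exact: itgq.
  - exact: L1_itg.
  - move=> y /=; rewrite in_itv /= => /andP[ay yb].
    rewrite ger0_norm ?expR_ge0// ler_expR.
    rewrite (Iq_split Ea Eb ay yb) lerDl Iq_ge0//.
    by apply: Ey; rewrite in_itv /= ay yb.
apply: (subspace_eq_continuous (f := (fun x => expR (- I q a x) *
    (H v a + I (fun y => expR (I q a y) * v y) a x)) : subspace `[a, b] -> R)).
  exact: key.
have cq := I_cont ab (itgq Ea Eb); have cv := I_cont ab iq.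
set S := subspace _.
have c1 : continuous ((fun x => expR (- I q a x)) : S -> R).
  move=> x; apply: (@continuous_comp S R R (fun x => - I q a x) expR).
    by apply: (@continuousN R R S); exact: cq.
  exact: continuous_expR.
have c2 : continuous ((fun x => H v a + I (fun y => expR (I q a y) * v y) a x) : S -> R).
  by move=> x; exact: (@continuousD R R S (fun=> H v a) (I (fun y => expR (I q a y) * v y) a) x (cvg_cst _) (cv x)).
by move=> x; exact: (@continuousM R S _ _ x (c1 x) (c2 x)).
Qed.

Lemma H_meas_itv v a b : L1 d0 d1 v -> E a -> E b -> measurable_fun `[a, b] (H v).
Proof.
move=> Lv Ea Eb; have [ab|ba] := leP a b.
  apply: subspace_continuous_measurable_fun; first exact: measurable_itv.
  exact: H_cont.
rewrite (_ : [set` _] = set0); first exact: measurable_fun_set0.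
by apply/seteqP; split => y //=; rewrite in_itv /= => /andP[h1 h2]; rlra.
Qed.

Lemma H_meas v : L1 d0 d1 v -> measurable_fun E (H v).
Proof. by move=> Lv; apply: measurable_fun_loc => // a b; exact: H_meas_itv. Qed.

End LinearODE.

(** * The integrated differential equation of the variation-of-constants formula *)

Section DerivativeOfDuhamel.
Context {R : realType} {d0 d1 : \bar R}.
Context (d01 : (d0 < d1)%E) (q : R -> R).
Context (itgq : forall a b, Eset d0 d1 a -> Eset d0 d1 b -> itg `[a, b] q).
Context (q0 : forall x, Eset d0 d1 x -> 0 <= q x).
Implicit Types u v : R -> R.
Local Notation E := (Eset d0 d1).
Local Notation H := (@duhamel R d0 q).

Lemma itg_qk (k : R -> R) C a b : E a -> E b -> measurable_fun `[a, b] k ->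
  (forall x, a <= x <= b -> `|k x| <= C) -> itg `[a, b] (fun x => q x * k x).
Proof.
move=> Ea Eb mk kC.
have : itg `[a, b] (fun x => k x * q x).
  apply: (itg_bmul (C := C)) => //; exact: itgq.
by apply: eq_integrable => // x _ /=; rewrite mulrC.
Qed.

Lemma itg_qH v a b : L1 d0 d1 v -> E a -> E b -> itg `[a, b] (fun x => q x * H v x).
Proof.
move=> Lv Ea Eb; apply: (@itg_qk _ (J d0 d1 (fun y => `|v y|))) => //.
  exact: (H_meas_itv itgq q0).
move=> x /(Eset_convex Ea Eb) Ex; apply: le_trans (H_abs itgq q0 Lv Ex) _.
by apply: (H_le_J itgq q0) => //; exact: L1_abs.
Qed.

(** On a short interval, [e] is the decay factor [expR (- L)], [L] and [V] are the integrals of [q]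
    and [v], [h] and [hb] the values of [H v] at the two ends, and [S] the integral of [q * H v].
    All first-order terms cancel in [hb - h - V + S]. From [e * (1 + L) <= 1 <= (1 - L + L ^+ 2) *
    (1 + L)] the factor [e] agrees with [1 - L] up to [L ^+ 2]. *)
Lemma ode_defect (e L V h M S hb : R) : 0 <= L -> 0 <= V -> 0 <= h -> h <= M ->
  1 - L <= e -> e * (1 + L) <= 1 -> e <= 1 -> e * (h + V) <= hb -> hb <= e * h + V ->
  L * (e * h) <= S -> S <= L * (h + V) ->
  `|hb - h - V + S| <= (1 + M) * (L + V) ^+ 2.
Proof.
move=> L0 V0 h0 hM e1 e2 e3 hb1 hb2 S1 S2.
have M0 : 0 <= M by lra.
have B : h * L ^+ 2 + L * V <= (1 + M) * (L + V) ^+ 2.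
  have : h * L ^+ 2 <= M * L ^+ 2 by rewrite ler_wpM2r// sqr_ge0.
  have : 0 <= M * (V * L) by rewrite !mulr_ge0.
  have : 0 <= M * V ^+ 2 by rewrite mulr_ge0 ?sqr_ge0.
  have : 0 <= V * L by rewrite mulr_ge0.
  have := sqr_ge0 V; have := sqr_ge0 L; rewrite !expr2; nra.
rewrite (le_trans _ B)// ler_norml; apply/andP; split.
  have : h * (1 - L) * (1 + L) <= h * e * (1 + L) by rewrite ler_wpM2r ?ler_wpM2l//; lra.
  have : V * (1 - L) <= V * e by rewrite ler_wpM2l.
  by rewrite !expr2; nra.
have e4 : e <= 1 - L + L ^+ 2.
  have : e * (1 + L) <= (1 - L + L ^+ 2) * (1 + L).
    apply: le_trans e2 _; have : 0 <= L ^+ 3 by rewrite exprn_ge0.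
    rewrite !exprS expr0; lra.
  by rewrite ler_pM2r//; lra.
have : h * e <= h * (1 - L + L ^+ 2) by rewrite ler_wpM2l.
by rewrite !expr2; nra.
Qed.

(** The defect [D] of the equation is additive over adjacent intervals and quadratic in the
    increments of [I q a + I v a], so bisection applied to [D] and to [- D] kills it. Nonnegativity
    of [v] supplies the two-sided bounds that [ode_defect] asks for. *)
Lemma H_ode_nonneg v a b : L1 d0 d1 v -> (forall x, E x -> 0 <= v x) ->
  E a -> E b -> a <= b ->
  H v b - H v a = I v a b - I (fun x => q x * H v x) a b.
Proof.
move=> Lv v0 Ea Eb ab.
pose D x y := H v y - H v x - I v x y + I (fun x => q x * H v x) x y.
suff D0 : D a b = 0 by move: D0; rewrite /D => D0; rlra.
have M0 : 0 <= J d0 d1 v by apply: J_ge0 => //; exact: AE_all.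
have Ex x : a <= x -> x <= b -> E x.
  by move=> ax xb; apply: Eset_convex Ea Eb _; rewrite ax.
have addD x y z : a <= x -> x <= y -> y <= z -> z <= b -> D x z = D x y + D y z.
  move=> ax xy yz zb; rewrite /D.
  have Exx := Ex _ ax (le_trans xy (le_trans yz zb)).
  have Ez := Ex _ (le_trans ax (le_trans xy yz)) zb.
  rewrite (I_split xy yz (L1_itg Lv Exx Ez)) (I_split xy yz (itg_qH Lv Exx Ez)).
  rlra.
have bD x y : a <= x -> x <= y -> y <= b ->
    `|D x y| <= (1 + J d0 d1 v) * ((I q a y + I v a y) - (I q a x + I v a x)) ^+ 2.
  move=> ax xy yb; have Exx := Ex _ ax (le_trans xy yb).
  have Ey := Ex _ (le_trans ax xy) yb.
  rewrite (I_split ax xy (itgq Ea Ey)) (I_split ax xy (L1_itg Lv Ea Ey)).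
  rewrite (_ : _ - _ = I q x y + I v x y); last by rlra.
  have V0 : 0 <= I v x y by apply: I_ge0 => t /(Eset_convex Exx Ey) /v0.
  have L0 : 0 <= I q x y by apply: (Iq_ge0 q0).
  have e1 : expR (- I q x y) <= 1 by rewrite expR_le1 oppr_le0.
  have h0 z : E z -> 0 <= H v z.
    by move=> Ez; apply: (H_ge0 itgq) => //; exact: AE_all.
  have Iker s t : x <= s -> s <= t -> t <= y ->
      expR (- I q s t) * I v s t <= I (fun z => expR (- I q z t) * v z) s t <= I v s t.
    move=> xs st ty.
    have Es : E s by apply: Ex; [exact: le_trans xs|exact: le_trans (le_trans st ty) yb].
    have Et : E t by apply: Ex; [exact: le_trans (le_trans ax xs) st|exact: le_trans yb].
    have ik := itg_ker_itv itgq q0 Lv Es Et st.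
    have iv := L1_itg Lv Es Et.
    apply/andP; split.
      rewrite -IZ//; apply: I_le => //; first exact: itgZ.
      move=> z szt; have Ez := Eset_convex Es Et szt; case/andP: szt => sz zt.
      rewrite ler_wpM2r ?v0// ler_expR lerN2.
      by rewrite (Iq_split itgq Es Et sz zt) lerDr; apply: (Iq_ge0 q0).
    apply: I_le => // z szt; have Ez := Eset_convex Es Et szt.
    by rewrite ler_piMl ?v0// (le_trans (ler_norm _))// (ker_le1 q0 Ez Et).
  (* These bounds inside [[x, y]] turn the integral of [q * H v] into the two estimates on [S]. *)
  have Hz z : x <= z -> z <= y ->
      expR (- I q x y) * H v x <= H v z /\ H v z <= H v x + I v x y.
    move=> xz zy; have Ez : E z by apply: Eset_convex Exx Ey _; rewrite xz.
    have /andP[W1 W2] := Iker x z (lexx _) xz zy.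
    rewrite (H_split itgq q0 Lv Exx Ez xz).
    have L0' : 0 <= I q x z by apply: (Iq_ge0 q0).
    have V0' : 0 <= I v x z by apply: I_ge0 => t /(Eset_convex Exx Ez) /v0.
    have Lxy := Iq_split itgq Exx Ey xz zy.
    have Vxy := I_split xz zy (L1_itg Lv Exx Ey).
    have L2 : 0 <= I q z y by apply: (Iq_ge0 q0).
    have V2 : 0 <= I v z y by apply: I_ge0 => t /(Eset_convex Ez Ey) /v0.
    split.
      have A : expR (- I q x y) * H v x <= expR (- I q x z) * H v x.
        by rewrite ler_wpM2r ?h0// ler_expR; rlra.
      have B : 0 <= expR (- I q x z) * I v x z by rewrite mulr_ge0 ?expR_ge0.
      by rlra.
    have A : expR (- I q x z) * H v x <= H v x.
      by rewrite ler_piMl ?h0// expR_le1 oppr_le0.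
    by rlra.
  have /andP[W1 W2] := Iker x y (lexx _) xy (lexx _).
  have HM := H_le_J itgq q0 Lv v0 Exx.
  have Hb := H_split itgq q0 Lv Exx Ey xy.
  rewrite /D; apply: (@ode_defect (expR (- I q x y)) _ _ _ _ _ _ L0 V0 (h0 _ Exx) HM) => //.
  + have := expR_ge1Dx (- I q x y); rlra.
  + rewrite expRN mulrC ler_pdivrMr ?expR_gt0// mul1r; exact: expR_ge1Dx.
  + by rewrite Hb mulrDr; rlra.
  + by rewrite Hb; rlra.
  + rewrite mulrC -IZ ?itgq//; apply: I_le.
    * by apply: itgZ => //; exact: itgq.
    * exact: itg_qH.
    * move=> z xzy; have Ez := Eset_convex Exx Ey xzy; case/andP: xzy => xz zy.
      by rewrite mulrC ler_wpM2l ?q0//; case: (Hz z xz zy).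
  + rewrite mulrC -IZ ?itgq//; apply: I_le.
    * exact: itg_qH.
    * by apply: itgZ => //; exact: itgq.
    * move=> z xzy; have Ez := Eset_convex Exx Ey xzy; case/andP: xzy => xz zy.
      by rewrite [leRHS]mulrC ler_wpM2l ?q0//; case: (Hz z xz zy).
have cF : {within `[a, b], continuous (fun x => I q a x + I v a x)}.
  have c1 := I_cont ab (itgq Ea Eb); have c2 := I_cont ab (L1_itg Lv Ea Eb).
  by move=> x; exact: (@continuousD R R (subspace `[a, b]) _ _ x (c1 x) (c2 x)).
have ndF x y : a <= x -> x <= y -> y <= b -> I q a x + I v a x <= I q a y + I v a y.
  move=> ax xy yb; have Ey := Ex _ (le_trans ax xy) yb.
  have Exx := Ex _ ax (le_trans xy yb).
  rewrite (I_split ax xy (itgq Ea Ey)) (I_split ax xy (L1_itg Lv Ea Ey)).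
  apply: lerD; rewrite lerDl; first exact: (Iq_ge0 q0).
  by apply: I_ge0 => t /(Eset_convex Exx Ey) /v0.
apply/eqP; rewrite eq_le; apply/andP; split.
  apply: (subadditive_le0 ab cF ndF) => [x y z *|x y *].
    by rewrite (@addD x y z).
  by apply: le_trans (ler_norm _) _; exact: bD.
rewrite -oppr_le0; apply: (@subadditive_le0 R _ (fun x y => - D x y) _ a b ab cF ndF) => [x y z *|x y *].
  by rewrite (@addD x y z)// opprD.
by apply: le_trans (ler_norm _) _; rewrite normrN; exact: bD.
Qed.

Lemma H_ode v a b : L1 d0 d1 v -> E a -> E b -> a <= b ->
  H v b - H v a = I v a b - I (fun x => q x * H v x) a b.
Proof.
move=> Lv Ea Eb ab.
pose p x := Num.max (v x) 0; pose n x := Num.max (- v x) 0.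
have Lp : L1 d0 d1 p by apply: L1_max => //; exact: L1_0.
have Ln : L1 d0 d1 n by apply: L1_max; [exact: L1N|exact: L1_0].
have vE : v = (fun x => 1 * p x + (-1) * n x).
  apply/funext => x; rewrite /p /n /Num.max; case: ifPn; case: ifPn; rlra.
have HE x : E x -> H v x = H p x - H n x.
  by move=> Ex; rewrite vE (H_comb itgq q0 _ _ Lp Ln Ex); rlra.
have p0 x : 0 <= p x by rewrite /p le_max lexx orbT.
have n0 x : 0 <= n x by rewrite /n le_max lexx orbT.
have hp := H_ode_nonneg Lp (fun x _ => p0 x) Ea Eb ab.
have hn := H_ode_nonneg Ln (fun x _ => n0 x) Ea Eb ab.
have -> : I v a b = I p a b - I n a b.
  rewrite -IB; [|exact: (L1_itg Lp Ea Eb)|exact: (L1_itg Ln Ea Eb)].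
  by apply: eq_I => x _; rewrite {1}vE; rlra.
have -> : I (fun x => q x * H v x) a b =
    I (fun x => q x * H p x) a b - I (fun x => q x * H n x) a b.
  rewrite -IB; [|exact: itg_qH|exact: itg_qH].
  apply: eq_I => x /(Eset_convex Ea Eb) Ex.
  by rewrite HE// mulrBr.
rewrite !HE//; rlra.
Qed.

End DerivativeOfDuhamel.

Section RestrictionToSubsets.
Context {R : realType} {d0 d1 : \bar R}.
Implicit Types u v : R -> R.
Local Notation E := (Eset d0 d1).

Lemma meas_restrict v (A : set R) : measurable A -> A `<=` E -> measurable_fun A v ->
  measurable_fun E (v \_ A).
Proof.
move=> mA sA mv; apply/(measurable_restrict v mA (@mEset R d0 d1)).
by rewrite (setIidr sA).
Qed.

Lemma L1_restrict v (A : set R) : measurable A -> A `<=` E -> L1 d0 d1 v -> L1 d0 d1 (v \_ A).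
Proof.
move=> mA sA Lv; apply: (L1_le _ (L1_abs Lv)).
  by apply: meas_restrict => //; apply: measurable_funS (L1_meas Lv) => //; exact: mEset.
by move=> x _; rewrite patchE; case: ifP => // _; rewrite normr0.
Qed.

Lemma J_restrict v (A : set R) : A `<=` E -> J d0 d1 (v \_ A) = Rintegral (lebm R) A v.
Proof. by move=> sA; rewrite JE -Rintegral_mkcondr (setIidr sA). Qed.

(** At each point of [E] the restrictions to [A n] are eventually constant, and they are dominated
    by [|v|], so dominated convergence applies. *)
Lemma cvg_Rint v (A : nat -> set R) (B : set R) :
  (forall n, measurable (A n)) -> (forall n, A n `<=` E) ->
  measurable B -> B `<=` E -> L1 d0 d1 v ->
  (forall x, E x -> exists N, forall n, (N <= n)%N -> A n x <-> B x) ->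
  (fun n => Rintegral (lebm R) (A n) v) @ \oo --> Rintegral (lebm R) B v.
Proof.
move=> mA sA mB sB Lv AB.
have [] := @J_dct R d0 d1 (fun n => v \_ (A n)) (v \_ B) (fun x => `|v x|).
- by move=> n; apply: L1_meas; exact: L1_restrict.
- by apply: L1_meas; exact: L1_restrict.
- exact: L1_abs.
- apply: AE_all => x /AB[N hN]; apply: cvg_near_cst.
  exists N => // n /= Nn; rewrite !patchE; have [h1 h2] := hN n Nn.
  case: (boolP (x \in A n)) => [/set_mem/h1 /mem_set -> //|/negP xA].
  by case: ifPn => // /set_mem/h2/mem_set.
- by move=> n; apply: AE_all => x _; rewrite patchE; case: ifP => // _; rewrite normr0.
move=> _; rewrite (J_restrict _ sB).
by under eq_fun do rewrite (J_restrict _ (sA _)).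
Qed.

(** Monotone convergence: the restrictions to the growing intervals increase to [v], so a uniform
    bound on the compact integrals bounds the whole one. *)
Lemma L1_exhaust v (a b : nat -> R) C : measurable_fun E v -> (forall x, E x -> 0 <= v x) ->
  (forall n, E (a n)) -> (forall n, E (b n)) ->
  (forall n m, (n <= m)%N -> a m <= a n) -> (forall n m, (n <= m)%N -> b n <= b m) ->
  (forall x, E x -> exists N, forall n, (N <= n)%N -> a n <= x <= b n) ->
  (forall n, itg `[a n, b n] v) ->
  (forall n, I v (a n) (b n) <= C) -> L1 d0 d1 v.
Proof.
move=> mv v0 Ea Eb am bm ab iv IC.
have subE n : `[a n, b n]%classic `<=` E by exact: sub_Eset.
pose g n := (EFin \o (v \_ `[a n, b n])) : R -> \bar R.
have g0 n x : E x -> (0%:E <= g n x)%E.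
  by move=> Ex; rewrite lee_fin patchE; case: ifP => // _; exact: v0.
have mg n : measurable_fun E (g n).
  apply/measurable_EFinP; apply: meas_restrict; [exact: measurable_itv|exact: subE|].
  by apply: measurable_funS mv => //; exact: mEset.
have gnd x : E x -> nondecreasing_seq (g^~ x).
  move=> Ex n m nm; rewrite lee_fin !patchE.
  case: ifPn => [/set_mem /= h|_]; last by case: ifPn => // _; exact: v0.
  rewrite ifT//; apply/mem_set => /=; move: h; rewrite !in_itv /= => /andP[h1 h2].
  by rewrite (le_trans (am _ _ nm) h1) (le_trans h2 (bm _ _ nm)).
have glim x : E x -> limn (g^~ x) = (v x)%:E.
  move=> /ab[N hN]; apply/cvg_lim => //; apply: cvg_near_cst.
  exists N => // n /= Nn; rewrite /g /= patchE ifT//; apply/mem_set => /=.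
  by rewrite in_itv /= hN.
have gI n : (\int[lebm R]_(x in E) g n x = (I v (a n) (b n))%:E)%E.
  rewrite IE -(J_restrict v (subE n)) JE RintegralE fineK//.
  apply: integrable_fin_num; first exact: mEset.
  have -> : (fun x => ((v \_ `[a n, b n]) x)%:E) = EFin \o (v \_ `[a n, b n]) by [].
  rewrite -restrict_EFin.
  apply/(@integrable_restrict _ _ _ (lebm R) _ (measurable_itv _) E mEset).
  by rewrite (setIidr (subE n)); exact: iv.
apply/integrableP; split; first exact/measurable_EFinP.
apply: (@le_lt_trans _ _ C%:E); last by rewrite ltry.
have -> : (\int[lebm R]_(x in E) `|(EFin \o v) x| = \int[lebm R]_(x in E) limn (g^~ x))%E.
  apply: eq_integral => x; rewrite inE => Ex.
  by rewrite glim//= ger0_norm// v0.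
have cv := @cvg_monotone_convergence _ _ _ (lebm R) E mEset g mg g0 gnd.
by apply: (cvge_to_le cv); apply: nearW => n; rewrite gI lee_fin.
Qed.

End RestrictionToSubsets.

(** * Behaviour at the ends of E, uniqueness and mass balance *)

Section BoundaryBehaviour.
Context {R : realType} {d0 d1 : \bar R}.
Context (d01 : (d0 < d1)%E).
Implicit Types u v : R -> R.
Local Notation E := (Eset d0 d1).
Local Notation tail := (@tail R d0).

Lemma cvg_at_d0P (h : R -> R) : h @ at_d0 d0 --> 0 <->
  forall e, 0 < e -> exists2 c, E c & forall x, E x -> x <= c -> `|h x| < e.
Proof.
split=> [h0 e e0|h0 A /nbhs_ballP[e /= e0 sA]].
  have /(at_d0P _ d01)[c Ec hc] := h0 _ (nbhsx_ballx 0 e e0).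
  exists c => // x Ex xc; have := hc x Ex xc.
  by rewrite /ball /= sub0r normrN.
have [c Ec hc] := h0 e e0.
apply/(at_d0P _ d01); exists c => // x Ex xc; apply: sA.
by rewrite /ball /= sub0r normrN; exact: hc.
Qed.

Lemma tail_mono v x y : L1 d0 d1 v -> (forall z, E z -> 0 <= v z) -> E x -> E y ->
  x <= y -> tail v x <= tail v y.
Proof.
move=> Lv v0 Ex Ey xy; rewrite /tail !RintegralE; apply: fine_le.
- apply: integrable_fin_num; first exact: mbelow.
  exact: (itg_below Lv).
- apply: integrable_fin_num; first exact: mbelow.
  exact: (itg_below Lv).
- apply: ge0_subset_integral; [exact: mbelow|exact: mbelow| | |].
  + by apply/measurable_EFinP; exact: itg_meas (itg_below Lv Ey).
  + by move=> z /(below_sub Ey) Ez; rewrite lee_fin v0.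
  + by move=> z [z0 zx]; split => //; exact: lt_le_trans xy.
Qed.

Lemma tail_small v e : L1 d0 d1 v -> (forall z, E z -> 0 <= v z) -> 0 < e ->
  exists2 c, E c & forall x, E x -> x <= c -> tail v x < e.
Proof.
move=> Lv v0 e0; have [a [b [Ea Eb _ _ ab]]] := exhaustion d01.
have : (fun n => tail v (a n)) @ \oo --> Rintegral (lebm R) set0 v.
  apply: (@cvg_Rint _ d0 d1) => //.
  - by move=> n; exact: mbelow.
  - by move=> n; exact: below_sub.
  - move=> x /ab[N hN]; exists N => n /hN /andP[ax _]; split => //= -[_ xa].
    by rewrite ltNge ax in xa.
rewrite RintegralE integral_set0 => /cvgrPdist_lt /(_ e e0)[N _ /(_ N (leqnn N))] /=.
rewrite sub0r normrN => hN; exists (a N) => // x Ex xa.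
by apply: le_lt_trans hN; rewrite (le_trans _ (ler_norm _))// tail_mono.
Qed.

Lemma tail_full v e : L1 d0 d1 v -> 0 < e ->
  exists2 c, E c & J d0 d1 v - tail v c < e.
Proof.
move=> Lv e0; have [a [b [Ea Eb _ [_ bm] ab]]] := exhaustion d01.
have : (fun n => tail v (b n)) @ \oo --> Rintegral (lebm R) E v.
  apply: (@cvg_Rint _ d0 d1) => //.
  - by move=> n; exact: mbelow.
  - by move=> n; exact: below_sub.
  - exact: mEset.
  (* [below] is strict, so a point [z] of [E] beyond [x] is needed to get [x < b n] out of
     [z <= b n]. *)
  - move=> x Ex; have [z xz Ez] : exists2 z, x < z & E z.
      have : \forall z \near x, E z by exact: open_nbhs_nbhs (conj (@open_Eset R d0 d1) Ex).
      move=> /nbhs_ballP[d /= d0' hd]; exists (x + d / 2); first by rewrite ltrDl divr_gt0.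
      apply: hd; rewrite /ball /= opprD addNKr normrN gtr0_norm ?divr_gt0//.
      by rewrite ltr_pdivrMr// ltr_pMr// ltr1n.
    have [N hN] := ab _ Ez; exists N => n /hN /andP[_ zb]; split => // _.
    by case: Ex => x0 _; split => //; exact: lt_le_trans zb.
rewrite -JE => /cvgrPdist_lt /(_ e e0)[N _ /(_ N (leqnn N))] /= hN.
by exists (b N) => //; apply: le_lt_trans hN; exact: ler_norm.
Qed.

Section Kernel.
Context (q : R -> R).
Context (itgq : forall a b, Eset d0 d1 a -> Eset d0 d1 b -> itg `[a, b] q).
Context (q0 : forall x, Eset d0 d1 x -> 0 <= q x).
Local Notation H := (@duhamel R d0 q).

Lemma H_cvg0 v : L1 d0 d1 v -> H v @ at_d0 d0 --> 0.
Proof.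
move=> Lv; apply/cvg_at_d0P => e e0.
have [c Ec hc] := tail_small (L1_abs Lv) (fun z _ => normr_ge0 _) e0.
exists c => // x Ex xc; apply: le_lt_trans (hc x Ex xc).
apply: le_trans (H_abs itgq q0 Lv Ex) _.
by apply: (H_le_tail itgq q0) => //; exact: L1_abs.
Qed.

(** [|k|] is nonincreasing, hence bounded at each point by its values near [d0], which are
    arbitrarily small. Monotonicity is another bisection: with [L = I q x y], [k y] equals
    [k x * (1 - L)] up to [M * L ^+ 2], and [|1 - L| <= 1 + L ^+ 2]; the two errors add up to the
    constant [2 * M]. *)
Lemma ode_unique (k : R -> R) :
  (forall a b, E a -> E b -> a <= b -> itg `[a, b] (fun x => q x * k x) /\
     k b - k a = - I (fun x => q x * k x) a b) ->
  k @ at_d0 d0 --> 0 -> forall x, E x -> k x = 0.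
Proof.
move=> kode /cvg_at_d0P k0 x Ex.
suff decr a b : E a -> E b -> a <= b -> `|k b| <= `|k a|.
  apply/eqP; rewrite -normr_le0 leNgt; apply/negP => kx.
  have [c Ec hc] := k0 _ kx.
  have [xc|cx] := leP x c; first by have := hc x Ex xc; rewrite ltxx.
  by have := lt_le_trans (hc c Ec (lexx _)) (decr c x Ec Ex (ltW cx)); rewrite ltxx.
move=> {x Ex} Ea Eb ab.
have Eab x : a <= x -> x <= b -> E x by move=> ax xb; apply: Eset_convex Ea Eb _; rewrite ax.
pose w x := q x * k x.
have iw x y : a <= x -> x <= y -> y <= b -> itg `[x, y] w.
  by move=> ax xy yb; apply: (kode x y _ _ xy).1; apply: Eab => //; lra.
have Iabs x y : a <= x -> x <= y -> y <= b -> `|k y - k x| <= I (fun z => `|w z|) x y.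
  move=> ax xy yb; rewrite (kode x y _ _ xy).2 ?normrN; [|apply: Eab => //; lra|apply: Eab => //; lra].
  exact/I_norm/iw.
have Iw0 x y : 0 <= I (fun z => `|w z|) x y by apply: I_ge0.
pose M := `|k a| + I (fun z => `|w z|) a b.
have kM x : a <= x -> x <= b -> `|k x| <= M.
  move=> ax xb; have := Iabs a x (lexx _) ax xb.
  have := I_split ax xb (itg_abs (iw a b (lexx _) ab (lexx _))).
  have := Iw0 x b; have := lerB_dist (k x) (k a); rewrite /M; lra.
have Lq x y : a <= x -> x <= y -> y <= b -> itg `[x, y] q.
  by move=> ax xy yb; apply: itgq; apply: Eab => //; lra.
have IwM x y : a <= x -> x <= y -> y <= b -> I (fun z => `|w z|) x y <= M * I q x y.
  move=> ax xy yb; rewrite -IZ; last exact: Lq.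
  apply: I_le; [exact/itg_abs/iw|apply: itgZ; [exact: measurable_itv|exact: Lq]|].
  move=> z /andP[xz zy]; have Ez := Eab z (le_trans ax xz) (le_trans zy yb).
  by rewrite normrM ger0_norm ?q0// mulrC ler_wpM2r ?q0// kM//; lra.
suff : `|k b| - `|k a| <= 0 by rewrite subr_le0.
have cF := I_cont ab (Lq a b (lexx _) ab (lexx _)).
apply: (@subadditive_le0 R (I q a) (fun x y => `|k y| - `|k x|) (2 * M) a b ab cF).
- move=> x y ax xy yb; rewrite (I_split ax xy (Lq _ _ (lexx _) (le_trans ax xy) yb)) lerDl.
  by apply: (Iq_ge0 q0); apply: Eab => //; lra.
- by move=> x y z *; lra.
move=> x y ax xy yb.
have Ex := Eab x ax (le_trans xy yb); have Ey := Eab y (le_trans ax xy) yb.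
rewrite (I_split ax xy (Lq _ _ (lexx _) (le_trans ax xy) yb)) addrAC subrr add0r.
have L0 : 0 <= I q x y by exact: (Iq_ge0 q0).
have iq := Lq x y ax xy yb; have iwxy := iw x y ax xy yb.
have iqk : itg `[x, y] (fun z => k x * q z) by apply: itgZ.
have key : k y = k x * (1 - I q x y) - I (fun z => w z - k x * q z) x y.
  rewrite IB// IZ//; have := (kode x y Ex Ey xy).2; rewrite -/w; lra.
have rem : `|I (fun z => w z - k x * q z) x y| <= M * I q x y * I q x y.
  apply: le_trans (I_norm _) _; first by apply: itgB.
  rewrite -IZ//; apply: I_le; first by apply: itg_abs; apply: itgB.
    by apply: itgZ.
  move=> z /andP[xz zy]; have Ez := Eab z (le_trans ax xz) (le_trans zy yb).
  rewrite /w mulrC -mulrBl normrM (@ger0_norm _ (q z)) ?q0// ler_wpM2r ?q0//.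
  apply: le_trans (Iabs x z ax xz (le_trans zy yb)) _.
  apply: le_trans (IwM x z ax xz (le_trans zy yb)) _.
  rewrite ler_wpM2l//; first by rewrite (le_trans _ (kM a (lexx _) ab)).
  by rewrite (Iq_split itgq Ex Ey xz zy) lerDl; apply: (Iq_ge0 q0).
have ky : `|k y| <= `|k x| * `|1 - I q x y| + M * I q x y * I q x y.
  rewrite {1}key (le_trans (ler_normB _ _))// normrM; lra.
have kx := kM x ax (le_trans xy yb).
have : `|1 - I q x y| <= 1 + I q x y ^+ 2.
  by rewrite ler_norml !expr2; apply/andP; split; nra.
move=> h1; have : `|k x| * `|1 - I q x y| <= `|k x| * (1 + I q x y ^+ 2).
  by rewrite ler_wpM2l.
have : `|k x| * I q x y ^+ 2 <= M * I q x y ^+ 2 by rewrite ler_wpM2r ?sqr_ge0.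
rewrite !expr2; lra.
Qed.

Context (qinf : forall c (A : R), E c ->
  exists2 c', E c' & forall x, E x -> c' <= x -> c <= x -> A <= I q c x).

(** Mass far out is small by integrability; the rest, already accumulated at [c], is damped by
    [expR (- I q c x)], which tends to 0 because the integral of [q] diverges at [d1]. *)
Lemma H_small_d1 v e : L1 d0 d1 v -> (forall z, E z -> 0 <= v z) -> 0 < e ->
  exists2 c, E c & forall x, E x -> c <= x -> H v x < e.
Proof.
move=> Lv v0 e0; have e20 : 0 < e / 2 by rewrite divr_gt0.
have [c Ec hc] := tail_full Lv e20.
have J0 : 0 <= J d0 d1 v by apply: J_ge0 => //; exact: AE_all.
(* Since [expR s >= 1 + s], this level makes the damped part at most [e / 2]. *)
have [c' Ec' hc'] := qinf (2 * J d0 d1 v / e) Ec.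
exists (Num.max c c'); first by rewrite /Num.max; case: ifP.
move=> x Ex; rewrite ge_max => /andP[cx c'x].
have Lx := hc' x Ex c'x cx.
rewrite (H_split itgq q0 Lv Ec Ex cx).
have -> : e = e / 2 + e / 2 by rewrite -splitr.
apply: ler_ltD.
  apply: (@le_trans _ _ (expR (- I q c x) * J d0 d1 v)).
    by rewrite ler_wpM2l ?expR_ge0//; apply: (H_le_J itgq q0).
  rewrite expRN mulrC ler_pdivrMr ?expR_gt0//.
  have := expR_ge1Dx (I q c x) => h1.
  have : 2 * J d0 d1 v / e <= expR (I q c x) by rlra.
  by rewrite ler_pdivrMr//; rlra.
apply: le_lt_trans hc.
apply: (@le_trans _ _ (I v c x)).
  apply: I_le; [exact: (itg_ker_itv itgq q0)|exact: (L1_itg Lv)|].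
  move=> y cyx; have Ey := Eset_convex Ec Ex cyx.
  by rewrite ler_piMl ?v0// (le_trans (ler_norm _))// (ker_le1 q0).
rewrite lerBrDl.
(* [tail] is [duhamel] for the rate 0, so its additivity is an instance of [H_split]. *)
have -> : tail v c + I v c x = tail v x.
  have i0 : forall a b, E a -> E b -> itg `[a, b] (fun=> (0 : R)).
    by move=> a b _ _; exact: integrable0.
  have HT y : E y -> tail v y = @duhamel R d0 (fun=> 0) v y.
    move=> Ey; rewrite /tail HE; apply: eq_Rintegral => z _.
    by rewrite IE RintegralE integral0 /= oppr0 expR0 mul1r.
  rewrite !HT// (H_split i0 _ Lv Ec Ex cx) //.
  have I0 a b : I (fun=> (0 : R)) a b = 0 by rewrite IE RintegralE integral0.
  rewrite I0 oppr0 expR0 mul1r; congr (_ + _).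
  by apply: eq_I => y _; rewrite I0 oppr0 expR0 mul1r.
by rewrite /tail; apply: subset_J => //; [exact: mbelow|exact: below_sub].
Qed.

Lemma qH_meas v : measurable_fun E q -> L1 d0 d1 v -> measurable_fun E (fun x => q x * H v x).
Proof. by move=> mq Lv; apply: measurable_funM => //; exact: (H_meas d01 itgq q0). Qed.

(** Integrating the equation over [[a n, b n]] leaves the boundary terms [H v (a n)] and
    [H v (b n)], which tend to 0 by [H_cvg0] and [H_small_d1]. Integrability comes first, from a
    uniform bound on the compact integrals. *)
Lemma H_mass_nonneg v : measurable_fun E q -> L1 d0 d1 v -> (forall z, E z -> 0 <= v z) ->
  L1 d0 d1 (fun x => q x * H v x) /\ J d0 d1 (fun x => q x * H v x) = J d0 d1 v.
Proof.
move=> mq Lv v0; have [a [b [Ea Eb leab [am bm] ab]]] := exhaustion d01.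
have Hge0 z : E z -> 0 <= H v z by move=> Ez; apply: (H_ge0 itgq) => //; exact: AE_all.
have ode n := H_ode itgq q0 Lv (Ea n) (Eb n) (leab n).
have Ivab n : I v (a n) (b n) <= J d0 d1 v.
  by rewrite IE; apply: subset_J => //; exact: sub_Eset.
have LqH : L1 d0 d1 (fun x => q x * H v x).
  apply: (@L1_exhaust _ _ _ _ a b (J d0 d1 v + J d0 d1 v)) => //.
  - exact: qH_meas.
  - by move=> x Ex; rewrite mulr_ge0 ?q0// Hge0.
  - by move=> n; exact: (itg_qH itgq q0).
  - move=> n; have := ode n; have := Hge0 _ (Eb n); have := Ivab n.
    have := H_le_J itgq q0 Lv v0 (Ea n); rlra.
split => //.
have cI u : L1 d0 d1 u -> (fun n => I u (a n) (b n)) @ \oo --> J d0 d1 u.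
  move=> Lu; rewrite JE; under eq_fun do rewrite IE.
  apply: (@cvg_Rint _ d0 d1) => //.
  - by move=> n; exact: sub_Eset.
  - exact: mEset.
  - move=> x Ex; have [N hN] := ab x Ex; exists N => n Nn; split => // _ /=.
    by rewrite in_itv /= hN.
have c1 := cI _ LqH; have c2 := cI _ Lv.
have c3 : (fun n => H v (a n) - H v (b n)) @ \oo --> 0 - 0.
  apply: cvgB; apply/cvgrPdist_lt => e e0.
    have [c Ec hc] := (cvg_at_d0P _).1 (H_cvg0 Lv) e e0.
    have [N hN] := ab c Ec; exists N => // n /= /hN /andP[ac _].
    by rewrite sub0r normrN; exact: hc.
  have [c Ec hc] := H_small_d1 Lv v0 e0.
  have [N hN] := ab c Ec; exists N => // n /= /hN /andP[_ cb].
  by rewrite sub0r normrN ger0_norm ?Hge0//; exact: hc.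
have c4 : ((fun n => I v (a n) (b n)) \+ (fun n => H v (a n) - H v (b n))) @ \oo --> J d0 d1 v.
  by have h := cvgD c2 c3; rewrite subr0 addr0 in h; exact: h.
have key : (fun n => I (fun x => q x * H v x) (a n) (b n)) =
    (fun n => I v (a n) (b n)) \+ (fun n => H v (a n) - H v (b n)).
  by apply/funext => n /=; have := ode n; rlra.
rewrite key in c1.
by rewrite -(cvg_lim (@Rhausdorff R) c1) (cvg_lim (@Rhausdorff R) c4).
Qed.

Lemma H_mass v : measurable_fun E q -> L1 d0 d1 v ->
  L1 d0 d1 (fun x => q x * H v x) /\ J d0 d1 (fun x => q x * H v x) = J d0 d1 v.
Proof.
move=> mq Lv.
pose p x := Num.max (v x) 0; pose n x := Num.max (- v x) 0.
have Lp : L1 d0 d1 p by apply: L1_max => //; exact: L1_0.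
have Ln : L1 d0 d1 n by apply: L1_max; [exact: L1N|exact: L1_0].
have vE : v = (fun x => 1 * p x + (-1) * n x).
  by apply/funext => x; rewrite /p /n /Num.max; case: ifPn; case: ifPn; rlra.
have [Lqp Jp] : L1 d0 d1 (fun x => q x * H p x) /\ J d0 d1 (fun x => q x * H p x) = J d0 d1 p.
  by apply: H_mass_nonneg => // z _; rewrite /p le_max lexx orbT.
have [Lqn Jn] : L1 d0 d1 (fun x => q x * H n x) /\ J d0 d1 (fun x => q x * H n x) = J d0 d1 n.
  by apply: H_mass_nonneg => // z _; rewrite /n le_max lexx orbT.
have eqq x : E x -> 1 * (q x * H p x) + (-1) * (q x * H n x) = q x * H v x.
  by move=> Ex; rewrite vE (H_comb itgq q0 _ _ Lp Ln Ex); rlra.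
have Lq := L1_eqE eqq (L1_comb 1 (-1) Lqp Lqn); split => //.
rewrite -(J_ae (L1_comb 1 (-1) Lqp Lqn) Lq); last exact: AE_all.
by rewrite Jcomb// Jp Jn vE Jcomb.
Qed.

End Kernel.

Lemma H_mono (q q' v : R -> R) x :
  (forall a b, E a -> E b -> itg `[a, b] q) -> (forall a b, E a -> E b -> itg `[a, b] q') ->
  (forall x, E x -> 0 <= q x <= q' x) ->
  L1 d0 d1 v -> nonneg_ae d0 d1 v -> E x -> @duhamel R d0 q' v x <= @duhamel R d0 q v x.
Proof.
move=> iq iq' qq' Lv v0 Ex.
have q0 y : E y -> 0 <= q y by move=> /qq' /andP[].
have q0' y : E y -> 0 <= q' y by move=> Ey; have /andP[h1 h2] := qq' y Ey; exact: le_trans h2.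
rewrite (@H_ae _ d0 d1 q iq q0 v (fun x => Num.max (v x) 0) x) //; first last.
- by refine (AE1 v0 _) => y _ h; rewrite max_l.
- by apply: L1_max => //; exact: L1_0.
rewrite (@H_ae _ d0 d1 q' iq' q0' v (fun x => Num.max (v x) 0) x) //; first last.
- by refine (AE1 v0 _) => y _ h; rewrite max_l.
- by apply: L1_max => //; exact: L1_0.
have Lm : L1 d0 d1 (fun x => Num.max (v x) 0) by apply: L1_max => //; exact: L1_0.
rewrite !HE; apply: le_Rintegral; [exact: mbelow|exact: (itg_ker iq' q0')|exact: (itg_ker iq q0)|].
move=> y yx; have Ey := below_sub Ex yx; case: yx => _ yx.
rewrite ler_wpM2r ?le_max ?lexx ?orbT// ler_expR lerN2.
apply: I_le; [exact: iq|exact: iq'|].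
by move=> z zyx; have /andP[] := qq' z (Eset_convex Ey Ex zyx).
Qed.

End BoundaryBehaviour.

(** * The resolvent of A *)

Record flow_model (R : realType) (d0 d1 : \bar R) (g phi : R -> R) : Prop := FlowModel {
  fm_itv : (d0 < d1)%E;
  fm_cont : {within Eset d0 d1, continuous g};
  fm_pos : forall x, Eset d0 d1 x -> 0 < g x;
  fm_meas : measurable_fun (Eset d0 d1) phi;
  fm_ge0 : forall x, Eset d0 d1 x -> 0 <= phi x;
  fm_loc : forall C : set R, compact C -> C `<=` Eset d0 d1 ->
    (lebm R).-integrable C (EFin \o phi);
  fm_G : G_infinite d0 d1 g;
  fm_Q : Q_infinite d0 d1 g phi }.

Section Resolvent.
Context {R : realType} {d0 d1 : \bar R} {g phi : R -> R}.
Context (M : flow_model d0 d1 g phi).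
Let d01 := fm_itv M.
Let cg := fm_cont M.
Let g0 := fm_pos M.
Let mphi := fm_meas M.
Let phi0 := fm_ge0 M.
Let phiC := fm_loc M.
Let Ginf := fm_G M.
Let Qinf := fm_Q M.
Implicit Types (u v w : R -> R) (lam : R).
Local Notation E := (Eset d0 d1).

(** The damping rate of the flux [h = g u] in the equation [(g u)' = v - (lam + phi) u]. *)
Definition rate lam (z : R) : R := (lam + phi z) / g z.

Lemma mg : measurable_fun E g.
Proof. by apply: subspace_continuous_measurable_fun => //; exact: mEset. Qed.

Lemma gV_bounded a b : E a -> E b -> exists C : R, forall x, a <= x <= b -> `|(g x)^-1| <= C.
Proof.
move=> Ea Eb; have [ab|ba] := leP a b; last first.
  by exists 0 => x /andP[ax xb]; have := le_lt_trans (le_trans ax xb) ba; rewrite ltxx.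
have cab : {within `[a, b], continuous g}.
  by apply: continuous_subspaceW cg; exact: sub_Eset.
have [c cab' hc] := EVT_min ab cab.
have Ec : E c by move: cab'; rewrite in_itv /=; exact: Eset_convex.
exists (g c)^-1 => x xab.
have gx : 0 < g x by apply: g0; exact: Eset_convex xab.
rewrite ger0_norm ?invr_ge0 ?(ltW gx)// lef_pV2 ?posrE//; last exact: g0.
by apply: hc; rewrite in_itv.
Qed.

Lemma mgV : measurable_fun E (fun x => (g x)^-1).
Proof.
have -> : (fun x => (g x)^-1) = (@GRing.inv R) \o g by [].
apply: (@measurable_comp _ _ _ _ _ _ [set y : R | 0 < y]) => //.
- rewrite (_ : mkset _ = `]0, +oo[%classic); first exact: measurable_itv.
  by apply/seteqP; split => y /=; rewrite in_itv /= andbT.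
- by move=> _ [x Ex <-]; exact: g0.
- apply: open_continuous_measurable_fun; first exact: open_gt.
  by move=> y; rewrite inE /= => y0; apply: inv_continuous; rewrite gt_eqF.
- exact: mg.
Qed.

Lemma itg_bddV a b (f : R -> R) : E a -> E b -> itg `[a, b] f -> itg `[a, b] (fun x => f x / g x).
Proof.
move=> Ea Eb itf; have [C hC] := gV_bounded Ea Eb.
have : itg `[a, b] (fun x => (g x)^-1 * f x).
  apply: (itg_bmul (C := C)) => //.
  apply: measurable_funS mgV; [exact: mEset|exact: sub_Eset].
by apply: eq_integrable => // x _ /=; rewrite mulrC.
Qed.

Lemma nbhs_pinfty_ge (A : R) : nbhs +oo%E [set y : \bar R | (A%:E <= y)%E].
Proof. by exists A; split => [|y]; [exact: num_real|exact: ltW]. Qed.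

Lemma itg_cst a b (c : R) : itg `[a, b] (fun=> c).
Proof.
apply/integrableP; split; first exact: measurable_cst.
rewrite integral_cst//= lebesgue_measure_itv /=; case: ifP => _; last by rewrite mule0 ltry.
by rewrite -EFinD -EFinM ltry.
Qed.

Lemma itg_phi a b : E a -> E b -> itg `[a, b] phi.
Proof. by move=> Ea Eb; apply: phiC; [exact: segment_compact|exact: sub_Eset]. Qed.

Lemma itg_rate lam a b : E a -> E b -> itg `[a, b] (rate lam).
Proof.
move=> Ea Eb; apply: itg_bddV => //; apply: itgD => //; first exact: itg_cst.
exact: itg_phi.
Qed.

Lemma rate_ge0 lam x : 0 <= lam -> E x -> 0 <= rate lam x.
Proof. by move=> l0 Ex; rewrite divr_ge0 ?addr_ge0 ?phi0// ltW// g0. Qed.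

Lemma mrate lam : measurable_fun E (rate lam).
Proof.
apply: measurable_funM; last exact: mgV.
by apply: measurable_funD.
Qed.

Lemma rate_inf_G lam c (A : R) : 0 < lam -> E c ->
  exists2 c', E c' & forall x, E x -> c' <= x -> c <= x -> A <= I (rate lam) c x.
Proof.
move=> l0 Ec; have [c' Ec' hc'] := at_d1E d01 (Ginf Ec (nbhs_pinfty_ge (A / lam))).
exists c' => // x Ex c'x cx; have /= := hc' x Ex c'x.
have i1 : itg `[c, x] (fun z => (g z)^-1).
  have := itg_bddV Ec Ex (itg_cst c x 1); apply: eq_integrable => // z _ /=.
  by rewrite mul1r.
rewrite (_ : integral _ _ _ = (I (fun z => (g z)^-1) c x)%:E); last first.
  by rewrite IE RintegralE fineK//; apply: integrable_fin_num.
rewrite lee_fin ler_pdivrMr// => h; apply: le_trans h _.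
rewrite mulrC -IZ//; apply: I_le; [exact: itgZ|exact: itg_rate|].
move=> z zcx; have Ez := Eset_convex Ec Ex zcx.
by rewrite ler_wpM2r ?invr_ge0 ?(ltW (g0 Ez))// lerDl phi0.
Qed.

Lemma rate_inf_Q c (A : R) : E c ->
  exists2 c', E c' & forall x, E x -> c' <= x -> c <= x -> A <= I (rate 0) c x.
Proof.
move=> Ec; have [c' Ec' hc'] := at_d1E d01 (Qinf Ec (nbhs_pinfty_ge A)).
exists c' => // x Ex c'x cx; have /= := hc' x Ex c'x.
have i1 : itg `[c, x] (fun z => phi z / g z) by apply: itg_bddV => //; exact: itg_phi.
rewrite (_ : integral _ _ _ = (I (fun z => phi z / g z) c x)%:E); last first.
  by rewrite IE RintegralE fineK//; apply: integrable_fin_num.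
rewrite lee_fin => h; apply: le_trans h _.
by rewrite le_eqVlt (eq_I (f' := rate 0)) ?eqxx// => z _; rewrite /rate add0r.
Qed.

Lemma rate_inf lam c (A : R) : 0 <= lam -> E c ->
  exists2 c', E c' & forall x, E x -> c' <= x -> c <= x -> A <= I (rate lam) c x.
Proof.
rewrite le_eqVlt => /orP[/eqP <-|l0] Ec; first exact: rate_inf_Q.
exact: rate_inf_G.
Qed.

(* For lam = 0 this is R0; for lam > 0 it is the resolvent of A. *)
Definition Rlam lam v (x : R) : R := (g x)^-1 * @duhamel R d0 (rate lam) v x.

Lemma R0E v x : R0 d0 d1 g phi v x = Rlam 0 v x.
Proof.
rewrite /R0 /Rlam HE; congr (_ * _); apply: eq_Rintegral => y _.
congr (expR (- _) * _); rewrite IE /Qdiff; apply: eq_Rintegral => z _.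
by rewrite /rate add0r.
Qed.

Section FixedLam.
Context (lam : R) (lam0 : 0 <= lam).
Let iq a b : E a -> E b -> itg `[a, b] (rate lam). Proof. exact: itg_rate. Qed.
Let q0 x : E x -> 0 <= rate lam x. Proof. exact: rate_ge0. Qed.
Local Notation H := (@duhamel R d0 (rate lam)).

Lemma Rlam_meas v : L1 d0 d1 v -> measurable_fun E (Rlam lam v).
Proof. by move=> Lv; apply: measurable_funM; [exact: mgV|exact: (H_meas d01 iq q0)]. Qed.

Lemma Rlam_comb c c' u v x : L1 d0 d1 u -> L1 d0 d1 v -> E x ->
  Rlam lam (fun y => c * u y + c' * v y) x = c * Rlam lam u x + c' * Rlam lam v x.
Proof. by move=> Lu Lv Ex; rewrite /Rlam (H_comb iq q0 _ _ Lu Lv Ex); ring. Qed.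

Lemma Rlam_ae u v x : L1 d0 d1 u -> L1 d0 d1 v -> aeE d0 d1 u v -> E x ->
  Rlam lam u x = Rlam lam v x.
Proof. by move=> Lu Lv uv Ex; rewrite /Rlam (H_ae iq q0 Lu Lv uv Ex). Qed.

Lemma Rlam_ge0 v x : L1 d0 d1 v -> nonneg_ae d0 d1 v -> E x -> 0 <= Rlam lam v x.
Proof.
by move=> Lv v0 Ex; rewrite mulr_ge0 ?invr_ge0 ?(ltW (g0 Ex))// (H_ge0 iq q0 Lv v0 Ex).
Qed.

Lemma Rlam_abs v x : L1 d0 d1 v -> E x -> `|Rlam lam v x| <= Rlam lam (fun y => `|v y|) x.
Proof.
move=> Lv Ex; rewrite /Rlam normrM gtr0_norm ?invr_gt0 ?g0//.
by rewrite ler_wpM2l ?invr_ge0 ?(ltW (g0 Ex))// (H_abs iq q0 Lv Ex).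
Qed.

(** The outflow [(lam + phi) * Rlam lam v] is [rate lam * H v], so this is the mass balance of
    [duhamel]. *)
Lemma Rlam_mass v : L1 d0 d1 v -> L1 d0 d1 (fun x => (lam + phi x) * Rlam lam v x) /\
  J d0 d1 (fun x => (lam + phi x) * Rlam lam v x) = J d0 d1 v.
Proof.
move=> Lv; have [h1 h2] := H_mass d01 iq q0 (fun c A => rate_inf A lam0) (mrate lam) Lv.
have e : (fun x => (lam + phi x) * Rlam lam v x) = (fun x => rate lam x * H v x).
  by apply/funext => x; rewrite /Rlam /rate mulrA.
by rewrite e.
Qed.

Lemma L1_phiRlam v : L1 d0 d1 v -> L1 d0 d1 (fun x => phi x * Rlam lam v x).
Proof.
move=> Lv; have Lv' := L1_abs Lv.
apply: L1_le (Rlam_mass Lv').1 _.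
  by apply: measurable_funM => //; exact: Rlam_meas.
move=> x Ex; rewrite normrM ger0_norm ?phi0//.
apply: ler_pM => //; [exact: phi0|by rewrite lerDr|exact: Rlam_abs].
Qed.

Lemma DA_Rlam v : L1 d0 d1 v -> L1 d0 d1 (Rlam lam v) ->
  DA_deriv d0 d1 g phi (Rlam lam v) (fun x => v x - (lam + phi x) * Rlam lam v x).
Proof.
move=> Lv LR; split => //.
- by apply: L1B => //; exact: (Rlam_mass Lv).1.
- exact: L1_phiRlam.
- exists (H v); split.
  + by apply: AE_all => x /g0 gx; rewrite /Rlam mulrA mulfV ?gt_eqF// mul1r.
  + move=> x y Ex Ey yx; rewrite (H_ode iq q0 Lv Ey Ex yx) -IB; last 2 first.
    * exact: (L1_itg Lv).
    * exact: (itg_qH iq q0).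
    by rewrite IE; apply: eq_Rintegral => z _; rewrite /Rlam /rate mulrA.
  + exact: (H_cvg0 d01 iq q0).
Qed.

(** The absolutely continuous version [h] of [g u] and the function [H v] satisfy the same equation
    and both vanish at [d0]; their difference solves the homogeneous equation and is 0 by
    [ode_unique]. *)
Lemma DA_unique v u w : L1 d0 d1 v -> DA_deriv d0 d1 g phi u w ->
  aeE d0 d1 w (fun x => v x - (lam + phi x) * u x) -> aeE d0 d1 u (Rlam lam v).
Proof.
move=> Lv [Lu Lw Lphiu [h [hgu hI h0]]] wE.
pose k x := h x - H v x.
have hx a x : E a -> E x -> a <= x -> h x = h a + I w a x.
  by move=> Ea Ex ax; rewrite IE -(hI x a Ex Ea ax) addrC subrK.
(* [h] comes without measurability; on each compact interval it is a constant plus an integral of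
   [w], hence continuous. *)
have mh a b : E a -> E b -> a <= b -> measurable_fun `[a, b] h.
  move=> Ea Eb ab; apply: (eq_measurable_fun (fun x => h a + I w a x)).
    move=> x; rewrite inE /= in_itv /= => xab; have Ex := Eset_convex Ea Eb xab.
    by rewrite -hx//; case/andP: xab.
  apply: measurable_funD => //.
  apply: subspace_continuous_measurable_fun; first exact: measurable_itv.
  by apply: I_cont => //; exact: (L1_itg Lw).
have ih a b : E a -> E b -> a <= b -> itg `[a, b] (fun x => rate lam x * h x).
  move=> Ea Eb ab; apply: (itg_qk iq (C := `|h a| + J d0 d1 (fun y => `|w y|))) => //.
    exact: mh.
  move=> x xab; have Ex := Eset_convex Ea Eb xab; case/andP: xab => ax xb.
  rewrite (hx a x)// (le_trans (ler_normD _ _))// lerD2l.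
  have iw := L1_itg Lw Ea Ex.
  apply: le_trans (I_norm iw) _; rewrite IE; apply: subset_J => //.
    exact: sub_Eset.
  exact: L1_abs.
have key : forall x, E x -> k x = 0.
  apply: (ode_unique d01 iq q0) => [a b Ea Eb ab|].
    have iH := itg_qH iq q0 Lv Ea Eb; have i1 := ih a b Ea Eb ab.
    have ik : itg `[a, b] (fun x => rate lam x * k x).
      have := itgB (measurable_itv _) i1 iH; apply: eq_integrable => // x _ /=.
      by rewrite mulrBr.
    split => //.
    have -> : I (fun x => rate lam x * k x) a b =
        I (fun x => rate lam x * h x) a b - I (fun x => rate lam x * H v x) a b.
      by rewrite -IB//; apply: eq_I => x _; rewrite mulrBr.
    have iv := L1_itg Lv Ea Eb; have iw := L1_itg Lw Ea Eb.
    have Iw : I w a b = I v a b - I (fun x => rate lam x * h x) a b.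
      rewrite -IB// !IE !RintegralE; congr fine; apply: ae_eq_integral.
      - exact: measurable_itv.
      - by case/integrableP: iw.
      - by case/integrableP: (itgB (measurable_itv _) iv i1).
      - apply: filterS2 hgu wE => x h1 h2 /= xab.
        have Ex : E x by move: xab; rewrite in_itv /=; exact: Eset_convex.
        rewrite h2// h1// /rate; congr EFin; congr (_ - _).
        by rewrite mulrA divfK// gt_eqF// g0.
    have := H_ode iq q0 Lv Ea Eb ab; have := hx a b Ea Eb ab; rewrite /k Iw; rlra.
  apply/(cvg_at_d0P d01) => e e0; have e20 : 0 < e / 2 by rewrite divr_gt0.
  have [c Ec hc] := (cvg_at_d0P d01 _).1 h0 _ e20.
  have [c' Ec' hc'] := (cvg_at_d0P d01 _).1 (H_cvg0 d01 iq q0 Lv) _ e20.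
  exists (Num.min c c'); first by rewrite /Num.min; case: ifP.
  move=> x Ex; rewrite le_min => /andP[xc xc'].
  rewrite /k (le_lt_trans (ler_normB _ _))// [e]splitr ltrD//; first exact: hc.
  exact: hc'.
refine (AE1 hgu _) => x Ex hgx; have /eqP := key x Ex; rewrite subr_eq0 hgx => /eqP gu.
by rewrite /Rlam -gu mulrA mulVf ?mul1r// gt_eqF// g0.
Qed.

End FixedLam.

Section PositiveLam.
Context (lam : R) (lam0 : 0 < lam).
Let l0 : 0 <= lam := ltW lam0.
Local Notation RAl := (RA d0 d1 g phi lam).

(** [lam * Rlam] is dominated by the outflow [(lam + phi) * Rlam], whose integral is finite. For
    [lam = 0] this says nothing, whence the integrability hypothesis on [R0 vs] in the stability
    statement. *)
Lemma L1_Rlam v : L1 d0 d1 v -> L1 d0 d1 (Rlam lam v).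
Proof.
move=> Lv; have Lm := (Rlam_mass l0 (L1_abs Lv)).1.
apply: L1_le (L1Z lam^-1 Lm) _; first exact: Rlam_meas.
move=> x Ex; apply: le_trans (Rlam_abs l0 Lv Ex) _.
have R0 : 0 <= Rlam lam (fun y => `|v y|) x.
  by apply: Rlam_ge0 => //; [exact: L1_abs|exact: AE_all].
rewrite mulrA ler_peMl// mulrC ler_pdivlMr// mul1r lerDl; exact: phi0.
Qed.

Lemma RA_unique u v : L1 d0 d1 u -> is_resolventA d0 d1 g phi lam u v ->
  aeE d0 d1 v (Rlam lam u) /\ L1 d0 d1 v.
Proof.
move=> Lu [z [[w [DA zE] lE]]]; split; last by case: DA.
apply: (DA_unique l0 Lu DA); refine (AE2 zE lE _) => x _; rewrite /=.
move=> -> <-; ring.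
Qed.

(** [RA] is a choice: exhibiting [Rlam lam u] shows that there is something to choose, and
    [RA_unique] pins the choice down almost everywhere. *)
Lemma RA_spec u : L1 d0 d1 u -> is_resolventA d0 d1 g phi lam u (RAl u).
Proof.
move=> Lu; apply: ClassicalEpsilon.epsilon_spec; exists (Rlam lam u).
have LR := L1_Rlam Lu.
exists (fun x => lam * Rlam lam u x - u x); split.
  eexists; split; first exact: (DA_Rlam l0 Lu LR).
  by apply: AE_all => x _; ring.
by apply: AE_all => x _; ring.
Qed.

Lemma RA_ae u : L1 d0 d1 u -> aeE d0 d1 (RAl u) (Rlam lam u).
Proof. by move=> Lu; have [] := RA_unique Lu (RA_spec Lu). Qed.

Lemma L1_RA u : L1 d0 d1 u -> L1 d0 d1 (RAl u).
Proof. by move=> Lu; have [] := RA_unique Lu (RA_spec Lu). Qed.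

Lemma L1_phiRA u : L1 d0 d1 u -> L1 d0 d1 (fun x => phi x * RAl u x).
Proof. by move=> /RA_spec[z [[w [[_ _ ? _] _] _]]]. Qed.

Lemma RA_mass u : L1 d0 d1 u ->
  lam * J d0 d1 (RAl u) + J d0 d1 (fun x => phi x * RAl u x) = J d0 d1 u.
Proof.
move=> Lu; have LR := L1_RA Lu; have Lp := L1_phiRA Lu; have [Lm Jm] := Rlam_mass l0 Lu.
rewrite -Jm -JZ// -JD//; last exact: L1Z.
apply: J_ae => //; first by apply: L1D => //; exact: L1Z.
by refine (AE1 (RA_ae Lu) _) => x _ ->; rewrite mulrDl.
Qed.

Lemma RA_congr u v : L1 d0 d1 u -> L1 d0 d1 v -> aeE d0 d1 u v -> aeE d0 d1 (RAl u) (RAl v).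
Proof.
move=> Lu Lv uv; refine (AE2 (RA_ae Lu) (RA_ae Lv) _) => x Ex -> ->.
exact: (Rlam_ae l0).
Qed.

Lemma RA_comb a b u v : L1 d0 d1 u -> L1 d0 d1 v ->
  aeE d0 d1 (RAl (fun x => a * u x + b * v x)) (fun x => a * RAl u x + b * RAl v x).
Proof.
move=> Lu Lv; refine (AE3 (RA_ae (L1_comb a b Lu Lv)) (RA_ae Lu) (RA_ae Lv) _).
by move=> x Ex -> -> ->; exact: (Rlam_comb l0).
Qed.

Lemma RA_ge0 u : L1 d0 d1 u -> nonneg_ae d0 d1 u -> nonneg_ae d0 d1 (RAl u).
Proof.
by move=> Lu u0; refine (AE1 (RA_ae Lu) _) => x Ex ->; exact: Rlam_ge0.
Qed.

(** A larger rate damps more, and [rate 0 <= rate lam]. *)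
Lemma RA_le_R0 u : L1 d0 d1 u -> nonneg_ae d0 d1 u ->
  AE d0 d1 (fun x => RAl u x <= R0 d0 d1 g phi u x).
Proof.
move=> Lu u0; refine (AE1 (RA_ae Lu) _) => x Ex ->.
rewrite R0E /Rlam ler_wpM2l ?invr_ge0 ?(ltW (g0 Ex))//.
apply: (@H_mono R d0 d1) => // [a b|a b|y Ey]; try exact: itg_rate.
by rewrite rate_ge0//= /rate ler_wpM2r ?invr_ge0 ?(ltW (g0 Ey))// lerD2r.
Qed.

End PositiveLam.

End Resolvent.

(** * Operators and semigroups on L^1 *)

Section Operators.
Context {R : realType} {d0 d1 : \bar R}.
Implicit Types (u v w : R -> R) (T : (R -> R) -> R -> R).
Local Notation L := (L1 d0 d1).
Local Notation J := (J d0 d1).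
Local Notation N := (norm1 d0 d1).
Local Notation "u =ae v" := (aeE d0 d1 u v) (at level 70).

Lemma norm1_ge0 u : L u -> 0 <= N u.
Proof. by move=> Lu; rewrite norm1E; apply: J_ge0; [exact: L1_abs|exact: AE_all]. Qed.

Lemma norm1_ae u v : L u -> L v -> u =ae v -> N u = N v.
Proof.
move=> Lu Lv uv; rewrite !norm1E; apply: J_ae; try exact: L1_abs.
by refine (AE1 uv _) => x _ ->.
Qed.

Lemma norm1_nonneg u : L u -> nonneg_ae d0 d1 u -> N u = J u.
Proof.
move=> Lu u0; rewrite norm1E; apply: J_ae => //; first exact: L1_abs.
by refine (AE1 u0 _) => x _ h; rewrite ger0_norm.
Qed.

Lemma norm1_le u v : L u -> L v -> AE d0 d1 (fun x => `|u x| <= `|v x|) -> N u <= N v.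
Proof. by move=> Lu Lv uv; rewrite !norm1E; apply: J_le => //; exact: L1_abs. Qed.

Lemma norm1D u v : L u -> L v -> N (fun x => u x + v x) <= N u + N v.
Proof.
move=> Lu Lv; rewrite !norm1E -JD; [|exact: L1_abs|exact: L1_abs].
apply: J_le; [exact/L1_abs/L1D|apply: L1D; exact: L1_abs|].
by apply: AE_all => x _; exact: ler_normD.
Qed.

Lemma norm1Z c u : L u -> N (fun x => c * u x) = `|c| * N u.
Proof.
move=> Lu; rewrite !norm1E -JZ; last exact: L1_abs.
apply: J_ae; [exact/L1_abs/L1Z|apply: L1Z; exact: L1_abs|].
by apply: AE_all => x _; rewrite normrM.
Qed.

Lemma norm1_eq0 u : L u -> N u <= 0 -> u =ae (fun=> 0).
Proof.
move=> Lu; rewrite norm1E => h; have := J_eq0 (L1_abs Lu) _ h.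
by move=> h0; refine (AE1 (h0 _) _) => [|x _ /eqP]; [exact: AE_all|rewrite normr_eq0 => /eqP].
Qed.

Lemma norm1_sub0 u v : L u -> L v -> N (fun x => u x - v x) <= 0 -> u =ae v.
Proof.
move=> Lu Lv /(norm1_eq0 (L1B Lu Lv)) h.
by refine (AE1 h _) => x _ /eqP; rewrite subr_eq0 => /eqP.
Qed.

Lemma J_dist u v : L u -> L v -> `|J u - J v| <= N (fun x => u x - v x).
Proof. by move=> Lu Lv; rewrite norm1E -JB//; apply: J_abs; exact: L1B. Qed.

Section OneOperator.
Context T (oT : L1op d0 d1 T).

Lemma op_L1 u : L u -> L (T u). Proof. by case: oT => h _ _; exact: h. Qed.

Lemma op_ae u v : L u -> L v -> u =ae v -> T u =ae T v.
Proof. by case: oT => _ h _; exact: h. Qed.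

Lemma op_comb a b u v : L u -> L v ->
  T (fun x => a * u x + b * v x) =ae (fun x => a * T u x + b * T v x).
Proof. by case: oT => _ _ h; exact: h. Qed.

Lemma opZ c u : L u -> T (fun x => c * u x) =ae (fun x => c * T u x).
Proof.
move=> Lu; apply: (@aeE_trans _ _ _ (T (fun x => c * u x + 0 * u x))).
  apply: op_ae; [exact: L1Z|exact: L1_comb|].
  by apply: AE_all => x _; rewrite mul0r addr0.
by refine (AE1 (op_comb c 0 Lu Lu) _) => x _ ->; rewrite mul0r addr0.
Qed.

Lemma op0 : T (fun=> 0) =ae (fun=> 0).
Proof.
apply: (@aeE_trans _ _ _ (T (fun x => 0 * (fun=> 0) x))).
  by apply: op_ae; [exact: L1_0|apply: L1Z; exact: L1_0|apply: AE_all => x _; rewrite mul0r].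
by refine (AE1 (opZ 0 L1_0) _) => x _ ->; rewrite mul0r.
Qed.

Lemma opD u v : L u -> L v -> T (fun x => u x + v x) =ae (fun x => T u x + T v x).
Proof.
move=> Lu Lv; apply: (@aeE_trans _ _ _ (T (fun x => 1 * u x + 1 * v x))).
  apply: op_ae; [exact: L1D|exact: L1_comb|].
  by apply: AE_all => x _; rewrite !mul1r.
by refine (AE1 (op_comb 1 1 Lu Lv) _) => x _ ->; rewrite !mul1r.
Qed.

Lemma opB u v : L u -> L v -> T (fun x => u x - v x) =ae (fun x => T u x - T v x).
Proof.
move=> Lu Lv; apply: (@aeE_trans _ _ _ (T (fun x => 1 * u x + (-1) * v x))).
  apply: op_ae; [exact: L1B|exact: L1_comb|].
  by apply: AE_all => x _; rewrite mul1r mulN1r.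
by refine (AE1 (op_comb 1 (-1) Lu Lv) _) => x _ ->; rewrite mul1r mulN1r.
Qed.

Context (pT : positive_op d0 d1 T).

Lemma op_le u v : L u -> L v -> AE d0 d1 (fun x => u x <= v x) ->
  AE d0 d1 (fun x => T u x <= T v x).
Proof.
move=> Lu Lv uv.
have h : nonneg_ae d0 d1 (T (fun x => v x - u x)).
  by apply: pT; [exact: L1B|refine (AE1 uv _) => x _; rewrite subr_ge0].
by refine (AE2 h (opB Lv Lu) _) => x _ h0 e; rewrite -subr_ge0 -e.
Qed.

Lemma op_abs u : L u -> AE d0 d1 (fun x => `|T u x| <= T (fun x => `|u x|) x).
Proof.
move=> Lu; have La := L1_abs Lu.
have h1 : AE d0 d1 (fun x => T u x <= T (fun x => `|u x|) x).
  by apply: op_le => //; apply: AE_all => x _; exact: ler_norm.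
have h2 : AE d0 d1 (fun x => T (fun x => (-1) * u x) x <= T (fun x => `|u x|) x).
  apply: op_le => //; first exact: L1Z.
  by apply: AE_all => x _; rewrite mulN1r -normrN ler_norm.
refine (AE3 h1 h2 (opZ (-1) Lu) _) => x _ k1 k2 e.
by move: k2; rewrite e ler_norml k1 andbT => k2; lra.
Qed.

End OneOperator.

Lemma pos_part_decomp u : L u -> exists p n, [/\ L p, L n,
  (forall x, 0 <= p x /\ 0 <= n x) & (forall x, u x = p x - n x)].
Proof.
move=> Lu; exists (fun x => Num.max (u x) 0), (fun x => Num.max (- u x) 0); split.
- by apply: L1_max => //; exact: L1_0.
- by apply: L1_max; [exact: L1N|exact: L1_0].
- by move=> x; rewrite !le_max lexx !orbT.
- by move=> x; rewrite /Num.max; case: ifPn; case: ifPn; lra.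
Qed.

Lemma J_op_eq T : L1op d0 d1 T ->
  (forall u, L u -> nonneg_ae d0 d1 u -> J (T u) = J u) -> forall u, L u -> J (T u) = J u.
Proof.
move=> oT h u Lu; have [p [n [Lp Ln pn0 upn]]] := pos_part_decomp Lu.
have e : u =ae (fun x => p x - n x) by apply: AE_all => x _.
rewrite (J_ae (op_L1 oT Lu) _ (op_ae oT Lu (L1B Lp Ln) e)); last exact: op_L1 (L1B Lp Ln).
rewrite (J_ae _ _ (opB oT Lp Ln)); [|exact: op_L1 (L1B Lp Ln)|apply: L1B; exact: op_L1].
rewrite JB; [|exact: op_L1|exact: op_L1].
rewrite !h//; try by apply: AE_all => x _; have [] := pn0 x.
by rewrite -JB//; apply: J_ae => //; [exact: L1B|exact: aeE_sym].
Qed.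

Lemma density_scale u : L u -> nonneg_ae d0 d1 u -> 0 < J u ->
  density d0 d1 (fun x => (J u)^-1 * u x).
Proof.
move=> Lu u0 Ju; split; first exact: L1Z.
split; first by refine (AE1 u0 _) => x _ h; rewrite mulr_ge0// invr_ge0 ltW.
by rewrite norm1Z// norm1_nonneg// ger0_norm ?invr_ge0 ?(ltW Ju)// mulVf// gt_eqF.
Qed.

(** The hypothesis speaks of densities only, so [u] is scaled to mass 1; a function of mass 0 is
    almost everywhere 0 and is handled by linearity. *)
Lemma stochastic_nonneg T u : stochastic_op d0 d1 T -> L u -> nonneg_ae d0 d1 u ->
  nonneg_ae d0 d1 (T u) /\ J (T u) = J u.
Proof.
move=> [oT sT] Lu u0; have := J_ge0 Lu u0; rewrite le_eqVlt => /orP[/eqP Ju|Ju].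
  have u00 : u =ae (fun=> 0) by apply: J_eq0 => //; rewrite -Ju.
  have Tu0 := aeE_trans (op_ae oT Lu L1_0 u00) (op0 oT).
  split; first by refine (AE1 Tu0 _) => x _ ->.
  by rewrite (J_ae (op_L1 oT Lu) L1_0 Tu0) (J_ae Lu L1_0 u00).
have [_ [d2 d3]] := sT _ (density_scale Lu u0 Ju).
have e := opZ oT (J u)^-1 Lu.
have LT := op_L1 oT Lu.
have T0 : nonneg_ae d0 d1 (T u).
  by refine (AE2 d2 e _) => x _ h he; move: h; rewrite he pmulr_rge0 ?invr_gt0.
split => //; move: d3; rewrite (norm1_ae _ _ e); [|exact: op_L1 (L1Z _ Lu)|exact: L1Z].
rewrite norm1Z// ger0_norm ?invr_ge0 ?(ltW Ju)// norm1_nonneg//.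
by move=> /(congr1 (fun r => J u * r)); rewrite mulrA mulfV ?gt_eqF// mul1r mulr1.
Qed.

Lemma stochastic_pos T : stochastic_op d0 d1 T -> positive_op d0 d1 T.
Proof. by move=> sT u Lu u0; have [] := stochastic_nonneg sT Lu u0. Qed.

Lemma stochastic_J T u : stochastic_op d0 d1 T -> L u -> J (T u) = J u.
Proof.
move=> sT; apply: J_op_eq; first by case: sT.
by move=> v Lv v0; have [] := stochastic_nonneg sT Lv v0.
Qed.

Lemma mk_stochastic T : L1op d0 d1 T -> positive_op d0 d1 T ->
  (forall u, L u -> J (T u) = J u) -> stochastic_op d0 d1 T.
Proof.
move=> oT pT JT; split => // u [Lu [u0 nu]]; split; first exact: op_L1.
split; first exact: pT.
rewrite norm1_nonneg; [|exact: op_L1|exact: pT].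
by rewrite JT// -norm1_nonneg.
Qed.

Lemma J_le_eq u v : L u -> L v -> AE d0 d1 (fun x => u x <= v x) -> J v <= J u -> u =ae v.
Proof.
move=> Lu Lv uv Jvu; have : (fun x => v x - u x) =ae (fun=> 0).
  apply: J_eq0; [exact: L1B|by refine (AE1 uv _) => x _; rewrite subr_ge0|].
  by rewrite JB// subr_le0.
by move=> h; refine (AE1 h _) => x _ /eqP; rewrite subr_eq0 => /eqP ->.
Qed.

End Operators.

(** * Generators of contraction semigroups *)

Section Semigroups.
Context {R : realType} {d0 d1 : \bar R} {Pt : R -> (R -> R) -> R -> R}.
Context (sg : pos_sc_contraction_semigroup d0 d1 Pt).
Implicit Types (u v w z : R -> R).
Local Notation L := (L1 d0 d1).
Local Notation J := (J d0 d1).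
Local Notation N := (norm1 d0 d1).
Local Notation "u =ae v" := (aeE d0 d1 u v) (at level 70).

Lemma cvg_right0P (f : R -> R) : f @ 0^'+ --> 0 <->
  forall e, 0 < e -> exists2 d, 0 < d & forall t, 0 < t -> t < d -> `|f t| < e.
Proof.
split=> [/cvgrPdist_lt h e e0|h].
  have /nbhs_ballP[d /= d0' hd] := h e e0.
  exists d => // t t0 td; have := hd t; rewrite /ball /= sub0r normrN gtr0_norm//.
  by rewrite sub0r normrN; exact.
apply/cvgrPdist_lt => e e0; have [d d0' hd] := h e e0.
apply/nbhs_ballP; exists d => //= t; rewrite /ball /= sub0r normrN => td t0.
by rewrite sub0r normrN; apply: hd => //; rewrite gtr0_norm in td.
Qed.

(** Over [n] equal steps the increments add up to at most [e * t]; with [e = |f t - f 0| / (2 * t)]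
    this is only half of the total increment. Applied to orbits, it plays the role of the fact that
    a vanishing derivative means constancy. *)
Lemma slow_const (f : R -> R) :
  (forall e, 0 < e -> exists2 d, 0 < d & forall s t, 0 <= s -> 0 < t -> t < d ->
    `|f (s + t) - f s| <= e * t) -> forall t, 0 <= t -> f t = f 0.
Proof.
move=> h t; rewrite le_eqVlt => /orP[/eqP <- //|t0].
apply/eqP; rewrite -subr_eq0 -normr_le0 leNgt; apply/negP => ft.
have [d dd hd] := h (`|f t - f 0| / (2 * t)) (divr_gt0 ft (mulr_gt0 (ltr0n _ 2) t0)).
set e := _ / _ in hd.
pose n := (Num.truncn (t / d)).+1.
have tn : t / n%:R < d.
  rewrite ltr_pdivrMr ?ltr0n// mulrC -ltr_pdivrMr//; exact: truncnS_gt.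
have tn0 : 0 < t / n%:R by rewrite divr_gt0// ltr0n.
have step k : `|f (k%:R * (t / n%:R)) - f 0| <= k%:R * (e * (t / n%:R)).
  elim: k => [|k IH]; first by rewrite !mul0r subrr normr0.
  have := hd (k%:R * (t / n%:R)) _ (mulr_ge0 (ler0n _ _) (ltW tn0)) tn0 tn.
  rewrite -[in X in X + _]/(k%:R * (t / n%:R)).
  have -> : k%:R * (t / n%:R) + t / n%:R = k.+1%:R * (t / n%:R) by rewrite -addn1 natrD; ring.
  set A := f (k.+1%:R * _); set B := f (k%:R * _) in IH *; move=> h1.
  have -> : k.+1%:R * (e * (t / n%:R)) = k%:R * (e * (t / n%:R)) + e * (t / n%:R).
    by rewrite -addn1 natrD; ring.
  have := ler_normD (A - B) (B - f 0); rewrite addrA subrK; lra.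
have := step n; have nn : n%:R != 0 :> R by rewrite pnatr_eq0.
have -> : n%:R * (t / n%:R) = t by field.
have -> : n%:R * (e * (t / n%:R)) = e * t by field.
have -> : e * t = `|f t - f 0| / 2 by rewrite /e; field; rewrite gt_eqF.
lra.
Qed.

Let sg0 u : L u -> Pt 0 u =ae u. Proof. by case: sg => [[h _] _ _]; exact: h. Qed.
Lemma sgD s t u : 0 <= s -> 0 <= t -> L u -> Pt (s + t) u =ae Pt s (Pt t u).
Proof. by case: sg => [[_ h] _ _]; exact: h. Qed.
Lemma sg_op t : 0 <= t -> L1op d0 d1 (Pt t).
Proof. by case: sg => _ h _ => /h[]. Qed.
Lemma sg_pos t : 0 <= t -> positive_op d0 d1 (Pt t).
Proof. by case: sg => _ h _ => /h[]. Qed.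
Lemma sg_contr t u : 0 <= t -> L u -> N (Pt t u) <= N u.
Proof. by case: sg => _ h _ => /h[_ _ k]; exact: k. Qed.
Lemma sg_L1 t u : 0 <= t -> L u -> L (Pt t u).
Proof. by move=> t0 Lu; exact: (op_L1 (sg_op t0)). Qed.
Hint Resolve sg_L1 : core.

Lemma sg_comm s t u : 0 <= s -> 0 <= t -> L u -> Pt s (Pt t u) =ae Pt t (Pt s u).
Proof.
move=> s0 t0 Lu; apply: aeE_trans (aeE_sym (sgD s0 t0 Lu)) _.
by rewrite addrC; exact: sgD.
Qed.

(** Multiplying the difference quotient by [t] gives a first-order expansion that is linear in [w]
    and [z]. *)
Lemma generatorP w z : L w -> L z -> generator d0 d1 Pt w z <->
  forall e, 0 < e -> exists2 d, 0 < d & forall t, 0 < t -> t < d ->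
    N (fun x => Pt t w x - w x - t * z x) <= e * t.
Proof.
move=> Lw Lz.
have key t : 0 < t -> N (fun x => Pt t w x - w x - t * z x) =
    t * N (fun x => (Pt t w x - w x) / t - z x).
  move=> t0; have LP := sg_L1 (ltW t0) Lw.
  have e : (fun x => (Pt t w x - w x) / t - z x) = fun x => t^-1 * (Pt t w x - w x - t * z x).
    by apply/funext => x; field; rewrite gt_eqF.
  rewrite e norm1Z; last by apply: L1B; [exact: L1B|exact: L1Z].
  by rewrite gtr0_norm ?invr_gt0// mulrA mulfV ?mul1r// gt_eqF.
have ge t : 0 < t -> 0 <= N (fun x => (Pt t w x - w x) / t - z x).
  move=> t0; have := norm1_ge0 (L1B (L1B (sg_L1 (ltW t0) Lw) Lw) (L1Z t Lz)).
  by rewrite key// pmulr_rge0.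
split=> [[_ _ /cvg_right0P h] e e0|h].
  have [d dd hd] := h e e0; exists d => // t t0 td.
  have := hd t t0 td; rewrite ger0_norm ?ge// key// mulrC => k.
  by rewrite ler_wpM2r ?ltW.
split => //; apply/cvg_right0P => e e0.
have [d dd hd] := h (e / 2) (divr_gt0 e0 (ltr0n _ 2)); exists d => // t t0 td.
have := hd t t0 td; rewrite ger0_norm ?ge// key// mulrC ler_pM2r// => k.
by apply: le_lt_trans k _; lra.
Qed.

Lemma gen_L1 w z : generator d0 d1 Pt w z -> L w /\ L z.
Proof. by case. Qed.

Lemma gen_comb a b w z w' z' : generator d0 d1 Pt w z -> generator d0 d1 Pt w' z' ->
  generator d0 d1 Pt (fun x => a * w x + b * w' x) (fun x => a * z x + b * z' x).
Proof.
move=> h h'; have [Lw Lz] := gen_L1 h; have [Lw' Lz'] := gen_L1 h'.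
apply/generatorP; [exact: L1_comb|exact: L1_comb|move=> e e0].
pose c := `|a| + `|b| + 1; have c0 : 0 < c.
  by rewrite /c; have := normr_ge0 a; have := normr_ge0 b; lra.
have [d dd hd] := (generatorP Lw Lz).1 h (e / c) (divr_gt0 e0 c0).
have [d' dd' hd'] := (generatorP Lw' Lz').1 h' (e / c) (divr_gt0 e0 c0).
exists (Num.min d d'); first by rewrite lt_min dd.
move=> t t0; rewrite lt_min => /andP[td td']; have t0' := ltW t0.
have L1' : L (fun x => Pt t w x - w x - t * z x).
  by apply: L1B; [apply: L1B => //; exact: sg_L1|exact: L1Z].
have L2' : L (fun x => Pt t w' x - w' x - t * z' x).
  by apply: L1B; [apply: L1B => //; exact: sg_L1|exact: L1Z].
rewrite (@norm1_ae _ _ _ _ (fun x => a * (Pt t w x - w x - t * z x) +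
    b * (Pt t w' x - w' x - t * z' x))); first last.
- by refine (AE1 (op_comb (sg_op t0') a b Lw Lw') _) => x _ ->; ring.
- exact: L1_comb.
- apply: L1B; last by apply: L1Z; exact: L1_comb.
  by apply: L1B; [apply: sg_L1 => //; exact: L1_comb|exact: L1_comb].
apply: le_trans (norm1D (L1Z a L1') (L1Z b L2')) _.
rewrite !norm1Z//.
have k1 : `|a| * N (fun x => Pt t w x - w x - t * z x) <= `|a| * (e / c * t).
  by rewrite ler_wpM2l// hd.
have k2 : `|b| * N (fun x => Pt t w' x - w' x - t * z' x) <= `|b| * (e / c * t).
  by rewrite ler_wpM2l// hd'.
have k3 : e * t = c * (e / c * t) by field; rewrite gt_eqF.
have k4 : 0 <= e / c * t by rewrite !mulr_ge0// ?invr_ge0 ltW.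
by rewrite k3 /c; lra.
Qed.

Lemma gen_ae w z w' z' : generator d0 d1 Pt w z -> L w' -> L z' -> w =ae w' -> z =ae z' ->
  generator d0 d1 Pt w' z'.
Proof.
move=> h Lw' Lz' ww' zz'; have [Lw Lz] := gen_L1 h.
apply/generatorP => // e e0; have [d dd hd] := (generatorP Lw Lz).1 h e e0.
exists d => // t t0 td; have t0' := ltW t0.
rewrite (@norm1_ae _ _ _ _ (fun x => Pt t w x - w x - t * z x)); first exact: hd.
- by apply: L1B; [apply: L1B => //; exact: sg_L1|exact: L1Z].
- by apply: L1B; [apply: L1B => //; exact: sg_L1|exact: L1Z].
- refine (AE3 (op_ae (sg_op t0') Lw Lw' ww') ww' zz' _) => x _ -> -> -> //.
Qed.

(** Dissipativity: if [z = lam w], the expansion says that [Pt t w] is [(1 + t * lam) * w] up to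
    [o(t)], and a contraction cannot enlarge [w] at first order. *)
Lemma gen_inj lam w z : 0 < lam -> generator d0 d1 Pt w z ->
  (fun x => lam * w x - z x) =ae (fun=> 0) -> w =ae (fun=> 0).
Proof.
move=> l0 h zE; have [Lw Lz] := gen_L1 h.
apply: norm1_eq0 => //; rewrite leNgt; apply/negP => nw.
have e0 : 0 < lam * N w / 2 by rewrite divr_gt0// mulr_gt0.
have [d dd hd] := (generatorP Lw Lz).1 h _ e0.
pose t := d / 2; have t0 : 0 < t by rewrite divr_gt0.
have td : t < d by rewrite /t; lra.
have LP := sg_L1 (ltW t0) Lw.
have Lr : L (fun x => Pt t w x - w x - t * z x) by apply: L1B; [exact: L1B|exact: L1Z].
have hr := hd t t0 td.
have : N (fun x => (1 + t * lam) * w x) <= N (Pt t w) + N (fun x => (-1) * (Pt t w x - w x - t * z x)).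
  apply: le_trans (norm1D LP (L1Z (-1) Lr)).
  rewrite le_eqVlt; apply/orP; left; apply/eqP; apply: norm1_ae.
  - exact: L1Z.
  - by apply: L1D => //; exact: L1Z.
  - by refine (AE1 zE _) => x _ /eqP; rewrite subr_eq0 => /eqP <-; ring.
rewrite !norm1Z// normrN1 mul1r ger0_norm; last by rewrite addr_ge0// mulr_ge0 ?ltW.
have := sg_contr (ltW t0) Lw => k1 k2.
have : t * lam * N w <= lam * N w / 2 * t by lra.
have : 0 < t * lam * N w by rewrite !mulr_gt0.
lra.
Qed.

Lemma gen_resolvent_unique lam w z w' z' : 0 < lam ->
  generator d0 d1 Pt w z -> generator d0 d1 Pt w' z' ->
  (fun x => lam * w x - z x) =ae (fun x => lam * w' x - z' x) -> w =ae w'.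
Proof.
move=> l0 h h' e; have := gen_inj l0 (gen_comb 1 (-1) h h') _ => k.
refine (AE1 (k _) _) => [|x _ /eqP].
  by refine (AE1 e _) => x _ ex; transitivity ((lam * w x - z x) - (lam * w' x - z' x));
    [ring|rewrite ex subrr].
by rewrite mul1r mulN1r subr_eq0 => /eqP.
Qed.

Lemma gen_comm t w z : 0 <= t -> generator d0 d1 Pt w z -> generator d0 d1 Pt (Pt t w) (Pt t z).
Proof.
move=> t0 h; have [Lw Lz] := gen_L1 h.
have LPw := sg_L1 t0 Lw; have LPz := sg_L1 t0 Lz.
apply/generatorP => // e e0; have [d dd hd] := (generatorP Lw Lz).1 h e e0.
exists d => // s s0 sd; have s0' := ltW s0; apply: le_trans (hd s s0 sd).
have Ld : L (fun x => Pt s w x - w x) by apply: L1B => //; exact: sg_L1.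
have Lr : L (fun x => Pt s w x - w x - s * z x) by apply: L1B => //; exact: L1Z.
apply: le_trans (sg_contr t0 Lr).
rewrite le_eqVlt; apply/orP; left; apply/eqP; apply: norm1_ae.
- by apply: L1B; [apply: L1B => //; exact: sg_L1|exact: L1Z].
- exact: sg_L1.
have LPs := sg_L1 s0' Lw.
have e1 : Pt t (fun x => Pt s w x - w x - s * z x) =ae
    (fun x => Pt t (Pt s w) x - Pt t w x - s * Pt t z x).
  refine (AE3 (opB (sg_op t0) Ld (L1Z s Lz)) (opB (sg_op t0) LPs Lw) (opZ (sg_op t0) s Lz) _).
  by move=> x _ -> -> ->.
by refine (AE2 e1 (sg_comm s0' t0 Lw) _) => x _ -> ->.
Qed.

Lemma gen_unique w z z' : generator d0 d1 Pt w z -> generator d0 d1 Pt w z' -> z =ae z'.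
Proof.
move=> h h'; have [Lw Lz] := gen_L1 h; have [_ Lz'] := gen_L1 h'.
apply: norm1_sub0 => //; rewrite leNgt; apply/negP => nz.
set n := N _ in nz; have e0 : 0 < n / 4 by rewrite divr_gt0.
have [d dd hd] := (generatorP Lw Lz).1 h _ e0.
have [d' dd' hd'] := (generatorP Lw Lz').1 h' _ e0.
pose t := Num.min d d' / 2; have m0 : 0 < Num.min d d' by rewrite lt_min dd.
have t0 : 0 < t by rewrite divr_gt0.
have tm : t < Num.min d d' by rewrite /t; lra.
have [td td'] : t < d /\ t < d' by move: tm; rewrite lt_min => /andP[].
have LP := sg_L1 (ltW t0) Lw.
have Lr : L (fun x => Pt t w x - w x - t * z x) by apply: L1B; [exact: L1B|exact: L1Z].
have Lr' : L (fun x => Pt t w x - w x - t * z' x) by apply: L1B; [exact: L1B|exact: L1Z].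
have := norm1D Lr' (L1Z (-1) Lr); rewrite norm1Z// normrN1 mul1r.
rewrite (_ : (fun x => _) = (fun x => t * (z x - z' x))); last by apply/funext => x; ring.
rewrite norm1Z; last exact: L1B.
rewrite gtr0_norm// -/n; have := hd t t0 td; have := hd' t t0 td'.
have : 0 < n / 4 * t by rewrite mulr_gt0.
lra.
Qed.

Lemma fixed_gen w : L w -> (forall t, 0 <= t -> Pt t w =ae w) -> generator d0 d1 Pt w (fun=> 0).
Proof.
move=> Lw h; apply/generatorP => //; first exact: L1_0.
move=> e e0; exists 1 => // t t0 _.
rewrite (@norm1_ae _ _ _ _ (fun=> 0)); first by rewrite norm1E normr0 J0 mulr_ge0// ltW.
- by apply: L1B; [apply: L1B => //; apply: sg_L1 => //; exact: ltW|apply: L1Z; exact: L1_0].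
- exact: L1_0.
- by refine (AE1 (h t (ltW t0)) _) => x _ ->; ring.
Qed.

Lemma sg_increment s t w : 0 <= s -> 0 <= t -> L w ->
  N (fun x => Pt (s + t) w x - Pt s w x) <= N (fun x => Pt t w x - w x).
Proof.
move=> s0 t0 Lw; have LP := sg_L1 t0 Lw.
apply: le_trans (sg_contr s0 (L1B LP Lw)).
rewrite le_eqVlt; apply/orP; left; apply/eqP; apply: norm1_ae.
- by apply: L1B; apply: sg_L1 => //; exact: addr_ge0.
- by apply: sg_L1 => //; exact: L1B.
- by refine (AE2 (sgD s0 t0 Lw) (opB (sg_op s0) LP Lw) _) => x _ -> ->.
Qed.

(** The distance from [Pt s w] to [w] varies by [o(r)] over a step [r], uniformly in [s], since
    [Pt s] contracts the increment at time 0; [slow_const] then makes it 0. *)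
Lemma gen0_fixed w t : generator d0 d1 Pt w (fun=> 0) -> 0 <= t -> Pt t w =ae w.
Proof.
move=> h t0; have [Lw Lz] := gen_L1 h.
apply: norm1_sub0 => //; first exact: sg_L1.
rewrite (@slow_const (fun t => N (fun x => Pt t w x - w x)) _ t t0).
  rewrite (@norm1_ae _ _ _ _ (fun=> 0)) ?norm1E ?normr0 ?J0//.
  - by apply: L1B => //; exact: sg_L1.
  - by refine (AE1 (sg0 Lw) _) => x _ ->; rewrite subrr.
move=> e e0; have [d dd hd] := (generatorP Lw Lz).1 h e e0.
exists d => // s r s0 r0 rd; have r0' := ltW r0.
have LPs := sg_L1 s0 Lw; have LPr := sg_L1 r0' Lw; have LPsr := sg_L1 (addr_ge0 s0 r0') Lw.
have h1 : N (fun x => Pt (s + r) w x - Pt s w x) <= e * r.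
  apply: le_trans (sg_increment s0 r0' Lw) _.
  have := hd r r0 rd; rewrite (_ : (fun x => _) = (fun x => Pt r w x - w x))//.
  by apply/funext => x; rewrite mulr0 subr0.
have h2 := norm1D (L1B LPsr LPs) (L1B LPs Lw).
rewrite (_ : (fun x => _) = (fun x => Pt (s + r) w x - w x)) in h2; last first.
  by apply/funext => x; rewrite addrA subrK.
have h3 := norm1D (L1Z (-1) (L1B LPsr LPs)) (L1B LPsr Lw).
rewrite norm1Z ?normrN1 ?mul1r in h3; last exact: L1B.
rewrite (_ : (fun x => _) = (fun x => Pt s w x - w x)) in h3; last first.
  by apply/funext => x; ring.
by rewrite ler_norml; apply/andP; split; lra.
Qed.

(** The derivative of [J (Pt s w)] is [J (Pt s z)], and [Pt s z] is again a value of the generator,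
    at [Pt s w], so that its integral is 0. *)
Lemma gen_mass w z t : (forall w z, generator d0 d1 Pt w z -> J z = 0) ->
  generator d0 d1 Pt w z -> 0 <= t -> J (Pt t w) = J w.
Proof.
move=> J0g h t0; have [Lw Lz] := gen_L1 h.
rewrite (@slow_const (fun t => J (Pt t w)) _ t t0).
  by apply: J_ae; [exact: sg_L1|exact: Lw|exact: sg0].
move=> e e0; have [d dd hd] := (generatorP Lw Lz).1 h e e0.
exists d => // s r s0 r0 rd; have r0' := ltW r0.
have LPs := sg_L1 s0 Lw; have LPr := sg_L1 r0' Lw; have LPsr := sg_L1 (addr_ge0 s0 r0') Lw.
have Ld : L (fun x => Pt r w x - w x) by exact: L1B.
have Lr : L (fun x => Pt r w x - w x - r * z x) by apply: L1B => //; exact: L1Z.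
apply: le_trans (hd r r0 rd); apply: le_trans (sg_contr s0 Lr).
have LPz := sg_L1 s0 Lz.
have e1 : Pt s (fun x => Pt r w x - w x - r * z x) =ae
    (fun x => Pt s (Pt r w) x - Pt s w x - r * Pt s z x).
  refine (AE3 (opB (sg_op s0) Ld (L1Z r Lz)) (opB (sg_op s0) LPr Lw) (opZ (sg_op s0) r Lz) _).
  by move=> x _ -> -> ->.
have e2 : Pt s (fun x => Pt r w x - w x - r * z x) =ae
    (fun x => Pt (s + r) w x - Pt s w x - r * Pt s z x).
  by refine (AE2 e1 (sgD s0 r0' Lw) _) => x _ -> ->.
rewrite (norm1_ae _ _ e2); first last.
- by apply: L1B; [exact: L1B|exact: L1Z].
- exact: sg_L1.
have -> : J (Pt (s + r) w) - J (Pt s w) =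
    J (fun x => Pt (s + r) w x - Pt s w x - r * Pt s z x).
  rewrite JB; [|exact: L1B|exact: L1Z].
  by rewrite JB// JZ// (J0g _ _ (gen_comm s0 h)) mulr0 subr0.
by rewrite norm1E; apply: J_abs; apply: L1B; [exact: L1B|exact: L1Z].
Qed.

End Semigroups.

(** * Monotone limits and truncation in L^1 *)

Section MonotoneLimits.
Context {R : realType} {d0 d1 : \bar R}.
Implicit Types (u v w : R -> R).
Local Notation E := (Eset d0 d1).
Local Notation L := (L1 d0 d1).
Local Notation J := (J d0 d1).

(** The order holds only almost everywhere, so the limit is taken to be the infimum of the
    [max (v n) 0], which are bounded below everywhere; this keeps it measurable. *)
Lemma decreasing_limit (v : nat -> R -> R) : (forall n, L (v n)) ->
  (forall n, AE d0 d1 (fun x => 0 <= v n.+1 x <= v n x)) ->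
  exists w, [/\ L w, AE d0 d1 (fun x => forall n, 0 <= w x <= v n x) &
    (fun n => J (v n)) @ \oo --> J w].
Proof.
move=> Lv vdec.
pose p n x := Num.max (v n x) 0; pose w x := infs (fun n => p n x) 0%N.
have lb x : has_lbound (range (fun n => p n x)).
  by exists 0 => _ [n _ <-]; rewrite /p le_max lexx orbT.
have mp n : measurable_fun E (p n).
  by apply: measurable_maxr => //; exact: L1_meas.
have mw : measurable_fun E w by apply: measurable_fun_infs => // x _; exact: lb.
have pw : AE d0 d1 (fun x => [/\ forall n, 0 <= v n x, forall n, p n x = v n x,
    nonincreasing_seq (fun n => p n x) & (fun n => p n x) @ \oo --> w x]).
  refine (AE1 (AE_foralln vdec) _) => x Ex h.
  have v0 n : 0 <= v n x.
    by case: n => [|n]; [have /andP[] := h 0%N; exact: le_trans|have /andP[] := h n].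
  have pv n : p n x = v n x by rewrite /p max_l.
  have dec : nonincreasing_seq (fun n => p n x).
    by apply/nonincreasing_seqP => n; rewrite !pv; have /andP[] := h n.
  split => //; have := nonincreasing_cvgn dec (lb x).
  rewrite (_ : w x = inf (range (fun n => p n x))) // /w /infs /sdrop /=.
  by congr inf; apply/seteqP; split => y [k _ <-]; exists k.
have [] := @J_dct R d0 d1 v w (v 0%N) _ mw (Lv 0%N) _ _.
- by move=> n; exact: L1_meas.
- refine (AE1 pw _) => x _ [_ pv _ c].
  by rewrite (_ : v^~ x = fun n => p n x)//; apply/funext => n.
- move=> n; refine (AE1 pw _) => x _ [v0 pv dec _].
  by rewrite ger0_norm// -!pv; apply: dec.
move=> Lw cw; exists w; split => //.
refine (AE1 pw _) => x _ [v0 pv dec c] n; apply/andP; split.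
  apply: (cvgr_to_ge c); apply: nearW => k; by rewrite pv.
apply: (cvgr_to_le c); exists n => // k /= nk.
by rewrite -pv; apply: dec.
Qed.

Lemma increasing_limit (v : nat -> R -> R) u : (forall n, L (v n)) -> L u ->
  (forall n, AE d0 d1 (fun x => v n x <= v n.+1 x <= u x)) ->
  exists w, [/\ L w, AE d0 d1 (fun x => forall n, v n x <= w x <= u x) &
    (fun n => J (v n)) @ \oo --> J w].
Proof.
move=> Lv Lu vinc.
have [w [Lw hw cw]] : exists w, [/\ L w, AE d0 d1 (fun x => forall n, 0 <= w x <= u x - v n x) &
    (fun n => J (fun x => u x - v n x)) @ \oo --> J w].
  apply: (@decreasing_limit (fun n x => u x - v n x)) => n; first exact: L1B.
  by refine (AE1 (vinc n) _) => x _ /andP[h1 h2]; apply/andP; split; lra.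
exists (fun x => u x - w x); split; first exact: L1B.
  by refine (AE1 hw _) => x _ h n; have /andP[h1 h2] := h n; apply/andP; split; lra.
rewrite JB//.
have -> : (fun n => J (v n)) = (fun n => J u - J (fun x => u x - v n x)).
  by apply/funext => n; rewrite JB// opprB addrC subrK.
by apply: cvgB => //; exact: cvg_cst.
Qed.

(** Where [v > 0] the cut-off [n * v] eventually exceeds [u], so the remainder tends to 0 pointwise
    while staying below [u]. *)
Lemma truncation_small u v e : L u -> nonneg_ae d0 d1 u -> L v -> pos_ae d0 d1 v -> 0 < e ->
  exists2 M, 0 < M & J (fun x => u x - Num.min (u x) (M * v x)) < e.
Proof.
move=> Lu u0 Lv v0 e0.
pose f (n : nat) x := u x - Num.min (u x) (n%:R * v x).
have Lf n : L (f n) by apply: L1B => //; apply: L1_min => //; exact: L1Z.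
have [] := @J_dct R d0 d1 f (fun=> 0) (fun x => `|u x|) _ _ (L1_abs Lu) _ _.
- by move=> n; exact: L1_meas.
- exact: measurable_cst.
- refine (AE1 v0 _) => x _ vx; apply: cvg_near_cst.
  exists (Num.truncn (u x / v x)).+1 => // n /= hn; rewrite /f min_l ?subrr//.
  rewrite -ler_pdivrMr// (le_trans (ltW (truncnS_gt _)))// ler_nat//.
- move=> n; refine (AE2 u0 v0 _) => x _ ux vx; rewrite /f.
  have : 0 <= n%:R * v x by rewrite mulr_ge0// ltW.
  rewrite /Num.min; case: ifPn => [_ _|]; first by rewrite subrr normr0.
  by rewrite -leNgt => h1 h2; rewrite !ger0_norm//; lra.
move=> _; rewrite J0 => /cvgrPdist_lt /(_ e e0)[N _ hN].
exists (N.+1%:R); first by rewrite ltr0n.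
have := hN N.+1 (leqnSn N); rewrite /= sub0r normrN => h.
by apply: le_lt_trans (ler_norm _) h.
Qed.

End MonotoneLimits.

(** * The minimal semigroup *)

Section MinimalSemigroup.
Context {R : realType} {d0 d1 : \bar R} {g phi : R -> R}.
Context {P : (R -> R) -> R -> R} {Pt : R -> (R -> R) -> R -> R}.
Context (M : flow_model d0 d1 g phi) (sP : stochastic_op d0 d1 P).
Context (mS : minimal_semigroup d0 d1 g phi P Pt).
Implicit Types (u v w z : R -> R) (lam : R).
Local Notation L := (L1 d0 d1).
Local Notation J := (J d0 d1).
Local Notation N := (norm1 d0 d1).
Local Notation "u =ae v" := (aeE d0 d1 u v) (at level 70).
Let sg := proj1 mS.
Let oP := proj1 sP.
Let pP := stochastic_pos sP.

Lemma op_iter (T : (R -> R) -> R -> R) n : L1op d0 d1 T -> L1op d0 d1 (iter n T).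
Proof.
move=> oT; elim: n => [|n [IH1 IH2 IH3]]; first by split => // *; exact: aeE_refl.
split=> [u Lu|u v Lu Lv uv|a b u v Lu Lv] /=.
- by apply: (op_L1 oT); exact: IH1.
- by apply: (op_ae oT); [exact: IH1|exact: IH1|exact: IH2].
- apply: (aeE_trans (op_ae oT _ _ (IH3 a b u v Lu Lv))).
  + by apply: IH1; exact: L1_comb.
  + by apply: L1_comb; exact: IH1.
  + by apply: (op_comb oT); exact: IH1.
Qed.

Lemma pos_iter (T : (R -> R) -> R -> R) n : L1op d0 d1 T -> positive_op d0 d1 T ->
  positive_op d0 d1 (iter n T).
Proof.
move=> oT pT; elim: n => [|n IH] u Lu u0 //=.
by apply: pT; [exact: (op_L1 (op_iter n oT))|exact: IH].
Qed.

Section FixLam.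
Context (lam : R) (lam0 : 0 < lam).
Local Notation RAl := (RA d0 d1 g phi lam).
Local Notation B := (stepPA d0 d1 g phi P lam).
Local Notation pres := (partial_res d0 d1 g phi P lam).

Lemma RA_op : L1op d0 d1 RAl.
Proof.
split=> *; [exact: (L1_RA M)|exact: (RA_congr M)|exact: (RA_comb M)].
Qed.

Lemma RA_pos : positive_op d0 d1 RAl.
Proof. by move=> u; exact: (RA_ge0 M). Qed.

Lemma step_op : L1op d0 d1 B.
Proof.
split=> [u Lu|u v Lu Lv uv|a b u v Lu Lv].
- by apply: (op_L1 oP); exact: (L1_phiRA M).
- apply: (op_ae oP); [exact: (L1_phiRA M)|exact: (L1_phiRA M)|].
  by refine (AE1 (RA_congr M lam0 Lu Lv uv) _) => x _ ->.
- have L1' := L1_phiRA M lam0 Lu; have L2' := L1_phiRA M lam0 Lv.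
  apply: (aeE_trans (op_ae oP _ (L1_comb a b L1' L2') _)) (op_comb oP a b L1' L2').
    by apply: (L1_phiRA M lam0); exact: L1_comb.
  by refine (AE1 (RA_comb M lam0 a b Lu Lv) _) => x _ ->; ring.
Qed.

Lemma step_pos : positive_op d0 d1 B.
Proof.
move=> u Lu u0; apply: pP; first exact: (L1_phiRA M).
refine (AE1 (RA_ge0 M lam0 Lu u0) _) => x Ex h.
by rewrite mulr_ge0// (fm_ge0 M).
Qed.

(** Mass balance of the resolvent, [P] preserving integrals: one step of [B] loses exactly what the
    resolvent keeps. *)
Lemma J_step u : L u -> lam * J (RAl u) = J u - J (B u).
Proof.
move=> Lu; rewrite -(RA_mass M lam0 Lu) (stochastic_J sP); last exact: (L1_phiRA M).
by rewrite addrK.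
Qed.

Let iL n u : L u -> L (iter n B u). Proof. exact: (op_L1 (op_iter n step_op)). Qed.

Lemma L1_partial n u : L u -> L (fun x => \sum_(i < n) iter i B u x).
Proof.
move=> Lu; elim: n => [|n IH].
  by apply: L1_eqE L1_0 => x _; rewrite big_ord0.
by apply: L1_eqE (L1D IH (iL n Lu)) => x _; rewrite big_ord_recr.
Qed.

Lemma pres0 u : pres 0 u = RAl u.
Proof.
rewrite /partial_res (_ : (fun x => _) = u)//.
by apply/funext => x; rewrite big_ord_recr /= big_ord0 add0r.
Qed.

Lemma presS n u : L u -> pres n.+1 u =ae (fun x => pres n u x + RAl (iter n.+1 B u) x).
Proof.
move=> Lu; rewrite {1}/partial_res.
rewrite (_ : (fun x => _) = (fun x => \sum_(i < n.+1) iter i B u x + iter n.+1 B u x)).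
  by apply: (opD RA_op); [exact: L1_partial|exact: iL].
by apply/funext => x; rewrite big_ord_recr.
Qed.

Lemma L1_pres n u : L u -> L (pres n u).
Proof. by move=> Lu; apply: (op_L1 RA_op); exact: L1_partial. Qed.

(** The losses telescope. Hence the failure of [R(lam, C)] to preserve mass is measured by the limit
    of [J (iter n B u)]. *)
Lemma J_pres n u : L u -> lam * J (pres n u) = J u - J (iter n.+1 B u).
Proof.
move=> Lu; elim: n => [|n IH]; first by rewrite pres0 J_step.
have Li := iL n.+1 Lu; have LR := op_L1 RA_op Li.
rewrite (J_ae _ _ (presS n Lu)); [|exact: L1_pres|by apply: L1D => //; exact: L1_pres].
rewrite JD//; last exact: L1_pres.
by rewrite mulrDr IH J_step//= addrA subrK.
Qed.

Lemma cvg_norm_eps (f : nat -> R -> R) : (fun n => N (f n)) @ \oo --> 0 ->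
  forall e, 0 < e -> exists n0, forall n, (n0 <= n)%N -> N (f n) < e.
Proof.
move=> /cvgrPdist_lt h e e0; have [n0 _ hn] := h e e0.
exists n0 => n nn; have := hn n nn; rewrite /= sub0r normrN.
by apply: le_lt_trans; exact: ler_norm.
Qed.

Lemma resolventC u : L u -> exists w z, [/\ generator d0 d1 Pt w z,
  (fun x => lam * w x - z x) =ae u &
  forall e, 0 < e -> exists n0, forall n, (n0 <= n)%N -> N (fun x => pres n u x - w x) < e].
Proof.
move=> Lu; have [w [z [h1 h2 h3]]] := proj2 mS lam lam0 u Lu.
by exists w, z; split => //; exact: (cvg_norm_eps h3).
Qed.

(** [RAl (iter n.+1 B u)] is the difference of two consecutive terms of the convergent sequence
    [pres n u]. *)
Lemma RA_iter_cvg0 u e : L u -> 0 < e ->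
  exists n0, forall n, (n0 <= n)%N -> N (RAl (iter n.+1 B u)) < e.
Proof.
move=> Lu e0; have [w [z [/gen_L1[Lw _] _ h]]] := resolventC Lu.
have [n0 hn] := h (e / 2) (divr_gt0 e0 (ltr0n _ 2)).
exists n0 => n nn; have k1 := hn n nn; have k2 := hn n.+1 (leq_trans nn (leqnSn n)).
have Lp := L1_pres n Lu; have LpS := L1_pres n.+1 Lu.
have := norm1D (L1B LpS Lw) (L1Z (-1) (L1B Lp Lw)).
rewrite norm1Z ?normrN1 ?mul1r; last exact: L1B.
rewrite (@norm1_ae _ _ _ _ (RAl (iter n.+1 B u))); first by move=> k3; lra.
- by apply: L1D; [exact: L1B|apply: L1Z; exact: L1B].
- by apply: (op_L1 RA_op); exact: (iL n.+1).
- by refine (AE1 (presS n Lu) _) => x _ ->; ring.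
Qed.

End FixLam.

Let o1 : 0 < 1 :> R := ltr01.
Local Notation R1 := (RA d0 d1 g phi 1).
Local Notation B1 := (stepPA d0 d1 g phi P 1).
Local Notation pres1 := (partial_res d0 d1 g phi P 1).

(** The inclusion of [A + P phi] in the generator is derived from the resolvent formula. With
    [w0 = (1 - A) u] one has [R1 w0 = u], and [f = w0 - B1 w0] is [(1 - A - P phi) u]. The partial
    sums of [f] telescope to [u - R1 (iter n.+1 B1 w0)], so [R(1, C) f = u]. *)
Lemma generator_extends u w : DA_deriv d0 d1 g phi u w ->
  generator d0 d1 Pt u (fun x => - w x - phi x * u x + P (fun y => phi y * u y) x).
Proof.
move=> DA; have [Lu Lw Lphi _] := DA.
have LP := op_L1 oP Lphi.
pose w0 x := u x + w x + phi x * u x.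
have Lw0 : L w0 by apply: L1D => //; exact: L1D.
have Rw0 : R1 w0 =ae u.
  have h : is_resolventA d0 d1 g phi 1 w0 u.
    exists (fun x => - w x - phi x * u x); split.
      by exists w; split => //; exact: aeE_refl.
    by apply: AE_all => x _; rewrite /w0; ring.
  have [h1 _] := RA_unique M o1 Lw0 h.
  exact: (aeE_trans (RA_ae M o1 Lw0) (aeE_sym h1)).
have Bw0 : B1 w0 =ae P (fun y => phi y * u y).
  apply: (op_ae oP) => //; first exact: (L1_phiRA M).
  by refine (AE1 Rw0 _) => x _ ->.
pose f x := w0 x - P (fun y => phi y * u y) x.
have Lf : L f by exact: L1B.
have LB := op_L1 (step_op o1) Lw0.
have fE : f =ae (fun x => w0 x - B1 w0 x) by refine (AE1 Bw0 _) => x _ ->.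
have iL n v : L v -> L (iter n B1 v) by exact: (op_L1 (op_iter n (step_op o1))).
have RL v : L v -> L (R1 v) by exact: (op_L1 (RA_op o1)).
have itf n : iter n B1 f =ae (fun x => iter n B1 w0 x - iter n.+1 B1 w0 x).
  have on := op_iter n (step_op o1).
  apply: (aeE_trans (op_ae on Lf (L1B Lw0 LB) fE)).
  by rewrite iterSr; exact: (opB on).
have Ritf n : R1 (iter n B1 f) =ae (fun x => R1 (iter n B1 w0) x - R1 (iter n.+1 B1 w0) x).
  apply: (aeE_trans (op_ae (RA_op o1) (iL n f Lf) (L1B (iL n _ Lw0) (iL n.+1 _ Lw0)) (itf n))).
  by apply: (opB (RA_op o1)); [exact: (iL n)|exact: (iL n.+1)].
have presE n : pres1 n f =ae (fun x => u x - R1 (iter n.+1 B1 w0) x).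
  elim: n => [|n IH].
    rewrite pres0; apply: (aeE_trans (Ritf 0%N)).
    by refine (AE1 Rw0 _) => x _ ->.
  apply: (aeE_trans (presS o1 n Lf)).
  by refine (AE2 IH (Ritf n.+1) _) => x _ -> ->; ring.
have [v [z [gvz vzf hv]]] := resolventC o1 Lf.
have [Lv Lz] := gen_L1 gvz.
have uv : u =ae v.
  apply: norm1_sub0 => //; rewrite leNgt; apply/negP; set e := N _ => e0.
  have e20 : 0 < e / 2 by rewrite divr_gt0.
  have [n1 h1] := hv _ e20; have [n2 h2] := RA_iter_cvg0 o1 Lw0 e20.
  have k1 := h1 (maxn n1 n2) (leq_maxl _ _); have k2 := h2 (maxn n1 n2) (leq_maxr _ _).
  set n := maxn n1 n2 in k1 k2.
  have LRi : L (R1 (iter n.+1 B1 w0)) by apply: RL; exact: (iL n.+1).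
  have Lp := L1_pres o1 n Lf.
  have := norm1D (L1B Lp Lv) LRi.
  rewrite (@norm1_ae _ _ _ _ (fun x => u x - v x)); first by rewrite -/e; lra.
  - by apply: L1D => //; exact: L1B.
  - exact: L1B.
  - by refine (AE1 (presE n) _) => x _ ->; ring.
apply: (gen_ae sg gvz) => //.
- by apply: L1D => //; apply: L1B => //; exact: L1N.
- exact: aeE_sym.
- by refine (AE2 uv vzf _) => x _ e; rewrite /f /w0 -e => h; lra.
Qed.

Section InvariantK.
Context (vs : R -> R) (ivs : invariant_op d0 d1 (Kop d0 d1 g phi P) vs).
Let Lvs : L vs := (ivs.1).1.
Let vs0 : nonneg_ae d0 d1 vs := (ivs.1).2.1.
Local Notation R0vs := (R0 d0 d1 g phi vs).

Lemma R0_funE v : R0 d0 d1 g phi v = @Rlam R d0 g phi 0 v.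
Proof. by apply/funext => x; rewrite R0E. Qed.

Lemma L1_phiR0 v : L v -> L (fun x => phi x * R0 d0 d1 g phi v x).
Proof. by move=> Lv; rewrite R0_funE; exact: (L1_phiRlam M). Qed.

Lemma step_le_Kop v : L v -> nonneg_ae d0 d1 v ->
  AE d0 d1 (fun x => B1 v x <= Kop d0 d1 g phi P v x).
Proof.
move=> Lv v0; apply: (op_le oP pP); [exact: (L1_phiRA M)|exact: L1_phiR0|].
refine (AE1 (RA_le_R0 M o1 Lv v0) _) => x Ex h.
by rewrite ler_wpM2l// (fm_ge0 M).
Qed.

(** [A (R0 vs) = - vs] and [P (phi * R0 vs) = K vs = vs] cancel, so the generator sends [R0 vs] to
    0. *)
Lemma R0_fixed : L R0vs -> forall t, 0 <= t -> Pt t R0vs =ae R0vs.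
Proof.
move=> LR t; apply: (gen0_fixed sg).
have DA : DA_deriv d0 d1 g phi R0vs (fun x => vs x - (0 + phi x) * R0vs x).
  by rewrite !R0_funE in LR *; exact: (DA_Rlam M (lexx 0)).
apply: (gen_ae sg (generator_extends DA)) => //.
- exact: L1_0.
- exact: aeE_refl.
- by refine (AE1 ivs.2 _) => x _; rewrite /Kop => ->; ring.
Qed.

Lemma step_iter_vs : (fun n => J (iter n B1 vs)) @ \oo --> 0.
Proof.
have on n := op_iter n (step_op o1); have pn n := pos_iter n (step_op o1) (step_pos o1).
have LB := op_L1 (step_op o1) Lvs.
have dec1 : AE d0 d1 (fun x => B1 vs x <= vs x).
  by refine (AE2 (step_le_Kop Lvs vs0) ivs.2 _) => x _ h e; rewrite -e.
have Ln n : L (iter n B1 vs) by exact: (op_L1 (on n)).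
have [w [Lw hw cw]] : exists w, [/\ L w,
    AE d0 d1 (fun x => forall n, 0 <= w x <= iter n B1 vs x) &
    (fun n => J (iter n B1 vs)) @ \oo --> J w].
  apply: decreasing_limit => // n.
  have h1 := pn n.+1 _ Lvs vs0; have h2 := op_le (on n) (pn n) LB Lvs dec1.
  by refine (AE2 h1 h2 _) => x _ k1 k2; apply/andP; split => //; rewrite iterSr.
suff Jw : J w = 0 by rewrite Jw in cw.
have w0 : nonneg_ae d0 d1 w by refine (AE1 hw _) => x _ /(_ 0%N) /andP[].
(* [R1 w] is dominated by [R1 (iter n B1 vs)], whose integral is the mass lost at step [n]; these
   losses tend to 0 because the masses converge. *)
have JR : J (R1 w) <= 0.
  have c2 : (fun n => J (iter n B1 vs) - J (iter n.+1 B1 vs)) @ \oo --> 0.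
    rewrite -(subrr (J w)); apply: cvgB => //.
    by rewrite (cvg_shiftS (fun n => J (iter n B1 vs))).
  apply: (cvgr_to_ge c2); apply: nearW => n.
  rewrite -J_step// mul1r; apply: J_le; [exact: (L1_RA M)|exact: (L1_RA M)|].
  apply: (op_le (RA_op o1) (RA_pos o1)) => //.
  by refine (AE1 hw _) => x _ /(_ n) /andP[].
have R0w : R1 w =ae (fun=> 0).
  by apply: J_eq0 => //; [exact: (L1_RA M)|exact: (RA_ge0 M)].
(* With [R1 w = 0] both terms on the left of the mass balance vanish, which leaves [J w = 0]. *)
have := RA_mass M o1 Lw; rewrite (J_ae (L1_RA M o1 Lw) L1_0 R0w) J0 mulr0 add0r.
rewrite (@J_ae _ _ _ _ (fun=> 0) _ L1_0) ?J0//; first exact: (L1_phiRA M).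
by refine (AE1 R0w _) => x _ ->; rewrite mulr0.
Qed.
End InvariantK.

End MinimalSemigroup.

(** * Conservation of mass, and invariant densities of K *)

Section Stochasticity.
Context {R : realType} {d0 d1 : \bar R} {g phi : R -> R}.
Context {P : (R -> R) -> R -> R} {Pt : R -> (R -> R) -> R -> R}.
Context (M : flow_model d0 d1 g phi) (sP : stochastic_op d0 d1 P).
Context (mS : minimal_semigroup d0 d1 g phi P Pt).
Implicit Types (u v w z : R -> R).
Local Notation L := (L1 d0 d1).
Local Notation J := (J d0 d1).
Local Notation N := (norm1 d0 d1).
Local Notation "u =ae v" := (aeE d0 d1 u v) (at level 70).
Let sg := proj1 mS.
Let oP := proj1 sP.
Let o1 : 0 < 1 :> R := ltr01.
Local Notation B1 := (stepPA d0 d1 g phi P 1).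

Section WithInvariant.
Context (vs : R -> R) (ivs : invariant_op d0 d1 (Kop d0 d1 g phi P) vs).
Context (vspos : pos_ae d0 d1 vs).
Let Lvs : L vs := (ivs.1).1.

Let on n := op_iter n (step_op M sP o1).
Let pn n := pos_iter n (step_op M sP o1) (step_pos M sP o1).

Lemma step_iter_nonneg u e : L u -> nonneg_ae d0 d1 u -> 0 < e ->
  exists n0, forall n, (n0 <= n)%N -> `|J (iter n B1 u)| < e.
Proof.
move=> Lu u0 e0; have e20 : 0 < e / 2 by rewrite divr_gt0.
have [C C0 hC] := truncation_small Lu u0 Lvs vspos e20.
have eC : 0 < e / 2 / C by rewrite !divr_gt0.
have /cvgrPdist_lt/(_ _ eC)[n0 _ hn] := step_iter_vs M sP ivs.
exists n0 => n /hn; rewrite /= sub0r normrN => h.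
have Lm : L (fun x => Num.min (u x) (C * vs x)) by apply: L1_min => //; exact: L1Z.
have Lr : L (fun x => u x - Num.min (u x) (C * vs x)) by exact: L1B.
have Li v : L v -> L (iter n B1 v) by exact: (op_L1 (on n)).
have i0 : nonneg_ae d0 d1 (iter n B1 u) by apply: pn.
rewrite ger0_norm; last by apply: J_ge0 => //; exact: Li.
have h1 : J (iter n B1 u) <= J (fun x => iter n B1 (fun x => u x - Num.min (u x) (C * vs x)) x
    + C * iter n B1 vs x).
  apply: J_le; [exact: Li|apply: L1D; [exact: Li|apply: L1Z; exact: Li]|].
  have k1 := opB (on n) Lu Lm.
  have k2 : AE d0 d1 (fun x => iter n B1 (fun x => Num.min (u x) (C * vs x)) x
      <= iter n B1 (fun x => C * vs x) x).
    apply: (op_le (on n) (@pn n)) => //; first exact: L1Z.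
    by apply: AE_all => x _; rewrite ge_min lexx orbT.
  by refine (AE3 k1 k2 (opZ (on n) C Lvs) _) => x _ -> h2 h3; rewrite h3 in h2; lra.
(* Iteration does not shrink the remainder; its mass just cannot grow, since the left side of
   [J_step] is nonnegative. *)
have h2 : J (iter n B1 (fun x => u x - Num.min (u x) (C * vs x))) <=
    J (fun x => u x - Num.min (u x) (C * vs x)).
  have r0 : nonneg_ae d0 d1 (fun x => u x - Num.min (u x) (C * vs x)).
    by apply: AE_all => x _; rewrite subr_ge0 ge_min lexx.
  elim: (n) => [//|k IH]; apply: le_trans IH.
  have Lk := op_L1 (on k) Lr; have k0 := pn k Lr r0.
  rewrite /= -subr_ge0 -(J_step M sP o1 Lk) mul1r; apply: J_ge0; first exact: (L1_RA M).
  exact: (RA_ge0 M).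
have h3 : C * J (iter n B1 vs) < e / 2.
  rewrite mulrC -ltr_pdivlMr//; apply: le_lt_trans h; exact: ler_norm.
rewrite JD in h1; [|exact: Li|apply: L1Z; exact: Li].
by rewrite JZ in h1; [lra|exact: Li].
Qed.

Lemma step_iter_small u e : L u -> 0 < e ->
  exists n0, forall n, (n0 <= n)%N -> `|J (iter n B1 u)| < e.
Proof.
move=> Lu e0; have e20 : 0 < e / 2 by rewrite divr_gt0.
have [p [q [Lp Lq pq0 upq]]] := pos_part_decomp Lu.
have [n1 h1] := @step_iter_nonneg p _ Lp (AE_all (fun x _ => (pq0 x).1)) e20.
have [n2 h2] := @step_iter_nonneg q _ Lq (AE_all (fun x _ => (pq0 x).2)) e20.
exists (maxn n1 n2) => n; rewrite geq_max => /andP[/h1 k1 /h2 k2].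
have Lip := op_L1 (on n) Lp; have Liq := op_L1 (on n) Lq.
have e1 : iter n B1 u =ae (fun x => iter n B1 p x - iter n B1 q x).
  apply: (aeE_trans (op_ae (on n) Lu (L1B Lp Lq) _) (opB (on n) Lp Lq)).
  by apply: AE_all => x _.
rewrite (J_ae (op_L1 (on n) Lu) (L1B Lip Liq) e1) JB//.
by rewrite (le_lt_trans (ler_normB _ _))// [e]splitr ltrD.
Qed.

(** For [u = w - z] the partial sums converge to [w] while their integrals are
    [J w - J z - J (iter n.+1 B1 u)]; the last term tends to 0, which forces [J z = 0]. *)
Lemma gen_mean0 w z : generator d0 d1 Pt w z -> J z = 0.
Proof.
move=> h; have [Lw Lz] := gen_L1 h.
have Lu : L (fun x => 1 * w x - z x) by apply: L1B => //; exact: L1Z.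
have [w' [z' [h' e hN]]] := resolventC mS o1 Lu.
have ww' : w =ae w' by apply: (gen_resolvent_unique sg o1 h h'); exact: aeE_sym.
have [Lw' Lz'] := gen_L1 h'.
have Ju : J (fun x => 1 * w x - z x) = J w - J z by rewrite JB ?JZ ?mul1r//; exact: L1Z.
apply/eqP; rewrite -normr_le0 leNgt; apply/negP => z0.
have z20 : 0 < `|J z| / 2 by rewrite divr_gt0.
have [n1 h1] := hN _ z20; have [n2 h2] := step_iter_small Lu z20.
have k1 := h1 (maxn n1 n2) (leq_maxl _ _).
have k2 := h2 (maxn n1 n2).+1 (leq_trans (leq_maxr _ _) (leqnSn _)).
set n := maxn n1 n2 in k1 k2.
have Lp := L1_pres M sP o1 n Lu.
have k3 := J_dist Lp Lw'; have := J_pres M sP o1 n Lu.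
rewrite mul1r Ju (J_ae Lw Lw' ww') => k4; rewrite k4 in k3.
set A := J (iter _ _ _) in k2 k3.
have : J z = - (J w' - J z - A - J w') - A by ring.
move=> e3; have := ler_normB (- (J w' - J z - A - J w')) A.
by rewrite -e3 normrN; lra.
Qed.

(** Write [u = w - z] with [z] the generator at [w]: the integral of [Pt t w] is constant in [t],
    and [Pt t z] has integral 0 as a value of the generator. *)
Lemma sg_mass t u : 0 <= t -> L u -> J (Pt t u) = J u.
Proof.
move=> t0 Lu; have [w [z [h e _]]] := resolventC mS o1 Lu.
have [Lw Lz] := gen_L1 h.
have Lc : L (fun x => 1 * w x - z x) by apply: L1B => //; exact: L1Z.
have LPw := sg_L1 sg t0 Lw; have LPz := sg_L1 sg t0 Lz.
have e1 : Pt t u =ae (fun x => 1 * Pt t w x + (-1) * Pt t z x).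
  apply: (aeE_trans (op_ae (sg_op sg t0) Lu (L1_comb 1 (-1) Lw Lz) _)).
    by refine (AE1 e _) => x _ <-; ring.
  exact: (op_comb (sg_op sg t0)).
rewrite (J_ae (sg_L1 sg t0 Lu) (L1_comb 1 (-1) LPw LPz) e1) Jcomb//.
rewrite (gen_mean0 (gen_comm sg t0 h)) (gen_mass sg gen_mean0 h t0).
by rewrite -(J_ae Lc Lu e) JB ?JZ ?(gen_mean0 h)//; [ring|exact: L1Z].
Qed.

Lemma sg_stochastic : stochastic_semigroup d0 d1 Pt.
Proof.
case: (sg) => h1 h2 h3; split => // t t0; apply: mk_stochastic.
- exact: (sg_op sg t0).
- exact: (sg_pos sg t0).
- by move=> u; exact: sg_mass.
Qed.

End WithInvariant.

(** Invariance makes the generator vanish at [us]; as [us] lies in the domain of [A], this reads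
    [A us = - v] with [v = P (phi us)]. Hence [us = R0 v] by uniqueness, and
    [K v = P (phi us) = v]. *)
Lemma Kop_invariant us : invariant_sg d0 d1 Pt us -> inDA d0 d1 g phi us ->
  invariant_op d0 d1 (Kop d0 d1 g phi P)
    (fun x => P (fun y => phi y * us y) x / norm1 d0 d1 (fun y => phi y * us y)).
Proof.
move=> [[Lus [us0 nus]] inv] [w DA].
have [_ Lw Lphi [h [hE hI h0]]] := DA.
have phius0 : nonneg_ae d0 d1 (fun y => phi y * us y).
  by refine (AE1 us0 _) => x Ex ux; rewrite mulr_ge0// (fm_ge0 M).
pose v := P (fun y => phi y * us y).
have Lv : L v by exact: (op_L1 oP).
have C0 := gen_unique sg (generator_extends M sP mS DA) (fixed_gen sg Lus inv).
have wE : w =ae (fun x => v x - (0 + phi x) * us x).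
  by refine (AE1 C0 _) => x _; rewrite -/v => e; lra.
have usE : us =ae R0 d0 d1 g phi v.
  by rewrite R0_funE; exact: (DA_unique M (lexx 0) Lv DA wE).
rewrite norm1_nonneg//; set c := J _.
(* If [phi us] vanished, so would [v], and then [us = R0 v = 0], against its norm 1. *)
have c0 : 0 < c.
  rewrite lt_neqAle J_ge0// andbT eq_sym; apply/negP => /eqP c0.
  have pu0 : (fun y => phi y * us y) =ae (fun=> 0) by apply: J_eq0 => //; rewrite -/c c0.
  have v0 : v =ae (fun=> 0).
    by apply: (aeE_trans (op_ae oP Lphi L1_0 pu0)); exact: op0.
  have : us =ae (fun=> 0).
    refine (AE1 usE _) => x Ex ->; rewrite R0_funE (Rlam_ae M (lexx 0) Lv L1_0 v0 Ex).
    by rewrite /Rlam H_0 mulr0.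
  move=> us00; move: nus; rewrite (norm1_ae Lus L1_0 us00) norm1E normr0 J0 => /esym/eqP.
  by rewrite oner_eq0.
have fE : (fun x => v x / c) = (fun x => c^-1 * v x) by apply/funext => x; rewrite mulrC.
have Jv : J v = c by rewrite (stochastic_J sP).
rewrite -/v fE; split.
  by rewrite -Jv; apply: density_scale; rewrite ?Jv//; exact: (stochastic_pos sP).
apply: (@aeE_trans _ _ _ (P (fun x => c^-1 * (phi x * us x)))); last exact: opZ.
have LR : L (fun x => phi x * R0 d0 d1 g phi (fun x => c^-1 * v x) x).
  by apply: (L1_phiR0 M); exact: L1Z.
apply: (op_ae oP) => //; first exact: L1Z.
refine (AE1 usE _) => x Ex ->; rewrite !R0_funE.
have -> : @Rlam R d0 g phi 0 (fun x => c^-1 * v x) x = c^-1 * @Rlam R d0 g phi 0 v x.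
  have := Rlam_comb M (lexx 0) c^-1 0 Lv Lv Ex; rewrite mul0r addr0 => <-.
  by congr Rlam; apply/funext => y; rewrite mul0r addr0.
ring.
Qed.

End Stochasticity.

(** * Uniqueness of the fixed functions of the semigroup *)

Section FixedPoints.
Context {R : realType} {d0 d1 : \bar R} {g phi : R -> R}.
Context {P : (R -> R) -> R -> R} {Pt : R -> (R -> R) -> R -> R}.
Context (M : flow_model d0 d1 g phi) (sP : stochastic_op d0 d1 P).
Context (mS : minimal_semigroup d0 d1 g phi P Pt).
Implicit Types (f p : R -> R).
Local Notation E := (Eset d0 d1).
Local Notation L := (L1 d0 d1).
Local Notation J := (J d0 d1).
Local Notation "u =ae v" := (aeE d0 d1 u v) (at level 70).
Let sg := proj1 mS.
Let o1 : 0 < 1 :> R := ltr01.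
Local Notation R1 := (RA d0 d1 g phi 1).
Local Notation pres1 := (partial_res d0 d1 g phi P 1).

(** A fixed [p] satisfies [R(1, C) p = p], and [R1 p] is the first of the increasing partial sums
    that converge to it. Convergence is in norm, so the inequality is read off the integral of the
    positive part of [R1 p - w]. *)
Lemma fixed_ge_resolvent p : L p -> nonneg_ae d0 d1 p ->
  (forall t, 0 <= t -> Pt t p =ae p) -> AE d0 d1 (fun x => R1 p x <= p x).
Proof.
move=> Lp p0 fp; have [w [z [h e hN]]] := resolventC mS o1 Lp.
have [Lw Lz] := gen_L1 h; have gp := fixed_gen sg Lp fp.
have wp : w =ae p.
  apply: (gen_resolvent_unique sg o1 h gp).
  by refine (AE1 e _) => x _ ->; rewrite mul1r subr0.
have LR := L1_RA M o1 Lp.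
have geR n : AE d0 d1 (fun x => R1 p x <= pres1 n p x).
  elim: n => [|n IH]; first by rewrite pres0; exact: AE_all.
  have Bn0 := pos_iter n.+1 (step_op M sP o1) (step_pos M sP o1) Lp p0.
  have LBn := op_L1 (op_iter n.+1 (step_op M sP o1)) Lp.
  refine (AE3 IH (presS M sP o1 n Lp) (RA_ge0 M o1 LBn Bn0) _) => x _ k1 -> k2.
  by rewrite (le_trans k1)// lerDl.
have Lm : L (fun x => Num.max (R1 p x - w x) 0).
  by apply: L1_max; [exact: L1B|exact: L1_0].
have m0 : (fun x => Num.max (R1 p x - w x) 0) =ae (fun=> 0).
  apply: J_eq0 => //; first by apply: AE_all => x _; rewrite le_max lexx orbT.
  rewrite leNgt; apply/negP => k; have [n hn] := hN _ k.
  have := hn n (leqnn n); rewrite ltNge => /negP; apply; rewrite norm1E.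
  have Lpn := L1_pres M sP o1 n Lp.
  apply: J_le => //; first by apply: L1_abs; exact: L1B.
  refine (AE1 (geR n) _) => x _ h1; rewrite ge_max normr_ge0 andbT.
  by apply: le_trans (ler_norm _); rewrite lerB.
refine (AE2 m0 wp _) => x _ h1 <-; rewrite -subr_le0.
by rewrite -h1 le_max lexx.
Qed.

(** The kernel is strictly positive, so a vanishing integral would force [p = 0] almost everywhere
    below [c]. *)
Lemma Rlam_gt0 lam p c : 0 <= lam -> L p -> nonneg_ae d0 d1 p -> E c ->
  0 < @tail R d0 p c -> 0 < @Rlam R d0 g phi lam p c.
Proof.
move=> l0 Lp p0 Ec tc; rewrite /Rlam mulr_gt0 ?invr_gt0 ?(fm_pos M)//.
have iq a b : E a -> E b -> itg `[a, b] (@rate R g phi lam) by exact: (itg_rate M).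
have q0 x : E x -> 0 <= @rate R g phi lam x by exact: (rate_ge0 M l0).
rewrite ltNge; apply/negP => Hc.
pose f := (fun y => expR (- I (@rate R g phi lam) y c) * p y) \_ (@below R d0 c).
have sub := below_sub Ec.
have Lf : L f.
  apply: (L1_le _ (L1_abs Lp)) => [|x Ex].
    apply: meas_restrict => //; first exact: mbelow.
    exact: itg_meas (itg_ker iq q0 Lp Ec).
  rewrite /f patchE; case: ifPn => [_|_]; last by rewrite normr0.
  by rewrite normrM; apply: ler_piMl => //; exact: (ker_le1 q0 Ex Ec).
have f0 : f =ae (fun=> 0).
  apply: J_eq0 => //.
    refine (AE1 p0 _) => x _ px; rewrite /f patchE; case: ifP => // _.
    by rewrite mulr_ge0// expR_ge0.
  by rewrite J_restrict// -HE.
have Lt : L (p \_ (@below R d0 c)) by apply: L1_restrict => //; exact: mbelow.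
have : J (p \_ (@below R d0 c)) = 0.
  rewrite (J_ae Lt L1_0) ?J0//; refine (AE1 f0 _) => x Ex.
  rewrite /f !patchE; case: ifP => // _ /eqP.
  by rewrite mulf_eq0 gt_eqF ?expR_gt0//= => /eqP.
by rewrite J_restrict// -/(@tail R d0 p c) => h; rewrite h ltxx in tc.
Qed.

Lemma resolvent_pos p : L p -> nonneg_ae d0 d1 p -> 0 < J p ->
  exists2 c, E c & AE d0 d1 (fun x => c <= x -> 0 < R1 p x).
Proof.
move=> Lp p0 Jp; have [c Ec hc] := tail_full (fm_itv M) Lp Jp.
exists c => //; refine (AE1 (RA_ae M o1 Lp) _) => x Ex -> cx.
apply: Rlam_gt0 => //; apply: (@lt_le_trans _ _ (@tail R d0 p c)); first by lra.
rewrite /tail -(J_restrict p (below_sub Ec)) -(J_restrict p (below_sub Ex)).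
apply: J_le; try by apply: L1_restrict => //; [exact: mbelow|exact: below_sub].
refine (AE1 p0 _) => y _ py; rewrite !patchE.
case: ifPn => [/set_mem [h1 h2]|_]; last by case: ifP.
by rewrite mem_set//; split => //; exact: lt_le_trans h2 cx.
Qed.

Lemma not_AE_lt c : E c -> ~ AE d0 d1 (fun x => x < c).
Proof.
move=> Ec [A [mA A0 hA]].
have [e ce Ee] : exists2 e, c < e & E e.
  have : \forall z \near c, E z by exact: open_nbhs_nbhs (conj (@open_Eset R d0 d1) Ec).
  move=> /nbhs_ballP[d /= d0' hd]; exists (c + d / 2); first by rewrite ltrDl divr_gt0.
  apply: hd; rewrite /ball /= opprD addNKr normrN gtr0_norm ?divr_gt0//.
  by rewrite ltr_pdivrMr// ltr_pMr// ltr1n.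
have sub : `[c, e]%classic `<=` A.
  move=> x /= xce; apply: hA => /= h; have Ex := sub_Eset Ec Ee xce.
  by have := h Ex; move: xce; rewrite in_itv /= => /andP[cx _]; rewrite ltNge cx.
have : (lebm R `[c, e]%classic <= 0)%E by rewrite -A0; apply: le_measure; rewrite ?inE.
by rewrite [lebm R _]lebesgue_measure_itv /= lte_fin ce -EFinD lee_fin; lra.
Qed.

Context (mass : forall t u, 0 <= t -> L u -> J (Pt t u) = J u).

(** The image of the positive part dominates both [Pt t f = f] and 0, hence the positive part of
    [f]; equal masses turn this into equality. *)
Lemma fixed_pos_part f : L f -> (forall t, 0 <= t -> Pt t f =ae f) ->
  forall t, 0 <= t -> Pt t (fun x => Num.max (f x) 0) =ae (fun x => Num.max (f x) 0).
Proof.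
move=> Lf ff t t0; have Lp : L (fun x => Num.max (f x) 0) by apply: L1_max => //; exact: L1_0.
apply: aeE_sym; apply: J_le_eq => //; last by rewrite mass.
  exact: (sg_L1 sg).
have h1 : AE d0 d1 (fun x => Pt t f x <= Pt t (fun x => Num.max (f x) 0) x).
  apply: (op_le (sg_op sg t0) (sg_pos sg t0)) => //.
  by apply: AE_all => x _; rewrite le_max lexx.
have h2 : nonneg_ae d0 d1 (Pt t (fun x => Num.max (f x) 0)).
  by apply: (sg_pos sg t0) => //; apply: AE_all => x _; rewrite le_max lexx orbT.
by refine (AE3 h1 h2 (ff t t0) _) => x _ k1 k2 k3; rewrite ge_max k2 andbT -k3.
Qed.

Lemma fixed_sign f : L f -> (forall t, 0 <= t -> Pt t f =ae f) ->
  J (fun x => Num.max (f x) 0) <= 0 \/ J (fun x => Num.max (- f x) 0) <= 0.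
Proof.
move=> Lf ff.
have LN := L1N Lf.
have fN t : 0 <= t -> Pt t (fun x => - f x) =ae (fun x => - f x).
  move=> t0; have e : (fun x => - f x) = (fun x => (-1) * f x).
    by apply/funext => x; rewrite mulN1r.
  rewrite e; apply: (aeE_trans (opZ (sg_op sg t0) (-1) Lf)).
  by refine (AE1 (ff t t0) _) => x _ ->.
have Lp : L (fun x => Num.max (f x) 0) by apply: L1_max => //; exact: L1_0.
have Ln : L (fun x => Num.max (- f x) 0) by apply: L1_max => //; exact: L1_0.
have p0 : nonneg_ae d0 d1 (fun x => Num.max (f x) 0) by apply: AE_all => x _; rewrite le_max lexx orbT.
have n0 : nonneg_ae d0 d1 (fun x => Num.max (- f x) 0) by apply: AE_all => x _; rewrite le_max lexx orbT.
have [?|Jp] := leP (J (fun x => Num.max (f x) 0)) 0; first by left.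
have [?|Jn] := leP (J (fun x => Num.max (- f x) 0)) 0; first by right.
have [c Ec hc] := resolvent_pos Lp p0 Jp; have [c' Ec' hc'] := resolvent_pos Ln n0 Jn.
have h := fixed_ge_resolvent Lp p0 (fixed_pos_part Lf ff).
have h' := fixed_ge_resolvent Ln n0 (fixed_pos_part LN fN).
have k : AE d0 d1 (fun x => c <= x -> 0 < f x).
  refine (AE2 hc h _) => x _ h1 h2 /h1 h3; have := lt_le_trans h3 h2.
  by rewrite lt_max ltxx orbF.
have k' : AE d0 d1 (fun x => c' <= x -> f x < 0).
  refine (AE2 hc' h' _) => x _ h1 h2 /h1 h3; have := lt_le_trans h3 h2.
  by rewrite lt_max ltxx orbF oppr_gt0.
have Em : E (Num.max c c') by rewrite /Num.max; case: ifP.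
exfalso; apply: (not_AE_lt Em); refine (AE2 k k' _) => x _ h1 h2.
rewrite ltNge; apply/negP; rewrite ge_max => /andP[/h1 k1 /h2 k2].
by have := lt_trans k1 k2; rewrite ltxx.
Qed.

(** [f - J f * us] is fixed and has integral 0; one of its two parts vanishes by [fixed_sign], and
    so does the other, having the same mass. *)
Lemma fixed_unique us f : density d0 d1 us -> (forall t, 0 <= t -> Pt t us =ae us) ->
  L f -> (forall t, 0 <= t -> Pt t f =ae f) -> f =ae (fun x => J f * us x).
Proof.
move=> [Lus [us0 nus]] fus Lf ff; rewrite norm1_nonneg// in nus.
pose h x := f x - J f * us x.
have Lh : L h by apply: L1B => //; exact: L1Z.
have Jh : J h = 0 by rewrite JB ?JZ ?nus ?mulr1 ?subrr//; exact: L1Z.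
have fh t : 0 <= t -> Pt t h =ae h.
  move=> t0; apply: (aeE_trans (opB (sg_op sg t0) Lf (L1Z _ Lus))).
  by refine (AE3 (ff t t0) (opZ (sg_op sg t0) (J f) Lus) (fus t t0) _) => x _ -> -> ->.
have Lp : L (fun x => Num.max (h x) 0) by apply: L1_max => //; exact: L1_0.
have Ln : L (fun x => Num.max (- h x) 0) by apply: L1_max; [exact: L1N|exact: L1_0].
have dec : J (fun x => Num.max (h x) 0) - J (fun x => Num.max (- h x) 0) = 0.
  rewrite -JB//; transitivity (J h) => //; apply: J_ae => //; first exact: L1B.
  by apply: AE_all => x _; rewrite /Num.max; case: ifPn; case: ifPn; lra.
have [Jp Jn] : J (fun x => Num.max (h x) 0) <= 0 /\ J (fun x => Num.max (- h x) 0) <= 0.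
  by have [k|k] := fixed_sign Lh fh; split; lra.
have p0 : nonneg_ae d0 d1 (fun x => Num.max (h x) 0) by apply: AE_all => x _; rewrite le_max lexx orbT.
have n0 : nonneg_ae d0 d1 (fun x => Num.max (- h x) 0) by apply: AE_all => x _; rewrite le_max lexx orbT.
refine (AE2 (J_eq0 Lp p0 Jp) (J_eq0 Ln n0 Jn) _) => x _.
by rewrite /h /Num.max; case: ifPn; case: ifPn; lra.
Qed.

End FixedPoints.

(** * Partially integral operators *)

Section DensityInterval.
Context {R : realType}.
Notation mu := (@lebesgue_measure R).

(** Lebesgue's density theorem at a point of [S]. The endpoints are rational so that only countably
    many intervals have to be considered later. *)
Lemma density_interval (S : set R) : measurable S -> (0 < mu S)%E ->
  exists a b : rat, (ratr a < ratr b :> R) /\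
    ((3 / 4 * (ratr b - ratr a))%:E < mu (S `&` `](ratr a : R), ratr b[))%E.
Proof.
move=> mS S0.
have [x Sx dx] : exists2 x, S x & (mu (S `&` ball x r) * (mu (ball x r))^-1)%E
    @[r --> 0^'+] --> (\1_S x : R)%:E.
  apply: contrapT => h; have [A [mA A0 hA]] := lebesgue_density mS.
  have sub : S `<=` A.
    by move=> x Sx; apply: hA => /= k; apply: h; exists x.
  have : (mu S <= mu A)%E by apply: le_measure; rewrite ?inE.
  by rewrite A0 leNgt S0.
rewrite indicE mem_set //= in dx.
have h78 : (((7 / 8) : R)%:E < (1 : R)%:E)%E by rewrite lte_fin; lra.
have := dx _ (open_ereal_gt' h78).
rewrite near_simpl => /nbhs_ballP[d /= d0 hd].
pose r := d / 2; have r0 : 0 < r by rewrite divr_gt0.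
have : (((7 / 8) : R)%:E < mu (S `&` ball x r) * (mu (ball x r))^-1)%E.
  apply: (hd r) => //; rewrite /ball /= sub0r normrN gtr0_norm//.
  by rewrite /r ltr_pdivrMr// ltr_pMr// ltr1n.
rewrite lebesgue_measure_ball ?ltW// inver mulrn_eq0/= gt_eqF//.
have mSb : measurable (S `&` ball x r) by apply: measurableI => //; exact: measurable_ball.
have fSb : mu (S `&` ball x r) \is a fin_num.
  rewrite ge0_fin_numE//; apply: (@le_lt_trans _ _ (mu (ball x r))).
    by apply: le_measure; rewrite ?inE//; exact: measurable_ball.
  by rewrite lebesgue_measure_ball ?ltW// ltry.
rewrite -(fineK fSb) -EFinM lte_fin ltr_pdivlMr ?mulrn_wgt0// => h.
(* The ball has length [2 * r] and is filled to more than 7/8. Rational endpoints less than [r / 8]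
   outside it give length below [9 / 4 * r], and [3 / 4 * (9 / 4) < 7 / 8 * 2]. *)
have e0 : 0 < r / 8 by rewrite divr_gt0.
have [a] := @rat_in_itvoo R (x - r - r / 8) (x - r) ltac:(lra).
have [b] := @rat_in_itvoo R (x + r) (x + r + r / 8) ltac:(lra).
rewrite !in_itv /= => /andP[b1 b2] /andP[a1 a2].
exists a, b; split; first by lra.
apply: (@lt_le_trans _ _ (fine (mu (S `&` ball x r)))%:E).
  by rewrite lte_fin; apply: le_lt_trans h; rewrite -mulr_natr; lra.
rewrite fineK//; apply: le_measure; rewrite ?inE//.
  by apply: measurableI => //; exact: measurable_itv.
move=> y [Sy]; rewrite /ball /= ltr_distlC => /andP[y1 y2]; split => //=.
by rewrite in_itv /=; apply/andP; split; lra.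
Qed.

End DensityInterval.

Section SmallSet.
Context {R : realType} {d0 d1 : \bar R}.
Local Notation TR := (measurableTypeR R).
Notation mu := (@lebesgue_measure R).
Local Notation E := (Eset d0 d1).
Local Notation J := (J d0 d1).
Context (p : R -> R -> R).
Context (mp : measurable_fun (E `*` E) (fun xy : R * R => p xy.1 xy.2)).
Context (p0 : forall x y, E x -> E y -> 0 <= p x y).
Context (pint : (0 < \int[lebm R]_(x in E) \int[lebm R]_(y in E) (p x y)%:E)%E).

Let mE : measurable (E : set TR) := @mEset R d0 d1.
Let EE : set (TR * TR) := E `*` E.
Let mEE : measurable EE. Proof. exact: measurableX. Qed.

(** Extended by 0 to the whole plane, so that Tonelli applies over [setT]. *)
Definition pE (z : TR * TR) : R := ((fun xy : R * R => p xy.1 xy.2) \_ EE) z.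

Lemma pE_meas : measurable_fun setT pE.
Proof. by apply/(measurable_restrictT _ mEE); exact: mp. Qed.

Lemma pE_ge0 z : 0 <= pE z.
Proof. by rewrite /pE patchE; case: ifPn => // /set_mem[Ex Ey]; exact: p0. Qed.

Lemma pEE x y : E x -> E y -> pE (x, y) = p x y.
Proof. by move=> Ex Ey; rewrite /pE patchE mem_set. Qed.

Definition level (n : nat) : set (TR * TR) := pE @^-1` `[n.+1%:R^-1, +oo[%classic.

Lemma mlevel n : measurable (level n).
Proof.
have := pE_meas measurableT (measurable_itv `[n.+1%:R^-1, +oo[).
by rewrite setTI.
Qed.

Lemma levelE n x y : level n (x, y) -> E x /\ E y.
Proof.
rewrite /level /= in_itv /= andbT /pE patchE.
case: ifPn => [/set_mem[]//|_]; rewrite leNgt => /negP; case.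
by rewrite invr_gt0 ltr0n.
Qed.

(** The fraction 3/4 exceeds one half, so the sections at any two points of this set overlap inside
    the interval. Cut down to [E], it becomes the set [Y] of the stability argument. *)
Definition dense_set (n : nat) (a b : rat) : set TR :=
  [set y | ((3 / 4 * (ratr b - ratr a))%:E <
            mu (ysection (level n) y `&` `](ratr a : R), ratr b[))%E].

Let block (n : nat) (a b : rat) : set (TR * TR) :=
  level n `&` (`](ratr a : R), ratr b[ `*` setT).

Let mblock n a b : measurable (block n a b).
Proof.
apply: measurableI; first exact: mlevel.
by apply: measurableX => //; exact: measurable_itv.
Qed.

Let ysection_block n a b y :
  ysection (block n a b) y = ysection (level n) y `&` `](ratr a : R), ratr b[.
Proof.
apply/seteqP; split => x /=.
  by move=> /ysectionP[h [/= k _]]; split => //; exact/ysectionP.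
by move=> [/ysectionP h k]; apply/ysectionP; split.
Qed.

Lemma mdense_set n a b : measurable (dense_set n a b).
Proof.
have := @measurable_fun_ysection _ _ TR TR R mu _ (mblock n a b).
move=> /emeasurable_fun_o_infty -/(_ measurableT (3 / 4 * (ratr b - ratr a))%:E).
rewrite setTI; congr measurable; apply/seteqP; split => y /=; by rewrite ysection_block.
Qed.

(** Otherwise almost every [y] lies in none of these sets; by [density_interval] every level then
    has a null section at [y], and Tonelli makes the double integral of [p] vanish. *)
Lemma exists_dense_set : exists n a b, (ratr a < ratr b :> R) /\ (0 < mu (dense_set n a b `&` E))%E.
Proof.
apply: contrapT => hno.
have hnull n a b : ratr a < ratr b :> R -> mu (dense_set n a b `&` E) = 0.
  move=> ab; apply/eqP; rewrite eq_le measure_ge0 andbT leNgt; apply/negP => h.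
  by apply: hno; exists n, a, b.
(* Enumerating the triples [(n, a, b)] by [unpickle] makes the exceptional set a countable union of
   null sets. *)
have ae1 : {ae mu, forall y, E y -> forall k : nat,
    if unpickle k is Some (n, a, b) then
      (ratr a < ratr b :> R) -> ~ dense_set n a b y else True}.
  have : forall k : nat, {ae mu, forall y, E y -> if unpickle k is Some (n, a, b) then
      (ratr a < ratr b :> R) -> ~ dense_set n a b y else True}.
    move=> k; case: (unpickle k) => [[[n a] b]|]; last by apply: aeW.
    have [ab|ab] := boolP ((ratr a : R) < ratr b); last by apply: aeW.
    exists (dense_set n a b `&` E); split; last first.
    - by move=> y /=; apply: contra_notP => h Ey _ hy; apply: h.
    - exact: hnull.
    - by apply: measurableI => //; exact: mdense_set.
  move=> /ae_foralln; apply: filterS => y hy Ey k; exact: hy.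
have ae2 : {ae mu, forall y, E y -> forall n, mu (ysection (level n) y) = 0}.
  apply: filterS ae1 => y hy Ey n; apply/eqP; rewrite eq_le measure_ge0 andbT leNgt.
  apply/negP => h; have mS := measurable_ysection y (mlevel n).
  have [a [b [ab k]]] := density_interval mS h.
  by have := hy Ey (pickle (n, a, b)); rewrite pickleK => /(_ ab).
have ae3 : {ae mu, forall y, setT y -> (\int[mu]_x (pE (x, y))%:E = 0)%E}.
  apply: filterS ae2 => y hy _.
  have mpy : measurable_fun setT (fun x : TR => (pE (x, y))%:E).
    by apply/measurable_EFinP; apply: measurableT_comp => //; exact: pE_meas.
  rewrite (_ : (fun x => _) = (fun x => `|(pE (x, y))%:E|)%E); last first.
    by apply/funext => x; rewrite /= ger0_norm// pE_ge0.
  apply/(ae_eq_integral_abs mu measurableT mpy).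
  have [Ey|nEy] := pselect (E y); last first.
    apply: aeW => x _ /=; congr EFin; rewrite /pE patchE; case: ifPn => // /set_mem[_ Ey].
    by exfalso; apply: nEy.
  have aen : {ae mu, forall x : R, forall n, ~ level n (x, y)}.
    apply/ae_foralln => n; exists (ysection (level n) y); split.
    - apply: measurable_ysection; exact: mlevel.
    - exact: hy.
    - by move=> x /contrapT h; exact/ysectionP.
  apply: filterS aen => x hx _ /=; congr EFin; apply/eqP.
  rewrite eq_le pE_ge0 andbT leNgt; apply/negP => px.
  (* A value [c > 0] reaches the level indexed by the integer part of [1 / c], since [1 / c] is less
     than that index plus 1. *)
  apply: (hx (Num.truncn (pE (x, y))^-1)); rewrite /level /= in_itv /= andbT.
  by rewrite invf_ple ?posrE ?ltr0n//; exact/ltW/truncnS_gt.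
have mf : measurable_fun setT (fun z : TR * TR => (pE z)%:E) by apply/measurable_EFinP; exact: pE_meas.
have f0 z : (0 <= (pE z)%:E)%E by rewrite lee_fin pE_ge0.
have := @fubini_tonelli _ _ TR TR R mu mu _ mf f0.
have -> : (\int[mu]_y \int[mu]_x (pE (x, y))%:E = 0)%E.
  rewrite -[RHS](integral0 mu setT); apply: ae_eq_integral => //.
  exact: (@measurable_fun_fubini_tonelli_G _ _ TR TR R mu _ mf f0).
have -> : (\int[mu]_x \int[mu]_y (pE (x, y))%:E =
    \int[lebm R]_(x in E) \int[lebm R]_(y in E) (p x y)%:E)%E.
  rewrite [RHS]integral_mkcond; apply: eq_integral => x _; rewrite patchE.
  case: ifPn => [/set_mem Ex|/negP nEx].
    rewrite [RHS]integral_mkcond; apply: eq_integral => y _; rewrite [RHS]patchE /pE patchE.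
    case: ifPn => [/set_mem[_ Ey]|/negP h]; first by rewrite mem_set.
    by rewrite memNset// => Ey; apply: h; apply: mem_set; split.
  rewrite -[RHS](integral0 mu setT); apply: eq_integral => y _; rewrite /pE patchE.
  by case: ifPn => // /set_mem[Ex _]; exfalso; apply: nEx; exact: mem_set.
by move=> h; move: pint; rewrite h ltxx.
Qed.

End SmallSet.

Section Minorant.
Context {R : realType} {d0 d1 : \bar R}.
Local Notation TR := (measurableTypeR R).
Notation mu := (@lebesgue_measure R).
Local Notation E := (Eset d0 d1).
Local Notation L := (L1 d0 d1).
Local Notation J := (J d0 d1).
Context (p : R -> R -> R).
Context (mp : measurable_fun (E `*` E) (fun xy : R * R => p xy.1 xy.2)).
Context (p0 : forall x y, E x -> E y -> 0 <= p x y).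
Context (n : nat) (a b : rat) (ab : ratr a < ratr b :> R).
Let mE : measurable (E : set TR) := @mEset R d0 d1.
Local Notation level := (@level R d0 d1 p n).
Local Notation pE := (@pE R d0 d1 p).
Let Y : set TR := @dense_set R d0 d1 p n a b `&` E.
Let I0 : set TR := `](ratr a : R), ratr b[%classic.
Let eps : R := n.+1%:R^-1.
Let l : R := ratr b - ratr a.

Let mY : measurable Y. Proof. by apply: measurableI => //; exact: mdense_set. Qed.
Let YE : Y `<=` E. Proof. by move=> y []. Qed.
Let mI0 : measurable I0. Proof. exact: measurable_itv. Qed.
Let eps0 : 0 < eps. Proof. by rewrite invr_gt0 ltr0n. Qed.
Let l0 : 0 < l. Proof. by rewrite subr_gt0. Qed.

Lemma L1_indic_I0 : L (\1_I0 : R -> R).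
Proof.
apply: itg_sub (_ : itg setT (\1_I0 : R -> R)) => //.
have := @integrable_indic_itv R (ratr a) (ratr b) false true.
by rewrite /I0.
Qed.

Lemma J_indic_I0 : J (\1_I0 : R -> R) <= l.
Proof.
rewrite JE RintegralE -lee_fin fineK; last by apply: integrable_fin_num => //; exact: L1_indic_I0.
rewrite integral_indic//.
apply: (@le_trans _ _ (mu I0)); first by apply: le_measure; rewrite ?inE//; exact: measurableI.
by rewrite [mu I0]lebesgue_measure_itv /= lte_fin ab -EFinD.
Qed.

Section OneFunction.
Context (f : R -> R) (Lf : L f) (f0 : forall x, E x -> 0 <= f x).
Let GY : set (TR * TR) := level `&` (I0 `*` Y).
Let mGY : measurable GY.
Proof.
by apply: measurableI; [exact: mlevel|exact: measurableX].
Qed.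
Let fE : TR -> R := f \_ E.
Let mfE : measurable_fun setT fE.
Proof. by apply/(measurable_restrictT _ mE); exact: L1_meas. Qed.
Let fE0 y : 0 <= fE y.
Proof. by rewrite /fE patchE; case: ifPn => // /set_mem; exact: f0. Qed.
Let F (z : TR * TR) : R := eps * \1_GY z * fE z.2.
Let F0 z : 0 <= F z.
Proof. by rewrite /F !mulr_ge0// ltW. Qed.
Let mF : measurable_fun setT F.
Proof.
apply: measurable_funM; first by apply: measurable_funM => //; exact: measurable_indic.
by apply: measurableT_comp => //; exact: measurable_snd.
Qed.
Let mFE : measurable_fun setT (EFin \o F). Proof. exact/measurable_EFinP. Qed.
Let K (x : TR) : \bar R := (\int[mu]_y (F (x, y))%:E)%E.
Let alpha : R := J (f \_ Y).
Let LfY : L (f \_ Y). Proof. exact: L1_restrict. Qed.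

Let alphaE : (\int[mu]_y ((f \_ Y) y)%:E)%E = alpha%:E.
Proof.
rewrite /alpha J_restrict// RintegralE fineK.
  rewrite [RHS]integral_mkcond; apply: eq_integral => y _.
  by rewrite !patchE; case: ifP.
by apply: integrable_fin_num => //; apply: itg_sub Lf.
Qed.

Let fY0 y : 0 <= (f \_ Y) y.
Proof. by rewrite patchE; case: ifPn => // /set_mem /YE; exact: f0. Qed.

Let mfY : measurable_fun setT (f \_ Y : TR -> R).
Proof.
apply/(measurable_restrictT _ mY); apply: measurable_funS (L1_meas Lf) => //.
Qed.

Let fYE y : Y y -> fE y = (f \_ Y) y.
Proof. by move=> Yy; rewrite /fE !patchE mem_set ?mem_set//; exact: YE. Qed.

Let K_le x : (K x <= (eps * alpha * \1_I0 x)%:E)%E.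
Proof.
apply: (@le_trans _ _ (\int[mu]_y ((eps * \1_I0 x)%:E * ((f \_ Y) y)%:E))%E).
  apply: ge0_le_integral => //.
  - by move=> y _; rewrite lee_fin.
  - by apply/measurable_EFinP; apply: measurableT_comp => //; exact: mF.
  - by apply: measurable_funeM; exact/measurable_EFinP.
  - move=> y _; rewrite -EFinM lee_fin /F /=.
    rewrite [\1_GY _]indicE; have [/set_mem [_ [/= Ix Yy]]|_] := boolP (_ \in GY).
      by rewrite indicE mem_set// fYE.
    by rewrite mulr0 mul0r !mulr_ge0// ltW.
rewrite ge0_integralZl//.
- by rewrite alphaE -EFinM lee_fin mulrAC.
- by exact/measurable_EFinP.
- by move=> y _; rewrite lee_fin.
- by rewrite lee_fin mulr_ge0// ltW.
Qed.

Let K0 x : (0 <= K x)%E. Proof. by apply: integral_ge0 => y _; rewrite lee_fin. Qed.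

Let mK : measurable_fun setT K.
Proof. by apply: (@measurable_fun_fubini_tonelli_F _ _ TR TR R mu _ mFE) => z; rewrite /= lee_fin. Qed.

Let Kfin x : K x = (fine (K x))%:E.
Proof. by rewrite fineK// ge0_fin_numE// (le_lt_trans (K_le x))// ltry. Qed.

Let K_out x : ~ E x -> K x = 0%E.
Proof.
move=> nEx; rewrite /K -[RHS](integral0 mu setT); apply: eq_integral => y _.
rewrite /F indicE; case: (boolP (_ \in GY)) => [/set_mem[/levelE[Ex _] _]|_] //.
by rewrite mulr0 mul0r.
Qed.

Let K_mass : ((eps * (3 / 4 * l) * alpha)%:E <= \int[mu]_x K x)%E.
Proof.
rewrite /K (@fubini_tonelli _ _ TR TR R mu mu (EFin \o F) mFE); last by move=> z; rewrite /= lee_fin.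
rewrite EFinM -alphaE -ge0_integralZl//; first last.
- by rewrite lee_fin !mulr_ge0 ?invr_ge0// ltW.
- by move=> y _; rewrite lee_fin.
- exact/measurable_EFinP.
apply: ge0_le_integral => //.
- by move=> y _; rewrite mule_ge0 ?lee_fin ?fY0 ?mulr_ge0 ?invr_ge0// ltW.
- by apply: measurable_funeM; exact/measurable_EFinP.
- by apply: (@measurable_fun_fubini_tonelli_G _ _ TR TR R mu _ mFE) => z; rewrite /= lee_fin.
move=> y _.
have [Yy|nY] := pselect (Y y); last first.
  rewrite patchE memNset// mule0; apply: integral_ge0 => x _.
  by rewrite lee_fin.
have dy : ((3 / 4 * l)%:E <= mu (ysection level y `&` I0))%E by apply: ltW; case: Yy.
have mS : measurable (ysection level y `&` I0).
  by apply: measurableI => //; apply: measurable_ysection; exact: mlevel.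
rewrite (_ : (fun x => _) = fun x : TR => ((eps * fE y)%:E * (\1_(ysection level y `&` I0) x)%:E)%E); last first.
  apply/funext => x; rewrite -EFinM /= /F /= mulrAC; congr (_ * _)%:E; rewrite !indicE; congr (nat_of_bool _)%:R.
  apply/idP/idP => /set_mem.
    by move=> [h [/= Ix _]]; apply: mem_set; split => //; exact/ysectionP.
  by move=> [/ysectionP h Ix]; apply: mem_set; split.
rewrite ge0_integralZl//; first last.
- by rewrite lee_fin mulr_ge0// ltW.
- by apply/measurable_EFinP; exact: measurable_indic.
rewrite integral_indic// setIT -(fYE Yy) -EFinM mulrAC EFinM.
by apply: lee_wpmul2l => //; rewrite lee_fin mulr_ge0// ltW.
Qed.

(** For [x] in [I0], [k x] integrates [eps * f] over those [y] in [Y] with [(x, y)] in the level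
    set, where [eps <= p]. The upper bound forgets the level set; the lower bound exchanges the
    integrals and uses that each [y] in [Y] sees at least 3/4 of [I0]. *)
Lemma minorant_section : exists k, [/\ L k,
  forall x, E x -> 0 <= k x <= eps * J (f \_ Y) * \1_I0 x,
  eps * (3 / 4 * l) * J (f \_ Y) <= J k &
  forall x, E x -> ((k x)%:E <= \int[lebm R]_(y in E) (p x y * f y)%:E)%E].
Proof.
pose k x := fine (K x).
have kb x : 0 <= k x <= eps * alpha * \1_I0 x.
  by rewrite -!lee_fin -[(k x)%:E]Kfin K0 K_le.
have mk : measurable_fun setT k by apply: measurableT_comp mK; exact: fine_measurable.
have Lk : L k.
  apply: L1_le (L1Z (eps * alpha) L1_indic_I0) _.
    by apply: measurable_funS mk.
  by move=> x _; have /andP[h1 h2] := kb x; rewrite ger0_norm.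
exists k; split => //.
- rewrite [J k]JE RintegralE -lee_fin fineK; last by apply: integrable_fin_num.
  apply: (le_trans K_mass); rewrite [leRHS]integral_mkcond.
  rewrite le_eqVlt; apply/orP; left; apply/eqP; apply: eq_integral => x _.
  rewrite patchE; case: ifPn => [_|/negP nEx]; first by rewrite -Kfin.
  by apply: K_out => Ex; apply: nEx; exact: mem_set.
- move=> x Ex; rewrite -Kfin [leRHS]integral_mkcond; apply: ge0_le_integral => //.
  + by move=> y _; rewrite lee_fin.
  + by apply/measurable_EFinP; apply: measurableT_comp => //; exact: mF.
  + have h : measurable_fun setT (fun y : TR => (pE (x, y) * fE y)%:E).
      apply/measurable_EFinP; apply: measurable_funM => //.
      by apply: measurableT_comp => //; exact: pE_meas.
    congr (measurable_fun _ _): h; apply/funext => y; rewrite /fE !patchE.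
    case: ifPn => [/set_mem Ey|_]; last by rewrite mulr0.
    by rewrite pEE.
  + move=> y _; rewrite [leRHS]patchE; case: ifPn => [/set_mem Ey|/negP nEy]; last first.
      rewrite lee_fin /F /= /fE patchE memNset ?mulr0//.
      by move=> Ey; apply: nEy; exact: mem_set.
    rewrite lee_fin /F /= /fE patchE mem_set// ler_wpM2r ?f0// indicE.
    case: (boolP (_ \in GY)) => [/set_mem[h _]|_]; last by rewrite mulr0 p0.
    rewrite mulr1 -(pEE p Ex Ey); move: h; rewrite /level /= in_itv /= andbT; exact.
Qed.

End OneFunction.

Context (T : (R -> R) -> R -> R) (oT : L1op d0 d1 T) (pT : positive_op d0 d1 T).
Context (hT : forall u, density d0 d1 u -> {ae lebm R, forall x, E x ->
  (\int[lebm R]_(y in E) (p x y * u y)%:E <= (T u x)%:E)%E}).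

(** The kernel bound is given for densities, so [f] is scaled to mass 1 and [k] scaled back; for
    mass 0 the zero function serves. *)
Lemma minorant f : L f -> (forall x, E x -> 0 <= f x) -> exists k, [/\ L k,
  forall x, E x -> 0 <= k x <= eps * J (f \_ Y) * \1_I0 x,
  eps * (3 / 4 * l) * J (f \_ Y) <= J k & AE d0 d1 (fun x => k x <= T f x)].
Proof.
move=> Lf f0; have f0' : nonneg_ae d0 d1 f by exact: AE_all.
have := J_ge0 Lf f0'; rewrite le_eqVlt => /orP[/eqP Jf|Jf].
  have Lr : L (f \_ Y) by exact: L1_restrict.
  have a0 : J (f \_ Y) = 0.
    apply/eqP; rewrite eq_le; apply/andP; split.
      rewrite Jf; apply: J_le => //; apply: AE_all => x Ex; rewrite patchE.
      by case: ifP => // _; exact: f0.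
    apply: J_ge0 => //; apply: AE_all => x Ex; rewrite patchE.
    by case: ifP => // _; exact: f0.
  exists (fun=> 0); rewrite a0 !mulr0; split.
  - exact: L1_0.
  - by move=> x _; rewrite mul0r lexx.
  - by rewrite J0.
  - exact: pT.
have du := density_scale Lf f0' Jf; set c := (J f)^-1 in du.
have c0 : 0 < c by rewrite invr_gt0.
have u0 x : E x -> 0 <= c * f x by move=> Ex; rewrite mulr_ge0 ?f0// ltW.
have [k [Lk kb Jk kp]] := minorant_section (L1Z c Lf) u0.
have e : J ((fun x => c * f x) \_ Y) = c * J (f \_ Y).
  rewrite -JZ; last exact: L1_restrict.
  congr J; apply/funext => x; rewrite !patchE; case: ifP => //; by rewrite mulr0.
rewrite e in kb Jk; have cc : J f * c = 1 by rewrite /c mulfV// gt_eqF.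
exists (fun x => J f * k x); split.
- exact: L1Z.
- move=> x Ex; have /andP[k1 k2] := kb x Ex; rewrite mulr_ge0 ?(ltW Jf)//=.
  have := ler_wpM2l (ltW Jf) k2; rewrite (_ : J f * (_ * (c * _) * _) = (J f * c) * (eps * J (f \_ Y) * \1_I0 x)).
    by rewrite cc mul1r.
  by ring.
- rewrite JZ//; have := ler_wpM2l (ltW Jf) Jk.
  rewrite (_ : J f * (_ * (c * _)) = (J f * c) * (eps * (3 / 4 * l) * J (f \_ Y))).
    by rewrite cc mul1r.
  by ring.
- refine (AE2 (hT du) (opZ oT c Lf) _) => x Ex h1 h2.
  have := le_trans (kp x Ex) h1; rewrite lee_fin h2 => h3.
  have := ler_wpM2l (ltW Jf) h3.
  by rewrite mulrA cc mul1r.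
Qed.

(* Each minorant covers three quarters of the interval, so the two overlap on half of it. *)
Lemma overlap_nonneg f f' : L f -> L f' -> (forall x, E x -> 0 <= f x) ->
  (forall x, E x -> 0 <= f' x) ->
  eps * l / 2 * Num.min (J (f \_ Y)) (J (f' \_ Y)) <=
    J (fun x => Num.min (T f x) (T f' x)).
Proof.
move=> Lf Lf' f0 f0'; set al := J (f \_ Y); set al' := J (f' \_ Y); set m := Num.min _ _.
have LT := op_L1 oT Lf; have LT' := op_L1 oT Lf'.
have Lm : L (fun x => Num.min (T f x) (T f' x)) by exact: L1_min.
have [m0|m0] := leP m 0.
  apply: (@le_trans _ _ 0).
    by rewrite pmulr_rle0// divr_gt0// mulr_gt0.
  apply: J_ge0 => //; refine (AE2 (pT Lf (AE_all f0)) (pT Lf' (AE_all f0')) _) => x _ h h'.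
  by rewrite le_min h.
have [al0 al0'] : 0 < al /\ 0 < al' by move: m0; rewrite lt_min => /andP[].
have [ma ma'] : m <= al /\ m <= al' by rewrite /m !ge_min !lexx orbT.
have [k [Lk kb Jk kT]] := minorant Lf f0; have [k' [Lk' kb' Jk' kT']] := minorant Lf' f0'.
rewrite -/al in kb Jk; rewrite -/al' in kb' Jk'.
(* Both minorants are scaled down to the common height [m * eps] on [I0]. *)
pose c := m / al; pose c' := m / al'.
have c01 : 0 <= c <= 1 by rewrite /c divr_ge0 ?(ltW m0) ?(ltW al0)//= ler_pdivrMr// mul1r.
have c01' : 0 <= c' <= 1 by rewrite /c' divr_ge0 ?(ltW m0) ?(ltW al0')//= ler_pdivrMr// mul1r.
have cal : c * al = m by rewrite /c divfK// gt_eqF.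
have cal' : c' * al' = m by rewrite /c' divfK// gt_eqF.
have LI := L1_indic_I0.
(* Both scaled minorants are at most [m * eps * \1_I0], so [r] lies below their minimum; its
   integral is at least [m * eps * l] times [3/4 + 3/4 - 1]. *)
pose r x := c * k x + c' * k' x - m * eps * \1_I0 x.
have Lr : L r by apply: L1B; [exact: L1_comb|exact: L1Z].
apply: (@le_trans _ _ (J r)).
  rewrite /r JB; [|exact: L1_comb|exact: L1Z].
  rewrite Jcomb// JZ//.
  have h1 : c * (eps * (3 / 4 * l) * al) <= c * J k by rewrite ler_wpM2l//; case/andP: c01.
  have h2 : c' * (eps * (3 / 4 * l) * al') <= c' * J k' by rewrite ler_wpM2l//; case/andP: c01'.
  have h3 : m * eps * J (\1_I0 : R -> R) <= m * eps * l.
    by rewrite ler_wpM2l ?J_indic_I0// mulr_ge0// ltW.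
  rewrite (_ : c * (_ * al) = m * eps * l * (3 / 4)) in h1; last by rewrite -cal; ring.
  rewrite (_ : c' * (_ * al') = m * eps * l * (3 / 4)) in h2; last by rewrite -cal'; ring.
  have -> : eps * l / 2 * m = m * eps * l / 2 by ring.
  lra.
apply: J_le => //; refine (AE2 kT kT' _) => x Ex h h'; rewrite /r le_min.
have /andP[k1 k2] := kb x Ex; have /andP[k1' k2'] := kb' x Ex.
case/andP: c01 => c0 c1; case/andP: c01' => c0' c1'.
have b1 : c * k x <= m * eps * \1_I0 x.
  have := ler_wpM2l c0 k2; rewrite (_ : c * (_ * al * _) = m * eps * \1_I0 x)//.
  by rewrite -cal; ring.
have b2 : c' * k' x <= m * eps * \1_I0 x.
  have := ler_wpM2l c0' k2'; rewrite (_ : c' * (_ * al' * _) = m * eps * \1_I0 x)//.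
  by rewrite -cal'; ring.
have b3 : c * k x <= k x by rewrite ler_piMl.
have b4 : c' * k' x <= k' x by rewrite ler_piMl.
by apply/andP; split; lra.
Qed.

Lemma overlap f f' : L f -> L f' -> nonneg_ae d0 d1 f -> nonneg_ae d0 d1 f' ->
  eps * l / 2 * Num.min (J (f \_ Y)) (J (f' \_ Y)) <=
    J (fun x => Num.min (T f x) (T f' x)).
Proof.
move=> Lf Lf' f0 f0'.
have Lm h : L h -> L (fun x => Num.max (h x) 0) by move=> Lh; apply: L1_max => //; exact: L1_0.
have e h : nonneg_ae d0 d1 h -> aeE d0 d1 h (fun x => Num.max (h x) 0).
  by move=> h0; refine (AE1 h0 _) => x _ k; rewrite max_l.
have eJ h : L h -> nonneg_ae d0 d1 h -> J (h \_ Y) = J ((fun x => Num.max (h x) 0) \_ Y).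
  move=> Lh h0; apply: J_ae; [exact: L1_restrict|by apply: L1_restrict => //; exact: Lm|].
  by refine (AE1 (e h h0) _) => x _ k; rewrite !patchE; case: ifP => // _; rewrite k.
have g0 (h : R -> R) x : E x -> 0 <= Num.max (h x) 0 by move=> _; rewrite le_max lexx orbT.
have := overlap_nonneg (Lm f Lf) (Lm f' Lf') (g0 f) (g0 f').
rewrite -!eJ// => h; apply: (le_trans h).
rewrite le_eqVlt; apply/orP; left; apply/eqP; apply: J_ae.
- by apply: L1_min; apply: (op_L1 oT); exact: Lm.
- by apply: L1_min; apply: (op_L1 oT).
- refine (AE2 (op_ae oT Lf (Lm f Lf) (e f f0)) (op_ae oT Lf' (Lm f' Lf') (e f' f0')) _).
  by move=> x _ -> ->.
Qed.

End Minorant.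

Section SmallSetExistence.
Context {R : realType} {d0 d1 : \bar R} {Pt : R -> (R -> R) -> R -> R}.

Lemma exists_small_set : pos_sc_contraction_semigroup d0 d1 Pt -> partially_integral d0 d1 Pt ->
  exists (t0 : R) (Y : set R) (kappa : R), [/\ 0 < t0, measurable Y /\ Y `<=` Eset d0 d1,
    (0 < lebm R Y)%E, 0 < kappa & forall f f', L1 d0 d1 f -> L1 d0 d1 f' ->
    nonneg_ae d0 d1 f -> nonneg_ae d0 d1 f' ->
    kappa * Num.min (J d0 d1 (f \_ Y)) (J d0 d1 (f' \_ Y)) <=
      J d0 d1 (fun x => Num.min (Pt t0 f x) (Pt t0 f' x))].
Proof.
move=> sg [t0 [t00 [p [mp p0 pint hT]]]].
have [n [a [b [ab muY]]]] := exists_dense_set mp p0 pint.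
exists t0, (@dense_set R d0 d1 p n a b `&` Eset d0 d1), (n.+1%:R^-1 * (ratr b - ratr a) / 2).
split => //.
- split; last by move=> y [].
  apply: measurableI; last exact: mEset.
  exact: (mdense_set mp).
- by rewrite divr_gt0// mulr_gt0 ?invr_gt0 ?ltr0n// subr_gt0.
- move=> f f' Lf Lf' f0 f0'.
  exact: (overlap mp p0 n ab (sg_op sg (ltW t00)) (sg_pos sg (ltW t00)) hT Lf Lf' f0 f0').
Qed.

End SmallSetExistence.

(** * Asymptotic stability *)

Section Restriction.
Context {R : realType} {d0 d1 : \bar R} {Y : set R}.
Context (mY : measurable Y) (YE : Y `<=` Eset d0 d1).
Implicit Types (h k : R -> R).
Local Notation L := (L1 d0 d1).
Local Notation JY h := (J d0 d1 (h \_ Y)).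

Lemma J_on_le h k : L h -> L k -> AE d0 d1 (fun x => h x <= k x) -> JY h <= JY k.
Proof.
move=> Lh Lk hk; apply: J_le; [exact: L1_restrict|exact: L1_restrict|].
by refine (AE1 hk _) => x _ le_hk; rewrite !patchE; case: ifP.
Qed.

Lemma J_on_ae h k : L h -> L k -> aeE d0 d1 h k -> JY h = JY k.
Proof.
move=> Lh Lk hk; apply: J_ae; [exact: L1_restrict|exact: L1_restrict|].
by refine (AE1 hk _) => x _ e; rewrite !patchE e.
Qed.

Lemma J_onD h k : L h -> L k -> JY (fun x => h x + k x) = JY h + JY k.
Proof.
move=> Lh Lk; rewrite -JD; [|exact: L1_restrict|exact: L1_restrict].
by congr J; apply/funext => x; rewrite !patchE; case: ifP; rewrite ?addr0.
Qed.

Lemma J_onB h k : L h -> L k -> JY (fun x => h x - k x) = JY h - JY k.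
Proof.
move=> Lh Lk; rewrite -JB; [|exact: L1_restrict|exact: L1_restrict].
by congr J; apply/funext => x; rewrite !patchE; case: ifP; rewrite ?subr0.
Qed.

Lemma J_onZ c h : L h -> JY (fun x => c * h x) = c * JY h.
Proof.
move=> Lh; rewrite -JZ; last exact: L1_restrict.
by congr J; apply/funext => x; rewrite !patchE; case: ifP; rewrite ?mulr0.
Qed.

Lemma J_on_dist h k : L h -> L k -> `|JY h - JY k| <= norm1 d0 d1 (fun x => h x - k x).
Proof.
move=> Lh Lk; apply: (le_trans (J_dist (L1_restrict mY YE Lh) (L1_restrict mY YE Lk))).
apply: norm1_le; [by apply: L1B; exact: L1_restrict|exact: L1B|].
by apply: AE_all => x _; rewrite !patchE; case: ifP => // _; rewrite subrr normr0.
Qed.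

Lemma J_on_gt0 h : L h -> pos_ae d0 d1 h -> (0 < lebm R Y)%E -> 0 < JY h.
Proof.
move=> Lh h0 Y0; rewrite ltNge; apply/negP => hY.
have hr0 : nonneg_ae d0 d1 (h \_ Y).
  by refine (AE1 h0 _) => x _ /ltW ?; rewrite patchE; case: ifP.
have := AE2 (J_eq0 (L1_restrict mY YE Lh) hr0 hY) h0.
move=> /(_ (fun x => ~ Y x)) [].
  by move=> x _ + hx Yx; rewrite patchE mem_set// => h1; rewrite h1 ltxx in hx.
move=> A [mA A0 hA]; have sub : Y `<=` A by move=> x Yx; apply: hA => /(_ (YE Yx)).
have : (lebm R Y <= 0)%E by rewrite -A0; apply: le_measure; rewrite ?inE.
by rewrite leNgt Y0.
Qed.

End Restriction.

(** [min w z] lies above every [v n], so its integral is at least that of [w], and it cannot drop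
    below [w] on a set of positive measure. *)
Lemma limit_least {R : realType} {d0 d1 : \bar R} (v : nat -> R -> R) (w z : R -> R) :
  (forall n, L1 d0 d1 (v n)) -> L1 d0 d1 w -> L1 d0 d1 z ->
  (forall n, AE d0 d1 (fun x => v n x <= w x)) -> (forall n, AE d0 d1 (fun x => v n x <= z x)) ->
  (fun n => J d0 d1 (v n)) @ \oo --> J d0 d1 w -> AE d0 d1 (fun x => w x <= z x).
Proof.
move=> Lv Lw Lz vw vz c.
have Lm := L1_min Lw Lz.
have e : aeE d0 d1 (fun x => Num.min (w x) (z x)) w.
  apply: J_le_eq => //; first by apply: AE_all => x _; rewrite ge_min lexx.
  apply: (cvgr_to_le c); apply: nearW => n; apply: J_le => //.
  by refine (AE2 (vw n) (vz n) _) => x _ h1 h2; rewrite le_min h1.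
by refine (AE1 e _) => x _ <-; rewrite ge_min lexx orbT.
Qed.

(** * Functions whose orbits avoid Y *)

Section NoEscape.
Context {R : realType} {d0 d1 : \bar R} {Pt : R -> (R -> R) -> R -> R}.
Context (sg : pos_sc_contraction_semigroup d0 d1 Pt).
Context (mass : forall t u, 0 <= t -> L1 d0 d1 u -> J d0 d1 (Pt t u) = J d0 d1 u).
Context {us : R -> R} (Lus : L1 d0 d1 us).
Context (fus : forall t, 0 <= t -> aeE d0 d1 (Pt t us) us).
Context {Y : set R} (mY : measurable Y) (YE : Y `<=` Eset d0 d1).
Implicit Types (h k p q : R -> R).
Local Notation L := (L1 d0 d1).
Local Notation J := (J d0 d1).
Local Notation N := (norm1 d0 d1).
Local Notation "u =ae v" := (aeE d0 d1 u v) (at level 70).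
Local Notation JY h := (J (h \_ Y)).

Definition dominated h := L h /\ AE d0 d1 (fun x => 0 <= h x <= us x).
(** The bound is imposed along the whole orbit, so that every [Pt t h] inherits it. *)
Definition evading del h := dominated h /\ forall s, 0 <= s -> JY (Pt s h) <= del.

Lemma dominated_nonneg h : dominated h -> nonneg_ae d0 d1 h.
Proof. by move=> [_ h0]; refine (AE1 h0 _) => x _ /andP[]. Qed.

Lemma dominated_sg h t : 0 <= t -> dominated h -> dominated (Pt t h).
Proof.
move=> t0 Dh; have [Lh hu] := Dh; split; first exact: (sg_L1 sg).
have h1 := sg_pos sg t0 Lh (dominated_nonneg Dh).
have h2 : AE d0 d1 (fun x => Pt t h x <= Pt t us x).
  by apply: (op_le (sg_op sg t0) (sg_pos sg t0)) => //; refine (AE1 hu _) => x _ /andP[].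
by refine (AE3 h1 h2 (fus t0) _) => x _ k1 k2 <-; rewrite k1.
Qed.

Lemma dominated_max h k : dominated h -> dominated k ->
  dominated (fun x => Num.max (h x) (k x)).
Proof.
move=> [Lh hu] [Lk ku]; split; first exact: L1_max.
by refine (AE2 hu ku _) => x _ /andP[h1 h2] /andP[k1 k2]; rewrite le_max ge_max h1 h2 k2.
Qed.

Lemma J_on_max s h k : 0 <= s -> dominated h -> dominated k ->
  JY (Pt s (fun x => Num.max (h x) (k x))) <= JY (Pt s h) + JY (Pt s k).
Proof.
move=> s0 Dh Dk; have [Lh _] := Dh; have [Lk _] := Dk.
have Lhs := sg_L1 sg s0 Lh; have Lks := sg_L1 sg s0 Lk.
rewrite -J_onD//; apply: J_on_le => //; [by apply: (sg_L1 sg) => //; exact: L1_max|exact: L1D|].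
have h1 : AE d0 d1 (fun x => Pt s (fun x => Num.max (h x) (k x)) x <= Pt s (fun x => h x + k x) x).
  apply: (op_le (sg_op sg s0) (sg_pos sg s0)); [exact: L1_max|exact: L1D|].
  refine (AE2 (dominated_nonneg Dh) (dominated_nonneg Dk) _) => x _ k1 k2.
  by rewrite ge_max lerDl k2 lerDr.
by refine (AE2 h1 (opD (sg_op sg s0) Lh Lk) _) => x _ k1 <-.
Qed.

Lemma evading_max del del' h k : evading del h -> evading del' k ->
  evading (del + del') (fun x => Num.max (h x) (k x)).
Proof.
move=> [Dh eh] [Dk ek]; split; first exact: dominated_max.
by move=> s s0; apply: le_trans (J_on_max s0 Dh Dk) _; rewrite lerD ?eh ?ek.
Qed.

Lemma evading_sg del h t : 0 <= t -> evading del h -> evading del (Pt t h).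
Proof.
move=> t0 [Dh eh]; split; first exact: dominated_sg.
move=> s s0; have [Lh _] := Dh.
rewrite -(J_on_ae mY YE _ _ (sgD sg s0 t0 Lh)); first by apply: eh; exact: addr_ge0.
  by apply: (sg_L1 sg) => //; exact: addr_ge0.
by do 2 apply: (sg_L1 sg) => //.
Qed.

Lemma evading_le del h k : evading del h -> L k -> AE d0 d1 (fun x => 0 <= k x <= h x) ->
  evading del k.
Proof.
move=> [[Lh hu] eh] Lk kh; split.
  split => //; refine (AE2 hu kh _) => x _ /andP[_ h2] /andP[-> h3].
  exact: le_trans h3 h2.
move=> s s0; apply: le_trans (eh s s0); apply: (J_on_le mY YE); [exact: (sg_L1 sg)..|].
by apply: (op_le (sg_op sg s0) (sg_pos sg s0)) => //; refine (AE1 kh _) => x _ /andP[].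
Qed.

(** For functions below [w], convergence of the integrals is convergence in norm, and both [Pt s]
    and the restriction to [Y] contract the norm. *)
Lemma evading_limit del (v : nat -> R -> R) w : (forall n, evading del (v n)) -> L w ->
  (forall n, AE d0 d1 (fun x => v n x <= w x <= us x)) ->
  (fun n => J (v n)) @ \oo --> J w -> evading del w.
Proof.
move=> ev Lw vw c; split.
  split => //; have [[_ h0] _] := ev 0%N.
  refine (AE2 h0 (vw 0%N) _) => x _ /andP[k1 _] /andP[k2 ->].
  by rewrite (le_trans k1 k2).
move=> s s0; apply/ler_addgt0Pr => e e0.
move/cvgrPdist_lt: c => /(_ e e0)[n _ hn]; have := hn n (leqnn n) => /= {}hn.
have [[Lv _] evn] := ev n; have Lvs := sg_L1 sg s0 Lv; have Lws := sg_L1 sg s0 Lw.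
have Lwv := L1B Lw Lv.
have : JY (Pt s w) - JY (Pt s (v n)) <= e.
  apply: le_trans (ler_norm _) _; apply: le_trans (J_on_dist mY YE Lws Lvs) _.
  have e1 : (fun x => Pt s w x - Pt s (v n) x) =ae Pt s (fun x => w x - v n x).
    by apply: aeE_sym; exact: (opB (sg_op sg s0)).
  rewrite (norm1_ae _ _ e1); [|exact: L1B|exact: (sg_L1 sg)].
  apply: le_trans (sg_contr sg s0 Lwv) _.
  rewrite norm1_nonneg//; last by refine (AE1 (vw n) _) => x _ /andP[]; rewrite subr_ge0.
  by rewrite JB//; apply: le_trans (ltW hn); exact: ler_norm.
have := evn s s0; lra.
Qed.

Lemma evading_weaken del del' h : del <= del' -> evading del h -> evading del' h.
Proof. by move=> dd [Dh eh]; split => // s s0; exact: le_trans (eh s s0) dd. Qed.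

Fixpoint running_max (p : nat -> R -> R) j n : R -> R :=
  if n is n'.+1 then fun x => Num.max (running_max p j n' x) (p (j + n)%N x) else p j.

Lemma running_max_shift (p : nat -> R -> R) j n x :
  running_max p j.+1 n x <= running_max p j n.+1 x.
Proof.
have rS (k m : nat) : running_max p k m.+1 x = Num.max (running_max p k m x) (p (k + m.+1)%N x) by [].
elim: n => [|n IH]; first by rewrite rS addn1 le_max lexx orbT.
rewrite (rS j.+1 n) (rS j n.+1) addSnnS ge_max.
by apply/andP; split; rewrite le_max; [rewrite IH|rewrite lexx orbT].
Qed.

Local Notation half i := ((2^-1 : R) ^+ i).

(** Maxima add the bounds, and the geometric sum of [half i] for [i] from [j] to [j + n] is
    [2 * half j - half (j + n)]. *)
Lemma evading_running_max (p : nat -> R -> R) j n : (forall i, evading (half i) (p i)) ->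
  evading (2 * half j) (running_max p j n).
Proof.
move=> ep; apply: (@evading_weaken (2 * half j - half (j + n))).
  by rewrite gerBl exprn_ge0.
elim: n => [|n IH]; first by rewrite addn0 mulrDl mul1r addrK; exact: ep.
rewrite (_ : _ - _ = 2 * half j - half (j + n) + half (j + n.+1)).
  by apply: evading_max => //; exact: ep.
by rewrite addnS exprS; field.
Qed.

Lemma evading_sup (p : nat -> R -> R) j : (forall i, evading (half i) (p i)) ->
  exists q, [/\ evading (2 * half j) q, AE d0 d1 (fun x => forall n, running_max p j n x <= q x),
    (fun n => J (running_max p j n)) @ \oo --> J q & L q].
Proof.
move=> ep; have er n := evading_running_max j n ep.
have ru n : AE d0 d1 (fun x => running_max p j n x <= us x).
  by have [[_ h] _] := er n; refine (AE1 h _) => x _ /andP[].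
have [n|n|q [Lq hq cq]] := @increasing_limit R d0 d1 (running_max p j) us _ Lus _.
- by have [[]] := er n.
- by refine (AE1 (ru n.+1) _) => x _ ->; rewrite /= le_max lexx.
exists q; split => //; last by refine (AE1 hq _) => x _ h n; have /andP[] := h n.
by apply: (evading_limit er Lq _ cq) => n; refine (AE1 hq _) => x _; exact.
Qed.

Context (Jus : J us = 1) (JYus : 0 < JY us).
Context (uniq : forall f, L f -> (forall t, 0 <= t -> Pt t f =ae f) -> f =ae (fun x => J f * us x)).

(* By maximality max(q, P(t) q) is again q, so q is fixed, hence a multiple of us, which charges Y. *)
Lemma evading0_le q : evading 0 q -> (forall h, evading 0 h -> J h <= J q) -> J q <= 0.
Proof.
move=> eq qmax; have [[Lq qu] eqY] := eq.
have fq t : 0 <= t -> Pt t q =ae q.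
  move=> t0; have Lqt := sg_L1 sg t0 Lq.
  have em : evading 0 (fun x => Num.max (q x) (Pt t q x)).
    by rewrite -[0]addr0; apply: evading_max => //; exact: evading_sg.
  have e : q =ae (fun x => Num.max (q x) (Pt t q x)).
    apply: J_le_eq => //; [exact: L1_max| |exact: qmax].
    by apply: AE_all => x _; rewrite le_max lexx.
  apply: J_le_eq => //; last by rewrite mass.
  by refine (AE1 e _) => x _ ->; rewrite le_max lexx orbT.
have e := uniq Lq fq.
have := eqY 0 (lexx 0); rewrite (J_on_ae mY YE _ _ (fq 0 (lexx 0)))//; last exact: (sg_L1 sg).
by rewrite (J_on_ae mY YE Lq (L1Z _ Lus) e) J_onZ// pmulr_lle0.
Qed.

(* The limit superior w of near-maximal functions p i evading Y up to 2^-i is a maximal function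
   evading Y completely. *)
Lemma no_escape eta : 0 < eta -> ~ (forall del, 0 < del -> exists2 p, evading del p & eta <= J p).
Proof.
move=> eta0 hex.
have half0 i : 0 < half i by rewrite exprn_gt0.
pose S i := [set r | exists2 p, evading (half i) p & r = J p].
have J1 del h : evading del h -> J h <= 1.
  move=> [[Lh hu] _]; rewrite -Jus; apply: J_le => //.
  by refine (AE1 hu _) => x _ /andP[].
have supS i : has_sup (S i).
  split; last by exists 1 => _ [h eh ->]; exact: J1 eh.
  by have [h eh _] := hex (half i) (half0 i); exists (J h); exists h.
have near i : exists p, evading (half i) p /\ forall h, evading (half i) h -> J h <= J p + half i.
  have [_ [p ep ->] hp] := sup_adherent (half0 i) (supS i).
  exists p; split => // h eh; rewrite -lerBlDr ltW//; apply: le_lt_trans hp.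
  by rewrite lerB// ub_le_sup//; [case: (supS i)|exists h].
have [p hp] := choice near; have ep i := (hp i).1.
have [q hq] := choice (fun j => evading_sup j ep).
have Lq j : L (q j) by have [] := hq j.
have pq j : J (p j) <= J (q j).
  have [_ h _ _] := hq j; have [[[Lp _] _] _] := hp j.
  by apply: J_le => //; refine (AE1 h _) => x _ /(_ 0%N).
have qdec j : AE d0 d1 (fun x => 0 <= q j.+1 x <= q j x).
  have [[[_ q0] _] h1 c Lq1] := hq j.+1; have [_ h2 _ _] := hq j.
  have h3 : AE d0 d1 (fun x => q j.+1 x <= q j x).
    apply: (limit_least (v := running_max p j.+1)) => // n.
    - by have [[]] := evading_running_max j.+1 n ep.
    - by refine (AE1 h1 _) => x _; exact.
    - refine (AE1 h2 _) => x _ h; apply: le_trans (running_max_shift p j n x) (h _).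
  by refine (AE2 q0 h3 _) => x _ /andP[-> _].
have [w [Lw hw cw]] := decreasing_limit Lq qdec.
have half_cvg : (fun i => half i) @ \oo --> (0 : R).
  by apply: cvg_expr; rewrite ger0_norm// invf_lt1// ltr1n.
have ew : evading 0 w.
  have ew i : evading (2 * half i) w.
    have [eqi _ _ _] := hq i; apply: (evading_le eqi Lw).
    by refine (AE1 hw _) => x _; exact.
  split; first by have [] := ew 0%N.
  move=> s s0; have c : (fun i => 2 * half i) @ \oo --> (2 * 0 : R) by exact: cvgMr.
  rewrite mulr0 in c; apply: (cvgr_to_ge c); apply: nearW => i.
  by have [_] := ew i; exact.
(* [J (q i)] is at least [J (p i)] and tends to [J w]. This serves twice: for the lower bound [eta]
   and for the maximality of [w]. *)
have wmax eta' : (forall i, eta' <= J (p i) + half i) -> eta' <= J w.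
  move=> h; have c : (fun i => J (q i) + half i) @ \oo --> J w.
    by rewrite -[J w]addr0; exact: cvgD.
  by apply: (cvgr_to_ge c); apply: nearW => i; apply: le_trans (h i) _; rewrite lerD2r.
have : eta <= J w.
  apply: wmax => i; have [h eh etah] := hex (half i) (half0 i).
  exact: le_trans etah ((hp i).2 h eh).
have := evading0_le ew; move=> k1 k2.
have : J w <= 0.
  apply: k1 => h eh; apply: wmax => i; apply: (hp i).2.
  by apply: evading_weaken eh; exact: ltW.
lra.
Qed.

End NoEscape.

(** * From small overlap of p and us - p to avoidance of Y *)

Section Decay.
Context {R : realType} {d0 d1 : \bar R} {Pt : R -> (R -> R) -> R -> R}.
Context (sg : pos_sc_contraction_semigroup d0 d1 Pt).
Context (mass : forall t u, 0 <= t -> L1 d0 d1 u -> J d0 d1 (Pt t u) = J d0 d1 u).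
Context {us : R -> R} (Lus : L1 d0 d1 us).
Context (fus : forall t, 0 <= t -> aeE d0 d1 (Pt t us) us).
Context {Y : set R} (mY : measurable Y) (YE : Y `<=` Eset d0 d1).
Context {t0 kappa : R} (t00 : 0 < t0) (kappa0 : 0 < kappa).
Context (overlap : forall f f', L1 d0 d1 f -> L1 d0 d1 f' ->
    nonneg_ae d0 d1 f -> nonneg_ae d0 d1 f' ->
    kappa * Num.min (J d0 d1 (f \_ Y)) (J d0 d1 (f' \_ Y)) <=
      J d0 d1 (fun x => Num.min (Pt t0 f x) (Pt t0 f' x))).
Implicit Types (f p : R -> R).
Local Notation L := (L1 d0 d1).
Local Notation J := (J d0 d1).
Local Notation "u =ae v" := (aeE d0 d1 u v) (at level 70).
Local Notation JY h := (J (h \_ Y)).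
Local Notation dominated := (@dominated R d0 d1 us).
Local Notation evading := (@evading R d0 d1 Pt us Y).

(** Steps of length [d / 2] reach every time, and each is short enough for the one-step
    hypothesis. *)
Lemma gap_stays (f : R -> R) th d : 0 < d ->
  (forall s r, 0 <= s -> 0 <= r -> r < d -> f s <= th -> f (s + r) <= th) ->
  f 0 <= th -> forall s, 0 <= s -> f s <= th.
Proof.
move=> dd step f0 s s0.
have d2 : 0 < d / 2 by rewrite divr_gt0.
have d2d : d / 2 < d by lra.
have key k : forall s, 0 <= s -> s <= k%:R * (d / 2) -> f s <= th.
  elim: k => [|k IH] r r0; first by rewrite mul0r => h; rewrite (_ : r = 0)//; lra.
  rewrite -addn1 natrD mulrDl mul1r => h.
  have [rd|rd] := leP r (d / 2).
    by rewrite -[r]add0r; apply: step => //; exact: le_lt_trans rd d2d.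
  rewrite -[r](subrK (d / 2)); apply: step => //; [lra|exact: ltW|].
  by apply: IH; lra.
apply: (key (Num.truncn (s / (d / 2))).+1) => //.
by rewrite -ler_pdivrMr// ltW// truncnS_gt.
Qed.

Lemma dominated_compl p : dominated p -> dominated (fun x => us x - p x).
Proof.
move=> [Lp pu]; split; first exact: L1B.
by refine (AE1 pu _) => x _ /andP[h1 h2]; apply/andP; split; lra.
Qed.

Lemma sg_compl p s : 0 <= s -> L p -> Pt s (fun x => us x - p x) =ae (fun x => us x - Pt s p x).
Proof.
by move=> s0 Lp; refine (AE2 (opB (sg_op sg s0) Lus Lp) (fus s0) _) => x _ -> ->.
Qed.

Lemma J_on_compl p s : 0 <= s -> L p -> JY (Pt s (fun x => us x - p x)) = JY us - JY (Pt s p).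
Proof.
move=> s0 Lp; have Lps := sg_L1 sg s0 Lp.
rewrite (J_on_ae mY YE _ _ (sg_compl s0 Lp)); first exact: J_onB.
  by apply: (sg_L1 sg) => //; exact: L1B.
exact: L1B.
Qed.

(* The mass on Y varies continuously in time, hence cannot jump from below th to above JY us - th. *)
Lemma evading_dichotomy p th : dominated p -> 0 <= th -> 2 * th < JY us ->
  (forall s, 0 <= s -> Num.min (JY (Pt s p)) (JY us - JY (Pt s p)) <= th) ->
  evading th p \/ evading th (fun x => us x - p x).
Proof.
move=> Dp th0 thJ hmin; have [Lp _] := Dp.
have [_ _ sc] := sg; have /cvg_right0P h := sc p Lp.
have [d dd hd] := h (JY us - 2 * th) ltac:(lra).
have cont s r : 0 <= s -> 0 <= r -> r < d ->
    `|JY (Pt (s + r) p) - JY (Pt s p)| < JY us - 2 * th.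
  move=> s0; rewrite le_eqVlt => /orP[/eqP <- _|r0 rd].
    by rewrite addr0 subrr normr0; lra.
  apply: le_lt_trans (hd r r0 rd); apply: le_trans (ler_norm _).
  apply: le_trans (sg_increment sg s0 (ltW r0) Lp).
  by apply: J_on_dist => //; apply: (sg_L1 sg) => //; rewrite addr_ge0// ltW.
have split2 s : 0 <= s -> JY (Pt s p) <= th \/ JY us - JY (Pt s p) <= th.
  by move=> /hmin; rewrite ge_min => /orP.
have [a0|a0] := split2 0 (lexx 0); [left|right]; split => //; try exact: dominated_compl.
  apply: (gap_stays (f := fun s => JY (Pt s p)) dd) => // s r s0 r0 rd hs.
  have := cont s r s0 r0 rd; have [//|] := split2 (s + r) (addr_ge0 s0 r0).
  by rewrite ltr_norml => k1 /andP[k2 k3]; lra.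
move=> s s0; rewrite J_on_compl//.
apply: (gap_stays (f := fun s => JY us - JY (Pt s p)) dd) => // {s0}s r s0 r0 rd hs.
have := cont s r s0 r0 rd; have [|//] := split2 (s + r) (addr_ge0 s0 r0).
by rewrite ltr_norml => k1 /andP[k2 k3]; lra.
Qed.

(** The orbit of [us - p] is [us - Pt s p]. A small overlap at time [t0 + s] bounds, through the
    constant [kappa], the smaller of the two masses on [Y] at time [s]. *)
Lemma overlap_evading p eps : dominated p ->
  (forall s, 0 <= s -> J (fun x => Num.min (Pt s p x) (us x - Pt s p x)) <= eps) ->
  forall s, 0 <= s -> Num.min (JY (Pt s p)) (JY us - JY (Pt s p)) <= eps / kappa.
Proof.
move=> Dp hJ s s0; have [Lp _] := Dp; have Lps := sg_L1 sg s0 Lp.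
have Dps := dominated_sg sg Lus fus s0 Dp.
rewrite ler_pdivlMr// mulrC -J_onB//.
have := overlap Lps (L1B Lus Lps) (dominated_nonneg Dps) (dominated_nonneg (dominated_compl Dps)).
move=> h; apply: (le_trans h); apply: le_trans (hJ (t0 + s) (addr_ge0 (ltW t00) s0)).
rewrite le_eqVlt; apply/orP; left; apply/eqP; have t0' := ltW t00.
have LP : L (Pt (t0 + s) p) by apply: (sg_L1 sg) => //; exact: addr_ge0.
apply: J_ae; [apply: L1_min; apply: (sg_L1 sg) => //; exact: L1B|apply: L1_min => //; exact: L1B|].
refine (AE2 (sgD sg t0' s0 Lp) (sg_compl t0' Lps) _) => x _ -> -> //.
Qed.

Context (Jus : J us = 1) (JYus : 0 < JY us).
Context (uniq : forall f, L f -> (forall t, 0 <= t -> Pt t f =ae f) -> f =ae (fun x => J f * us x)).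

Lemma no_persistent_overlap eta : 0 < eta ->
  ~ (forall eps, 0 < eps -> exists p, [/\ dominated p, eta <= J p, eta <= J (fun x => us x - p x) &
      forall s, 0 <= s -> J (fun x => Num.min (Pt s p x) (us x - Pt s p x)) <= eps]).
Proof.
move=> eta0 hex; apply: (no_escape sg mass Lus fus mY YE Jus JYus uniq eta0) => del del0.
(* A third of [JY us] leaves a gap between the two alternatives of [evading_dichotomy]. *)
pose th := Num.min del (JY us / 3).
have th0 : 0 < th by rewrite /th lt_min del0 divr_gt0.
have thd : th <= del by rewrite /th ge_min lexx.
have thJ : 2 * th < JY us.
  have : th <= JY us / 3 by rewrite /th ge_min lexx orbT.
  by lra.
have [p [Dp Jp Jp' hp]] := hex (kappa * th) (mulr_gt0 kappa0 th0).
have hp' := overlap_evading Dp hp; rewrite (_ : kappa * th / kappa = th) in hp'; last first.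
  by field; rewrite gt_eqF.
have [e|e] := evading_dichotomy Dp (ltW th0) thJ hp'.
  by exists p => //; exact: evading_weaken e.
by exists (fun x => us x - p x) => //; exact: evading_weaken e.
Qed.

End Decay.

(** * Decay of functions of integral 0 bounded by a multiple of us *)

Section BoundedDecay.
Context {R : realType} {d0 d1 : \bar R} {Pt : R -> (R -> R) -> R -> R}.
Context (sg : pos_sc_contraction_semigroup d0 d1 Pt).
Context (mass : forall t u, 0 <= t -> L1 d0 d1 u -> J d0 d1 (Pt t u) = J d0 d1 u).
Context {us : R -> R} (Lus : L1 d0 d1 us) (us0 : nonneg_ae d0 d1 us) (Jus : J d0 d1 us = 1).
Context (fus : forall t, 0 <= t -> aeE d0 d1 (Pt t us) us).
Local Notation L := (L1 d0 d1).
Local Notation J := (J d0 d1).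
Local Notation N := (norm1 d0 d1).
Local Notation "u =ae v" := (aeE d0 d1 u v) (at level 70).
Local Notation dominated := (@dominated R d0 d1 us).

(** Doubling [n] raises [t = min (n * a) u] by exactly [min t (u - t)], the overlap of [t] with its
    complement; passing from [t] to [w] costs at most [(y' - w) + (y' - t)], as both lie below
    [y']. *)
Lemma min_compl_le (a u w y' n : R) : 0 <= a -> 0 <= u -> 0 <= n -> w <= y' ->
  Num.min (n * a) u <= y' ->
  Num.min w (u - w) <= (Num.min (2 * n * a) u - Num.min (n * a) u) + (y' - w) +
                       (y' - Num.min (n * a) u).
Proof.
move=> a0 u0 n0 wy; have := mulr_ge0 n0 a0.
rewrite -mulrA; set b := n * a => b0.
have [bu|bu] := leP b u => by'.
  have [b2u|b2u] := leP (2 * b) u; first by apply: (@le_trans _ _ w); [rewrite ge_min lexx|lra].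
  by apply: (@le_trans _ _ (u - w)); [rewrite ge_min lexx orbT|lra].
have b2u : u <= 2 * b by lra.
rewrite (min_r b2u).
by apply: (@le_trans _ _ (u - w)); [rewrite ge_min lexx orbT|lra].
Qed.

Section OneFunction.
Context (f : R -> R) (C : R) (Lf : L f) (Jf : J f = 0) (C1 : 1 <= C).
Context (fC : AE d0 d1 (fun x => `|f x| <= C * us x)).

Let nu t := N (Pt t f).
Let a t x := Num.max (Pt t f x) 0.
Let b t x := Num.max (- Pt t f x) 0.

Let LP t : 0 <= t -> L (Pt t f). Proof. by move=> t0; exact: (sg_L1 sg). Qed.
Let La t : 0 <= t -> L (a t).
Proof. by move=> t0; apply: L1_max; [exact: LP|exact: L1_0]. Qed.
Let Lb t : 0 <= t -> L (b t).
Proof. by move=> t0; apply: L1_max; [apply: L1N; exact: LP|exact: L1_0]. Qed.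
Let a0 t x : 0 <= a t x. Proof. by rewrite /a le_max lexx orbT. Qed.
Let b0 t x : 0 <= b t x. Proof. by rewrite /b le_max lexx orbT. Qed.

(** The integral of [Pt t f] stays 0, so the two parts share its norm equally. *)
Let Jab t : 0 <= t -> J (a t) = nu t / 2 /\ J (b t) = nu t / 2.
Proof.
move=> t0; have La' := La t0; have Lb' := Lb t0.
have h1 : J (a t) + J (b t) = nu t.
  rewrite /nu norm1E -JD//; congr J; apply/funext => x; rewrite /a /b.
  by case: (ler0P (Pt t f x)) => h; rewrite ?(max_r _ h) ?(max_l (ltW h));
    [rewrite max_l ?add0r// oppr_ge0|rewrite max_r ?addr0// oppr_le0 ltW].
have h2 : J (a t) - J (b t) = 0.
  rewrite -JB// -[RHS](_ : J (Pt t f) = 0); last by rewrite mass.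
  congr J; apply/funext => x; rewrite /a /b.
  by rewrite /Num.max; case: ifPn; case: ifPn; lra.
by split; lra.
Qed.

Let PC t : 0 <= t -> AE d0 d1 (fun x => `|Pt t f x| <= C * us x).
Proof.
move=> t0; have op := sg_op sg t0; have pp := sg_pos sg t0.
have h1 := op_abs op pp Lf.
have h2 := op_le op pp (L1_abs Lf) (L1Z C Lus) fC.
have h3 : Pt t (fun x => C * us x) =ae (fun x => C * us x).
  by refine (AE2 (opZ op C Lus) (fus t0) _) => x _ -> ->.
by refine (AE3 h1 h2 h3 _) => x _ k1 k2 <-; exact: le_trans k1 k2.
Qed.

Let a_next s t : 0 <= s -> 0 <= t -> AE d0 d1 (fun x => a (s + t) x <= Pt s (a t) x).
Proof.
move=> s0 t0; have La' := La t0; have op := sg_op sg s0; have pp := sg_pos sg s0.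
have h1 : AE d0 d1 (fun x => Pt s (Pt t f) x <= Pt s (a t) x).
  by apply: (op_le op pp) => //; [exact: LP|apply: AE_all => x _; rewrite /a le_max lexx].
have h2 : nonneg_ae d0 d1 (Pt s (a t)) by apply: pp => //; exact: AE_all.
refine (AE3 h1 h2 (sgD sg s0 t0 Lf) _) => x _ k1 k2 k3.
by rewrite /a ge_max k2 k3 k1.
Qed.

Let nu_dec s t : 0 <= s -> 0 <= t -> nu (s + t) <= nu t.
Proof.
move=> s0 t0; rewrite /nu (norm1_ae _ _ (sgD sg s0 t0 Lf)).
- by apply: (sg_contr sg) => //; exact: LP.
- by apply: LP; exact: addr_ge0.
- by apply: (sg_L1 sg) => //; exact: LP.
Qed.

(** Cut at [us], a multiple of [a t] enters the order interval from 0 to [us]; large [n] brings it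
    close to [us] times the indicator of the set where [a t > 0]. *)
Let trunc (n t : R) x := Num.min (n * a t x) (us x).
Let Ltrunc n t : 0 <= t -> L (trunc n t).
Proof. by move=> t0; apply: L1_min => //; apply: L1Z; exact: La. Qed.
Let Dtrunc n t : 0 <= n -> 0 <= t -> dominated (trunc n t).
Proof.
move=> n0 t0; split; first exact: Ltrunc.
refine (AE1 us0 _) => x _ ux; rewrite /trunc le_min ux ge_min lexx orbT !andbT.
by rewrite mulr_ge0.
Qed.
Let m n t := J (trunc n t).

Let upper n s t x := Num.min (n * Pt s (a t) x) (us x).
Let Lupper n s t : 0 <= s -> 0 <= t -> L (upper n s t).
Proof. by move=> s0 t0; apply: L1_min => //; apply/L1Z/(sg_L1 sg) => //; exact: La. Qed.

Let trunc_upper n s t : 0 <= n -> 0 <= s -> 0 <= t ->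
  AE d0 d1 (fun x => trunc n (s + t) x <= upper n s t x).
Proof.
move=> n0 s0 t0; refine (AE1 (a_next s0 t0) _) => x _ h.
rewrite /trunc /upper le_min !ge_min lexx orbT andbT ler_wpM2l//.
Qed.

Let sg_trunc_upper n s t : 0 <= n -> 0 <= s -> 0 <= t ->
  AE d0 d1 (fun x => Pt s (trunc n t) x <= upper n s t x).
Proof.
move=> n0 s0 t0; have La' := La t0; have op := sg_op sg s0; have pp := sg_pos sg s0.
have Lt := Ltrunc n t0.
have h1 : AE d0 d1 (fun x => Pt s (trunc n t) x <= Pt s (fun x => n * a t x) x).
  by apply: (op_le op pp) => //; [exact: L1Z|apply: AE_all => x _; rewrite ge_min lexx].
have h2 : AE d0 d1 (fun x => Pt s (trunc n t) x <= Pt s us x).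
  by apply: (op_le op pp) => //; apply: AE_all => x _; rewrite ge_min lexx orbT.
have h3 : AE d0 d1 (fun x => Pt s (trunc n t) x <= us x).
  by refine (AE2 h2 (fus s0) _) => x _ k <-.
by refine (AE3 h1 h3 (opZ op n La') _) => x _ k1 k2 k3; rewrite /upper le_min k2 andbT -k3.
Qed.

(** [Pt s (a t)] exceeds [a (s + t)] by a nonnegative function whose integral is half of the drop of
    [nu], and cutting [n] times a function at [us] is [n]-Lipschitz. *)
Let J_upper n s t : 0 <= n -> 0 <= s -> 0 <= t ->
  J (upper n s t) <= m n (s + t) + n * ((nu t - nu (s + t)) / 2).
Proof.
move=> n0 s0 t0; have st0 := addr_ge0 s0 t0.
have La' := La t0; have La'' := La st0; have LPa := sg_L1 sg s0 La'.
have [Ja _] := Jab t0; have [Ja' _] := Jab st0.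
have -> : n * ((nu t - nu (s + t)) / 2) = n * J (fun x => Pt s (a t) x - a (s + t) x).
  by rewrite JB// mass// Ja Ja'; congr (_ * _); field.
rewrite -JZ; last exact: L1B.
rewrite -JD; [|exact: Ltrunc|by apply: L1Z; exact: L1B].
apply: J_le; [exact: Lupper|by apply: L1D; [exact: Ltrunc|apply: L1Z; exact: L1B]|].
refine (AE1 (a_next s0 t0) _) => x _ h; have := ler_wpM2l n0 h; rewrite mulrBr /upper /trunc.
rewrite /Num.min; case: ifPn; case: ifPn; lra.
Qed.

Let J_min_compl n s t : 0 <= n -> 0 <= s -> 0 <= t ->
  J (fun x => Num.min (Pt s (trunc n t) x) (us x - Pt s (trunc n t) x)) <=
    (m (2 * n) (s + t) - m n (s + t)) + (J (upper n s t) - m n t) +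
    (J (upper n s t) - m n (s + t)).
Proof.
move=> n0 s0 t0; have st0 := addr_ge0 s0 t0.
have Lt := Ltrunc n t0; have LPt := sg_L1 sg s0 Lt; have Lt2 := Ltrunc (2 * n) st0.
have Lt' := Ltrunc n st0; have Lu := Lupper n s0 t0.
(* Mass conservation lets [m n t] stand for the integral of [Pt s (trunc n t)]. *)
rewrite -[m n t](mass s0 Lt) -!JB// -JD; [|exact: L1B|exact: L1B].
rewrite -JD; [|by apply: L1D; exact: L1B|exact: L1B].
apply: J_le; first by apply: L1_min => //; exact: L1B.
  by apply: L1D; [apply: L1D; exact: L1B|exact: L1B].
refine (AE3 us0 (trunc_upper n0 s0 t0) (sg_trunc_upper n0 s0 t0) _) => x _ ux h1 h2.
exact: min_compl_le.
Qed.

(** From [|Pt t f| <= C * us] follow [a t / C <= trunc n t] and, as [b t] vanishes where [a t] does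
    not, [b t / C <= us - trunc n t]. The bounds are uniform in [n], which leaves the cut-off free
    to be chosen later. *)
Let J_trunc_ge n t : 1 <= n -> 0 <= t ->
  nu t / (2 * C) <= J (trunc n t) /\ nu t / (2 * C) <= J (fun x => us x - trunc n t x).
Proof.
move=> n1 t0; have C0 := lt_le_trans ltr01 C1.
have [Ja Jb] := Jab t0; have La' := La t0; have Lb' := Lb t0; have Lt := Ltrunc n t0.
have e r : r / (2 * C) = C^-1 * (r / 2) by field; rewrite gt_eqF.
split; rewrite e.
  rewrite -Ja -JZ//; apply: J_le => //; first exact: L1Z.
  refine (AE2 us0 (PC t0) _) => x _ ux h; rewrite /trunc le_min; apply/andP; split.
    by rewrite ler_wpM2r// (le_trans _ n1)// invf_le1.
  rewrite ler_pdivrMl// /a ge_max (le_trans (ler_norm _) h)/=.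
  by rewrite mulr_ge0// ltW.
rewrite -Jb -JZ//; apply: J_le; [exact: L1Z|exact: L1B|].
refine (AE2 us0 (PC t0) _) => x _ ux h; rewrite ler_pdivrMl// /b /trunc /a.
have [p0|p0] := leP (Pt t f x) 0.
  rewrite mulr0 min_l// subr0 ge_max; apply/andP; split.
    by apply: le_trans h; rewrite -normrN ler_norm.
  by rewrite mulr_ge0// ltW.
rewrite (max_r (_ : - Pt t f x <= 0)); last by rewrite oppr_le0 ltW.
by apply: mulr_ge0; [exact: ltW|rewrite subr_ge0 ge_min lexx orbT].
Qed.
Context (nopo : forall eta, 0 < eta ->
  ~ (forall eps, 0 < eps -> exists p, [/\ dominated p, eta <= J p, eta <= J (fun x => us x - p x) &
      forall s, 0 <= s -> J (fun x => Num.min (Pt s p x) (us x - Pt s p x)) <= eps])).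

Lemma bounded_decay e : 0 < e -> exists2 t, 0 <= t & N (Pt t f) < e.
Proof.
move=> e0; apply: contrapT => hno.
have nu_e t : 0 <= t -> e <= nu t.
  by move=> t0; rewrite leNgt; apply/negP => h; apply: hno; exists t.
pose V := [set nu t | t in [set t | 0 <= t]].
have V0 : has_inf V.
  split; first by exists (nu 0); exists 0 => /=.
  by exists e => _ [t t0 <-]; exact: nu_e.
pose c := inf V.
have cnu t : 0 <= t -> c <= nu t.
  by move=> t0; apply: ge_inf; [case: V0|exists t].
have ec : e <= c by apply: lb_le_inf; [case: V0|move=> _ [t t0 <-]; exact: nu_e].
pose ep t := (nu t - c) / 2.
have ep0 t : 0 <= t -> 0 <= ep t by move=> /cnu; rewrite /ep; lra.
have ep_dec s t : 0 <= s -> 0 <= t -> ep (s + t) <= ep t.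
  by move=> s0 t0; have := nu_dec s0 t0; rewrite /ep; lra.
have ep_small d : 0 < d -> exists2 t, 0 <= t & ep t < d.
  move=> dd; have [_ [t t0 <-] h] := inf_adherent dd V0; exists t => //.
  by move: h; rewrite -/c /ep; lra.
pose pw j := (2 : R) ^+ j.
have pw1 j : 1 <= pw j by rewrite /pw exprn_ege1// ler1n.
have pw0 j : 0 <= pw j by apply: le_trans (pw1 j).
(* F j is nondecreasing in t and bounded by 1; T j is its limit, and T j.+1 - T j is small for
   some j, which makes min(2^j a t, us) almost stationary under doubling of the cut-off. *)
pose F j t := m (pw j) t - pw j * ep t.
have F_inc j s t : 0 <= s -> 0 <= t -> F j t <= F j (s + t).
  move=> s0 t0; have Lt := Ltrunc (pw j) t0.
  have := J_upper (pw0 j) s0 t0.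
  have : m (pw j) t <= J (upper (pw j) s t).
    rewrite -[m _ _](mass s0 Lt); apply: J_le; [exact: (sg_L1 sg)|exact: Lupper|].
    exact: sg_trunc_upper.
  by rewrite /F /ep !mulrA; lra.
have F1 j t : 0 <= t -> F j t <= 1.
  move=> t0; apply: (@le_trans _ _ (m (pw j) t)); first by rewrite gerBl mulr_ge0// ep0.
  rewrite -Jus; apply: J_le => //; first exact: Ltrunc.
  by apply: AE_all => x _; rewrite ge_min lexx orbT.
pose T j := sup [set F j t | t in [set t | 0 <= t]].
have hsT j : has_sup [set F j t | t in [set t | 0 <= t]].
  split; first by exists (F j 0); exists 0 => /=.
  by exists 1 => _ [t t0 <-]; exact: F1.
have FT j t : 0 <= t -> F j t <= T j.
  by move=> t0; apply: ub_le_sup; [case: (hsT j)|exists t].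
have T1 j : T j <= 1 by apply: ge_sup; [case: (hsT j)|move=> _ [t t0 <-]; exact: F1].
have C0 := lt_le_trans ltr01 C1.
apply: (nopo (eta := c / (2 * C))).
  by rewrite divr_gt0 ?mulr_gt0//; lra.
(* The three terms of [J_min_compl] will total at most [3 * d + pw j * ep t], well within
   [6 * d]. *)
move=> eps eps0; pose d := eps / 6; have dd : 0 < d by rewrite divr_gt0.
(* The [T j] are bounded by 1, so they cannot grow by more than [d] at every step. *)
have [j hj] : exists j, T j.+1 <= T j + d.
  apply: contrapT => hn.
  have grow k : T 0%N + k%:R * d <= T k.
    elim: k => [|k IH]; first by rewrite mul0r addr0.
    have : T k + d < T k.+1 by rewrite ltNge; apply/negP => h; apply: hn; exists k.
    by rewrite -addn1 natrD mulrDl mul1r; lra.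
  pose k := (Num.truncn ((1 - T 0%N) / d)).+1.
  have : (1 - T 0%N) / d < k%:R by exact: truncnS_gt.
  rewrite ltr_pdivrMr// => h; have := grow k; have := T1 k; lra.
(* [t1] brings [F j] within [d] of its limit and [t2] makes [ep] small; both properties persist at
   later times, hence hold at [t1 + t2]. *)
have [_ [t1 t10 <-] h1] := sup_adherent dd (hsT j).
have [t2 t20 h2] := ep_small (d / (2 * pw j)) ltac:(by rewrite divr_gt0// mulr_gt0// (lt_le_trans ltr01)).
pose t := t1 + t2; have t0 : 0 <= t by exact: addr_ge0.
have Ft : T j - d <= F j t.
  by rewrite /t (addrC t1); apply: le_trans (F_inc _ _ _ t20 t10); exact: ltW.
have et : 2 * (pw j * ep t) <= d.
  have : ep t < d / (2 * pw j) by apply: le_lt_trans h2; exact: ep_dec.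
  rewrite ltr_pdivlMr; last by rewrite mulr_gt0// (lt_le_trans ltr01).
  by move=> /ltW; rewrite (_ : ep t * _ = 2 * (pw j * ep t))//; ring.
have [k1 k2] := J_trunc_ge (pw1 j) t0.
have cC : c / (2 * C) <= nu t / (2 * C).
  by rewrite ler_wpM2r ?invr_ge0 ?cnu//; lra.
exists (trunc (pw j) t); split; [exact: Dtrunc|exact: le_trans k1|exact: le_trans k2|].
move=> s s0; apply: le_trans (J_min_compl (pw0 j) s0 t0) _.
have st0 := addr_ge0 s0 t0.
have p2 : 2 * pw j = pw j.+1 by rewrite /pw exprS.
have q1 := FT j.+1 _ st0; have q2 := FT j _ st0.
have q3 := F_inc j _ _ s0 t0; have q4 := J_upper (pw0 j) s0 t0.
have q5 := ep_dec _ _ s0 t0.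
have q6 := ler_wpM2l (pw0 j) q5.
have q7 := mulr_ge0 (pw0 j) (ep0 _ st0).
have q8 : pw j * ((nu t - nu (s + t)) / 2) = pw j * ep t - pw j * ep (s + t).
  by rewrite /ep; field.
move: q1 q2 q3; rewrite /F -p2 -mulrA /F => q1 q2 q3; rewrite /F in Ft.
have -> : eps = 6 * d by rewrite /d; field.
lra.
Qed.

End OneFunction.

End BoundedDecay.

(** * Convergence to the invariant density *)

Section Stability.
Context {R : realType} {d0 d1 : \bar R} {g phi : R -> R}.
Context {P : (R -> R) -> R -> R} {Pt : R -> (R -> R) -> R -> R}.
Context (M : flow_model d0 d1 g phi) (sP : stochastic_op d0 d1 P).
Context (mS : minimal_semigroup d0 d1 g phi P Pt).
Local Notation E := (Eset d0 d1).
Local Notation L := (L1 d0 d1).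
Local Notation J := (J d0 d1).
Local Notation N := (norm1 d0 d1).
Local Notation "u =ae v" := (aeE d0 d1 u v) (at level 70).
Let sg := proj1 mS.

Lemma lebm_below_gt0 x : E x -> (0 < lebm R (@below R d0 x))%E.
Proof.
move=> Ex.
have : \forall z \near x, E z by exact: open_nbhs_nbhs (conj (@open_Eset R d0 d1) Ex).
move=> /nbhs_ballP[d /= d0' hd]; pose a := x - d / 2.
have ax : a < x by rewrite /a gtrBl divr_gt0.
have Ea : E a.
  apply: hd; rewrite /ball /= /a opprB addrC subrK gtr0_norm ?divr_gt0//.
  by rewrite ltr_pdivrMr// ltr_pMr// ltr1n.
have sub : `]a, x[%classic `<=` @below R d0 x.
  move=> y /=; rewrite in_itv /= => /andP[ay yx]; split => //.
  by apply: lt_trans Ea.1 _; rewrite lte_fin.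
apply: (@lt_le_trans _ _ (lebm R `]a, x[%classic)); last first.
  by apply: le_measure; rewrite ?inE//; exact: mbelow.
by rewrite [lebm R _]lebesgue_measure_itv /= lte_fin ax -EFinD lte_fin subr_gt0.
Qed.

Lemma R0_gt0 v : L v -> pos_ae d0 d1 v -> forall x, E x -> 0 < R0 d0 d1 g phi v x.
Proof.
move=> Lv v0 x Ex; rewrite R0E; apply: (Rlam_gt0 M) => //.
  by refine (AE1 v0 _) => y _ /ltW.
rewrite /tail -(J_restrict v (below_sub Ex)); apply: J_on_gt0 => //.
- exact: mbelow.
- exact: below_sub.
- exact: lebm_below_gt0.
Qed.

Lemma J_gt0 h : L h -> pos_ae d0 d1 h -> 0 < J h.
Proof.
move=> Lh h0; have [c Ec] := exists_between (fm_itv M).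
have := J_on_gt0 (mbelow c) (below_sub Ec) Lh h0 (lebm_below_gt0 Ec).
move=> /lt_le_trans; apply; apply: J_le => //.
  by apply: L1_restrict => //; [exact: mbelow|exact: below_sub].
by refine (AE1 h0 _) => x _ /ltW hx; rewrite patchE; case: ifP.
Qed.

Context (mass : forall t u, 0 <= t -> L u -> J (Pt t u) = J u).

(** The distance from [Pt t u] to [us] is nonincreasing in [t], so one good time for each [e]
    suffices. It comes from splitting [u] into a remainder of small mass, a function [f] of integral
    0 bounded by a multiple of [us], and [J v * us]. *)
Lemma stable us : density d0 d1 us -> pos_ae d0 d1 us ->
  (forall t, 0 <= t -> Pt t us =ae us) -> partially_integral d0 d1 Pt ->
  asympt_stable_with d0 d1 Pt us.
Proof.
move=> Dus pus fus pint; split => // u [Lu [u0 nu]].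
have [Lus [us0 nus]] := Dus; have Jus := nus; rewrite norm1_nonneg// in Jus.
rewrite norm1_nonneg// in nu.
have [t0 [Y [kappa [t00 [mY YE] muY kappa0 ov]]]] := exists_small_set sg pint.
have JY := J_on_gt0 mY YE Lus pus muY.
have uniq f := @fixed_unique _ _ _ _ _ _ _ M sP mS mass us f Dus fus.
have nopo := no_persistent_overlap sg mass Lus fus mY YE t00 kappa0 ov Jus JY uniq.
have small e : 0 < e -> exists2 t, 0 <= t & N (fun x => Pt t u x - us x) < e.
  move=> e0; have e4 : 0 < e / 4 by rewrite divr_gt0.
  have [C C0 hC] := truncation_small Lu u0 Lus pus e4.
  pose v x := Num.min (u x) (C * us x).
  have Lv : L v by apply: L1_min => //; exact: L1Z.
  have Luv : L (fun x => u x - v x) by exact: L1B.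
  have v0 : nonneg_ae d0 d1 v.
    by refine (AE2 u0 us0 _) => x _ h1 h2; rewrite /v le_min h1 mulr_ge0 ?(ltW C0).
  have uv0 : nonneg_ae d0 d1 (fun x => u x - v x).
    by apply: AE_all => x _; rewrite subr_ge0 ge_min lexx.
  have Jv0 := J_ge0 Lv v0.
  have Juv : 1 - J v < e / 4 by have := JB Lu Lv; rewrite nu => <-.
  have Jv1 : J v <= 1 by have := J_ge0 Luv uv0; rewrite JB// nu subr_ge0.
  pose f x := v x - J v * us x.
  have Lf : L f by apply: L1B => //; exact: L1Z.
  have Jf : J f = 0 by rewrite JB ?JZ ?Jus ?mulr1 ?subrr//; exact: L1Z.
  (* [v <= C * us] and [J v * us <= us] give the bound [C + 1], which is also at least 1 as
     [bounded_decay] asks. *)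
  have C1 : 1 <= C + 1 by rewrite lerDr ltW.
  have fC : AE d0 d1 (fun x => `|f x| <= (C + 1) * us x).
    refine (AE2 v0 us0 _) => x _ vx ux; have : v x <= C * us x by rewrite ge_min lexx orbT.
    have : J v * us x <= us x by rewrite ler_piMl.
    have : 0 <= J v * us x by rewrite mulr_ge0.
    by rewrite /f ler_norml mulrDl mul1r => k1 k2 k3; apply/andP; split; lra.
  have [t t0' ht] := bounded_decay sg mass Lus us0 Jus fus Lf Jf C1 fC nopo e4.
  exists t => //; have op := sg_op sg t0'.
  have Lr : L (fun x => (J v - 1) * us x) by exact: L1Z.
  have LPuv := sg_L1 sg t0' Luv; have LPf := sg_L1 sg t0' Lf.
  have e1 : (fun x => Pt t u x - us x) =ae
      (fun x => Pt t (fun x => u x - v x) x + Pt t f x + (J v - 1) * us x).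
    have k1 := opB op Lu Lv; have k2 := opB op Lv (L1Z (J v) Lus).
    have k3 : Pt t (fun x => J v * us x) =ae (fun x => J v * us x).
      by refine (AE2 (opZ op (J v) Lus) (fus t t0') _) => x _ -> ->.
    by refine (AE3 k1 k2 k3 _) => x _ -> -> ->; ring.
  rewrite (norm1_ae _ _ e1); first last.
  - by apply: L1D => //; exact: L1D.
  - by apply: L1B => //; exact: (sg_L1 sg).
  apply: le_lt_trans (norm1D (L1D LPuv LPf) Lr) _.
  have := norm1D LPuv LPf; have := sg_contr sg t0' Luv.
  rewrite (norm1_nonneg Luv uv0) JB// nu norm1Z// nus mulr1 ler0_norm; last by lra.
  lra.
apply/cvgrPdist_lt => e e0; have [t1 t10 ht1] := small e e0.
exists t1; split; first exact: num_real.
move=> t t1t; rewrite /= sub0r normrN.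
have tt0 : 0 <= t - t1 by rewrite subr_ge0 ltW.
have t0' : 0 <= t := le_trans t10 (ltW t1t).
have LP1 := sg_L1 sg t10 Lu; have LPt := sg_L1 sg t0' Lu.
have Ld : L (fun x => Pt t1 u x - us x) by exact: L1B.
rewrite ger0_norm ?norm1_ge0//; last exact: L1B.
apply: le_lt_trans ht1; apply: le_trans (sg_contr sg tt0 Ld).
rewrite le_eqVlt; apply/orP; left; apply/eqP; apply: norm1_ae.
- exact: L1B.
- exact: (sg_L1 sg).
have k1 := sgD sg tt0 t10 Lu; rewrite subrK in k1.
by refine (AE3 k1 (opB (sg_op sg tt0) LP1 Lus) (fus _ tt0) _) => x _ -> -> ->.
Qed.

Lemma R0_stable vs : invariant_op d0 d1 (Kop d0 d1 g phi P) vs -> pos_ae d0 d1 vs ->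
  partially_integral d0 d1 Pt -> L (R0 d0 d1 g phi vs) ->
  asympt_stable_with d0 d1 Pt
    (fun x => R0 d0 d1 g phi vs x / N (R0 d0 d1 g phi vs)).
Proof.
move=> ivs vs0 pint LR; have Lvs := ivs.1.1.
have R0p : pos_ae d0 d1 (R0 d0 d1 g phi vs) by apply: AE_all; exact: R0_gt0.
have R00 : nonneg_ae d0 d1 (R0 d0 d1 g phi vs) by refine (AE1 R0p _) => x _ /ltW.
have JR := J_gt0 LR R0p; pose c := (J (R0 d0 d1 g phi vs))^-1.
rewrite (norm1_nonneg LR R00) (_ : (fun x => _) = fun x => c * R0 d0 d1 g phi vs x);
  last by apply/funext => x; rewrite mulrC.
apply: stable => //; first exact: density_scale.
  by refine (AE1 R0p _) => x _ h; rewrite mulr_gt0 ?invr_gt0.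
move=> t t0; refine (AE2 (opZ (sg_op sg t0) c LR) (R0_fixed M sP mS ivs LR t0) _) => x _ -> -> //.
Qed.

End Stability.

Unset Implicit Arguments.

Theorem theorem5p1 (R : realType) (d0 d1 : \bar R) (g phi : R -> R)
    (P : (R -> R) -> (R -> R)) (Pt : R -> (R -> R) -> (R -> R)) :
  (d0 < d1)%E ->
  {within Eset d0 d1, continuous g} ->
  (forall x, Eset d0 d1 x -> 0 < g x) ->
  measurable_fun (Eset d0 d1) phi ->
  (forall x, Eset d0 d1 x -> 0 <= phi x) ->
  (forall C : set R, compact C -> C `<=` Eset d0 d1 ->
     (lebm R).-integrable C (EFin \o phi)) ->
  G_infinite d0 d1 g ->
  Q_infinite d0 d1 g phi ->
  stochastic_op d0 d1 P ->
  minimal_semigroup d0 d1 g phi P Pt ->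
  (forall vs : R -> R,
     invariant_op d0 d1 (Kop d0 d1 g phi P) vs -> pos_ae d0 d1 vs ->
     stochastic_semigroup d0 d1 Pt /\
     (partially_integral d0 d1 Pt -> L1 d0 d1 (R0 d0 d1 g phi vs) ->
      asympt_stable_with d0 d1 Pt
        (fun x => R0 d0 d1 g phi vs x / norm1 d0 d1 (R0 d0 d1 g phi vs)))) /\
  (forall us : R -> R,
     invariant_sg d0 d1 Pt us -> inDA d0 d1 g phi us ->
     invariant_op d0 d1 (Kop d0 d1 g phi P)
       (fun x => P (fun y => phi y * us y) x / norm1 d0 d1 (fun y => phi y * us y))).
Proof.
move=> d01 cg g0 mphi phi0 phiC Ginf Qinf sP mS.
have M := FlowModel d01 cg g0 mphi phi0 phiC Ginf Qinf.
split=> [vs ivs vs0|us]; last exact: (Kop_invariant M sP mS).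
split; first exact: (sg_stochastic M sP mS ivs vs0).
exact: (R0_stable M sP mS (sg_mass M sP mS ivs vs0) ivs vs0).
Qed.
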